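(* Let $d\ge 1$, $\mu>0$, $\beta>0$, $t_\iota\in\mathbb{R}$, and let $U\colon[t_\iota,\infty)\times\mathbb{R}^d\to\mathbb{R}_+$, $(t,q)\mapsto U_t(q)$, be a sufficiently regular and confining time-dependent potential (in the sense of the standing assumptions in the context). Let $\mathtt{p}_t(q)$ be the solution, for $t\ge t_\iota$ and $q\in\mathbb{R}^d$, of the Fokker-Planck equation $$\partial_t \mathtt{p}_t(q)-\mu\,\big\langle \partial_q,\ (\partial U_t)(q)\,\mathtt{p}_t(q)\big\rangle-\frac{\mu}{\beta}\,\partial_q^2\,\mathtt{p}_t(q)=0$$ with initial datum a probability density $\mathtt{p}_{t_\iota}$ at time $t_\iota$. Then for every $t\ge t_\iota$ and $q\in\mathbb{R}^d$, $$\mathtt{p}_t(q)=e^{-\beta U_t(q)}\ \mathrm{E}_{\mathcal{P}^\flat}\!\left(\mathtt{p}_{t_\iota}(\mathscr{q}_{t_\iota})\,\exp\Big(\beta\,U_{t_\iota}(\mathscr{q}_{t_\iota})+\beta\int_{t_\iota}^t \partial_sU_s(\mathscr{q}_s)\,ds\Big)\ \Big|\ \mathscr{q}_t=q\right),$$ where $\mathcal{P}^\flat$ is the probability measure over the paths of the backward diffusion process $$d^\flat \mathscr{q}_s=\mu\,(\partial U_s)(\mathscr{q}_s)\,ds+\sqrt{\frac{2\mu}{\beta}}\,d^\flat w_s .$$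
   Context: Notation: $\partial U_t$ is the gradient of $U_t$ in the space variable, $\partial_sU_s(q)$ is the partial derivative with respect to time at fixed $q$, $\langle\partial_q,\cdot\rangle$ is the divergence, $\partial_q^2$ is the Laplacian, and $\langle\cdot,\cdot\rangle$ is the Euclidean inner product. Backward diffusion: $w$ is a standard $d$-dimensional Wiener process, and the backward differentials are $d^\flat \mathscr{q}_s=\mathscr{q}_s-\mathscr{q}_{s-ds}$, $d^\flat w_s=w_s-w_{s-ds}$. The process is run backward in time from a condition assigned at the later time: conditioned on $\mathscr{q}_t=q$, it solves $$\mathscr{q}_s=q-\int_s^t\mu\,(\partial U_r)(\mathscr{q}_r)\,dr-\sqrt{\frac{2\mu}{\beta}}\,(w_t-w_s),\qquad s\in[t_\iota,t],$$ and is adapted to the backward filtration in which the $\sigma$-algebra at time $s$ is generated by $\{w_t-w_r : s\le r\le t\}$. Standing assumptions: $U$ is sufficiently regular and confining. This is understood to guarantee that the Fokker-Planck equation has a (sufficiently regular) solution fully specified by its initial datum and integrable over $\mathbb{R}^d$, that the backward stochastic differential equation is well posed, and the integrability needed for the following process to be a true (not merely local) martingale with respect to the backward filtration: $s\mapsto e^{\beta\int_s^t\partial_rU_r(\mathscr{q}_r)dr}\,e^{\beta U_s(\mathscr{q}_s)}\,\mathtt{p}_s(\mathscr{q}_s)$, $s\in[t_\iota,t]$. *)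

(* Defs.v *)
From HB Require Import structures.
From mathcomp Require Import all_boot all_order all_algebra.
From mathcomp Require Import all_classical all_reals all_analysis.

Set Implicit Arguments.
Unset Strict Implicit.
Unset Printing Implicit Defensive.

Import Order.TTheory GRing.Theory Num.Theory.
Import numFieldNormedType.Exports.

Local Open Scope classical_set_scope.
Local Open Scope ring_scope.

Section calculus.
Context {R : realType} {d : nat}.
Implicit Types (f : 'rV[R]_d -> R) (F : 'rV[R]_d -> 'rV[R]_d)
  (g : R -> 'rV[R]_d -> R) (I : set R) (s : R) (x : 'rV[R]_d) (i j : 'I_d).

Definition partial i f x : R := 'D_(delta_mx 0 i) f x.

Definition grad f x : 'rV[R]_d := \row_i partial i f x.

Definition divergence F x : R := \sum_i partial i (fun y => F y 0 i) x.

Definition laplacian f x : R := divergence (grad f) x.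

(* Two-sided derivative: not meaningful at the left endpoint of the time
   domain; below it occurs at interior times only, or under a time integral. *)
Definition time_deriv g s x : R := derive1 (g^~ x) s.

Definition jointly_continuous I g : Prop :=
  {within [set z : R * 'rV[R]_d | I z.1],
     continuous (fun z : R * 'rV[R]_d => g z.1 z.2)}.

Definition C2_in_space I g : Prop :=
  [/\ forall s x i, I s -> derivable (g s) x (delta_mx 0 i),
      forall s x i j, I s -> derivable (partial i (g s)) x (delta_mx 0 j),
      forall i, jointly_continuous I (fun s => partial i (g s)) &
      forall i j,
        jointly_continuous I (fun s => partial j (partial i (g s)))].

Definition C1_in_time I g : Prop :=
  (forall s x, I s -> derivable (g^~ x) s 1) /\
  jointly_continuous I (time_deriv g).

End calculus.

(* Iterated Lebesgue integral over R^d. It is only applied to nonnegative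
   continuous functions, for which it is the Lebesgue integral (Tonelli). *)
Fixpoint integral_rV {R : realType} (d : nat) :
    ('rV[R]_d -> \bar R) -> \bar R :=
  match d return ('rV[R]_d -> \bar R) -> \bar R with
  | 0%N => fun f => f 0
  | n.+1 => fun f => (\int[lebesgue_measure]_(x in [set: R])
      integral_rV (fun y : 'rV[R]_n => f (row_mx (x%:M : 'rV[R]_1) y)))%E
  end.

Section potential_and_density.
Context {R : realType} {d : nat}.
Implicit Types (U p : R -> 'rV[R]_d -> R) (rho : 'rV[R]_d -> R).

(* The time derivative has a continuous extension to the initial time; by the
   mean value theorem the extension is then the one-sided derivative there. *)
Definition regular_potential (t0 : R) U : Prop :=
  [/\ jointly_continuous `[t0, +oo[ U,
      C2_in_space `[t0, +oo[ U &
      exists2 dU : R -> 'rV[R]_d -> R, jointly_continuous `[t0, +oo[ dU &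
        forall s x, t0 < s -> is_derive s 1 (U^~ x) (dU s x)].

Definition confining (t0 : R) U : Prop :=
  forall s, t0 <= s ->
    forall A : R, exists r : R, forall x, r <= `|x| -> A <= U s x.

Definition probability_density rho : Prop :=
  (forall x, 0 <= rho x) /\ integral_rV (fun x => (rho x)%:E) = 1%E.

(* Classical solution: continuous up to the initial time, C^{1,2} afterwards. *)
Definition Fokker_Planck_solution (mu beta t0 : R) U p : Prop :=
  [/\ jointly_continuous `[t0, +oo[ p,
      C1_in_time `]t0, +oo[ p,
      C2_in_space `]t0, +oo[ p &
      forall s x, t0 < s ->
        time_deriv p s x
        - mu * divergence (fun y => p s y *: grad (U s) y) x
        - mu / beta * laplacian (p s) x = 0].

Definition integrable_in_space (t0 : R) p : Prop :=
  forall s, t0 <= s -> (integral_rV (fun x => `|p s x|%:E) < +oo)%E.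

End potential_and_density.

Section processes.
Context {R : realType} {d : nat} {disp : measure_display}
  {T : measurableType disp} (P : probability T R).
Implicit Types (w Q : R -> T -> 'rV[R]_d).

(* The sets A i may be setT, so the product rule for the whole family gives it
   for every subfamily. *)
Definition mutually_independent (I : finType) (X : I -> T -> R) : Prop :=
  forall A : I -> set R, (forall i, measurable (A i)) ->
    P (\bigcap_(i in [set: I]) (X i @^-1` A i)) =
    (\prod_(i : I) P (X i @^-1` A i))%E.

Definition has_normal_law (X : T -> R) (variance : R) : Prop :=
  forall A : set R, measurable A ->
    P (X @^-1` A) = normal_prob 0 (Num.sqrt variance) A.

Definition increment w (r s : R) (i : 'I_d) : T -> R :=
  fun o => w s o 0 i - w r o 0 i.

(* Standard d-dimensional Wiener process on [t0, +oo[, started from 0. *)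
Definition standard_Wiener (t0 : R) w : Prop :=
  [/\ forall s i, t0 <= s -> measurable_fun setT (fun o => w s o 0 i),
      {ae P, forall o, w t0 o = 0},
      {ae P, forall o, {within `[t0, +oo[, continuous (w^~ o)}},
      forall (r s : R) (i : 'I_d), t0 <= r -> r < s ->
        has_normal_law (increment w r s i) (s - r) &
      forall (n : nat) (s : nat -> R), t0 <= s 0%N ->
        (forall k, s k < s k.+1) ->
        mutually_independent
          (fun ki : 'I_n * 'I_d => increment w (s ki.1) (s ki.1.+1) ki.2)].

(* Sigma-algebra at time s generated by w_t - w_r, s <= r <= t: it grows as s
   decreases. *)
Definition backward_filtration w (t s : R) : set (set T) :=
  <<s [set E | exists (r : R) (i : 'I_d) (B : set R),
        [/\ s <= r <= t, measurable B & E = increment w r t i @^-1` B]] >>.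

(* Q is the process conditioned on Q_t = q: it solves, backward from (t, q),
     d^b Q_s = mu (grad U_s)(Q_s) ds + sqrt (2 mu / beta) d^b w_s. *)
Record backward_diffusion (mu beta t0 : R) (U : R -> 'rV[R]_d -> R) w
    (t : R) (q : 'rV[R]_d) Q : Prop := {
  diffusion_continuous : forall o, {within `[t0, t], continuous (Q^~ o)} ;
  diffusion_adapted : forall s i (B : set R), t0 <= s <= t -> measurable B ->
    backward_filtration w t s ((fun o => Q s o 0 i) @^-1` B) ;
  diffusion_equation : {ae P, forall o, forall s, t0 <= s <= t ->
    Q s o = q
      - \row_i (\int[lebesgue_measure]_(r in `[s, t])
                  (mu * grad (U r) (Q r o) 0 i))
      - Num.sqrt (2 * mu / beta) *: (w t o - w s o)} }.

(* Time runs backward, so "already stopped at s" is the event s <= tau. *)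
Definition backward_stopping_time (t0 : R) w (t : R) (tau : T -> R) : Prop :=
  (forall o, t0 <= tau o <= t) /\
  (forall s, t0 <= s <= t ->
     backward_filtration w t s [set o | s <= tau o]).

Definition uniformly_integrable (F : set (T -> R)) : Prop :=
  (forall X, F X -> P.-integrable setT (EFin \o X)) /\
  (forall e : R, 0 < e -> exists K : R, forall X, F X ->
     (\int[P]_(o in [set o | (K < `|X o|)%R]) `|X o|%:E <= e%:E)%E).

(* Class (D) on [t0, t]: for a continuous local martingale this is exactly the
   integrability that makes it a true martingale. *)
Definition class_D (t0 : R) w (t : R) (M : R -> T -> R) : Prop :=
  uniformly_integrable
    [set X | exists2 tau : T -> R, backward_stopping_time t0 w t tau &
             X = (fun o => M (tau o) o)].

End processes.

Definition weighted_density {R : realType} {d : nat} {T : Type} (beta : R)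
    (U p : R -> 'rV[R]_d -> R) (t : R) (Q : R -> T -> 'rV[R]_d)
    (s : R) (o : T) : R :=
  expR (beta * \int[lebesgue_measure]_(r in `[s, t]) time_deriv U r (Q r o))
  * expR (beta * U s (Q s o)) * p s (Q s o).

(* Main.v *)
(* Put f_s = exp (beta U_s) p_s and let M be the process of the class (D)
   hypothesis. The Fokker-Planck equation becomes the backward equation of the
   diffusion with the zero-order term beta (d_s U) f, so M is formally a backward
   martingale, and the formula says that E M_t0 = M_t = f_t(q).
   No stochastic calculus is used. On a grid of [a, t], with t0 < a because p is
   differentiable after t0 only, f is expanded to second order along the path and
   stopped at the first grid time outside a box. The main terms are a discrete
   martingale transform of dw_i, dw_i^2 - ds and dw_i dw_j (i <> j), bounded in L^2
   uniformly in the grid; the remainder is pathwise o(1) (1 + sum |dw|^2). As class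
   (D) gives uniform integrability, the expectation of the remainder vanishes when
   the mesh tends to 0. Letting the box grow and a decrease to t0 ends the proof. *)
Require Import Defs.
From HB Require Import structures.
From mathcomp Require Import all_boot all_order all_algebra.
From mathcomp Require Import all_classical all_reals all_analysis.
From mathcomp Require Import measurable_realfun.
From mathcomp Require Import ring lra.

Set Implicit Arguments.
Unset Strict Implicit.
Unset Printing Implicit Defensive.

Import Order.TTheory GRing.Theory Num.Theory.
Import numFieldNormedType.Exports.

Local Open Scope classical_set_scope.
Local Open Scope ring_scope.

(** * Real-valued integrals on a probability space *)

(** The remainder of the expansion is small only path by path: the mesh that makes it small depends
    on the bound and on the modulus of continuity of each path, and no integrable majorant is at
    hand. So the limit rests on two separate facts. The ratio of the remainder to [1 + sum |dw|^2]
    tends to 0 almost surely, and this denominator has bounded mean. The remainder is also the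
    stopped process minus a martingale transform minus a constant: class (D) controls the first and
    the [L^2] bound the second, so events of small probability can be discarded. The box serves the
    transform: up to the exit the coefficients are bounded by a constant common to all paths, which
    the [L^2] bound requires. Exit is tested at grid times only, so the exit time takes finitely
    many values and its stopping property, demanded by class (D), reduces to finite unions of
    adapted events. As the exit index is random, the pathwise expansion has to hold for all numbers
    of steps at once. *)

Lemma measurable_set_lt {R : realType} d (T : measurableType d) (f g : T -> R) :
  measurable_fun setT f -> measurable_fun setT g ->
  measurable [set o | f o < g o].
Proof.
move=> mf mg; have mh : measurable_fun setT (fun o => g o - f o) by exact: measurable_funB.
have := mh measurableT `]0, +oo[%classic (measurable_itv _); rewrite setTI.
rewrite (_ : _ @^-1` _ = [set o | f o < g o])//.
by apply/seteqP; split=> o /=; rewrite in_itv/= andbT subr_gt0.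
Qed.

Section real_integrals.
Context {R : realType} {disp : measure_display} {T : measurableType disp}
  (P : probability T R).
Implicit Types f g : T -> R.

Definition L1 f := P.-integrable setT (EFin \o f).

Lemma L1_measurable f : L1 f -> measurable_fun setT f.
Proof. by move=> /(measurable_int P) /measurable_EFinP. Qed.

Lemma L1_cst c : L1 (fun=> c).
Proof. exact: finite_measure_integrable_cst. Qed.

Lemma L1D f g : L1 f -> L1 g -> L1 (fun o => f o + g o).
Proof. move=> fi gi; exact: integrableD fi gi. Qed.

Lemma L1B f g : L1 f -> L1 g -> L1 (fun o => f o - g o).
Proof. move=> fi gi; exact: integrableB fi gi. Qed.

Lemma L1Z k f : L1 f -> L1 (fun o => k * f o).
Proof. move=> fi; exact: integrableZl fi. Qed.

Lemma L1_sum (I : Type) (r : seq I) (F : I -> T -> R) :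
  (forall i, L1 (F i)) -> L1 (fun o => \sum_(i <- r) F i o).
Proof.
move=> Fi; elim: r => [|i r ih].
  by under eq_fun do rewrite big_nil; exact: L1_cst.
by under eq_fun do rewrite big_cons; exact: L1D.
Qed.

Lemma L1_le g f : measurable_fun setT f -> (forall o, `|f o| <= g o) ->
  L1 g -> L1 f.
Proof.
move=> mf fg gi; apply: (le_integrable measurableT _ _ gi).
  exact/measurable_EFinP.
by move=> o _; rewrite /= lee_fin (le_trans (fg o))// ler_norm.
Qed.

Lemma L1_norm f : L1 f -> L1 (fun o => `|f o|).
Proof.
move=> fi; apply: (le_integrable measurableT _ _ fi).
  by apply/measurable_EFinP; apply: measurableT_comp => //; exact: L1_measurable.
by move=> o _; rewrite /= lee_fin normr_id.
Qed.

Lemma L1_bounded c f : measurable_fun setT f -> (forall o, `|f o| <= c) -> L1 f.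
Proof. by move=> mf fc; exact: L1_le mf fc (L1_cst c). Qed.

Lemma L1_mul_bounded c f g : measurable_fun setT f ->
  (forall o, `|f o| <= c) -> L1 g -> L1 (fun o => f o * g o).
Proof.
move=> mf fc gi; apply: (@L1_le (fun o => c * `|g o|)).
- by apply: measurable_funM => //; exact: L1_measurable.
- by move=> o; rewrite normrM ler_wpM2r.
- by apply: L1Z; exact: L1_norm.
Qed.

Lemma L1_indic_mul A f : measurable A -> L1 f -> L1 (fun o => \1_A o * f o).
Proof.
move=> mA fi; apply: (@L1_mul_bounded 1) => //.
by move=> o; rewrite indicE; case: (_ \in _); rewrite ?normr1 ?normr0.
Qed.

Local Notation E f := (Rintegral P setT f).

Lemma ErD f g : L1 f -> L1 g -> E (fun o => f o + g o) = E f + E g.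
Proof. exact: RintegralD. Qed.

Lemma ErB f g : L1 f -> L1 g -> E (fun o => f o - g o) = E f - E g.
Proof. exact: RintegralB. Qed.

Lemma ErZ k f : L1 f -> E (fun o => k * f o) = k * E f.
Proof. by move=> fi; rewrite RintegralZl. Qed.

Lemma Er_cst c : E (fun=> c) = c.
Proof. by rewrite /Rintegral integral_cst//= probability_setT mule1. Qed.

Lemma Er_sum (I : Type) (r : seq I) (F : I -> T -> R) :
  (forall i, L1 (F i)) ->
  E (fun o => \sum_(i <- r) F i o) = \sum_(i <- r) E (F i).
Proof.
move=> Fi; elim: r => [|i r ih].
  by under eq_Rintegral do rewrite big_nil; rewrite Er_cst big_nil.
under eq_Rintegral do rewrite big_cons.
by rewrite ErD ?ih ?big_cons//; exact: L1_sum.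
Qed.

Lemma Er_le f g : L1 f -> L1 g -> (forall o, f o <= g o) -> E f <= E g.
Proof. by move=> fi gi fg; apply: le_Rintegral => // o _; exact: fg. Qed.

Lemma Er_norm f : L1 f -> `|E f| <= E (fun o => `|f o|).
Proof. by move=> fi; exact: le_normr_Rintegral. Qed.

Lemma EFin_Er f : L1 f -> (E f)%:E = (\int[P]_o (f o)%:E)%E.
Proof. by move=> fi; rewrite /Rintegral fineK//; exact: integrable_fin_num. Qed.

Lemma ge0_L1 f : measurable_fun setT f -> (forall o, 0 <= f o) ->
  (\int[P]_o (f o)%:E < +oo)%E -> L1 f.
Proof.
move=> mf f0 fy; apply/integrableP; split; first exact/measurable_EFinP.
by under eq_integral do rewrite /= ger0_norm//.
Qed.

Lemma ErE f c : (\int[P]_o (f o)%:E = c%:E)%E -> E f = c.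
Proof. by rewrite /Rintegral => ->. Qed.

End real_integrals.

(** * Moments of the normal law *)

Section gaussian_moments.
Context {R : realType}.
Local Notation mu := (@lebesgue_measure R).
Variable s : R.
Hypothesis s_gt0 : 0 < s.

Let g : R -> R := normal_fun 0 s.

Lemma continuous_normal_fun : continuous g.
Proof.
move=> x; apply: (cvg_comp _ expR); last exact: continuous_expR.
apply: cvgMl.
apply: (@cvgN _ R^o); rewrite /g; apply: (cvg_comp (fun x => x - 0) (fun x => x ^+ 2)).
  by apply: (@cvgB _ R^o) => //; [exact: cvg_id|exact: cvg_cst].
exact: sqr_continuous.
Qed.

Lemma continuous_monomial_normal_fun n : continuous (fun x : R => x ^+ n * g x).
Proof.
move=> x; apply: cvgM; [exact: exprn_continuous|exact: continuous_normal_fun].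
Qed.

Lemma normal_funE x : g x = expR (- (x ^+ 2 / (s ^+ 2 *+ 2))).
Proof. by rewrite /g /normal_fun subr0 mulNr. Qed.

Lemma is_derive_normal_fun (x : R) :
  is_derive x 1 g (- (x / s ^+ 2) * g x).
Proof.
have -> : g = expR \o (fun y => - (s ^+ 2 *+ 2)^-1 * y ^+ 2).
  by apply/funext => y; rewrite normal_funE/= mulNr mulrC.
have sn0 : s != 0 by rewrite gt_eqF.
set e : R := - (s ^+ 2 *+ 2)^-1.
have d1 : is_derive x 1 (fun y : R => e * y ^+ 2) (e * (2 * x)).
  apply: is_derive_eq; rewrite /GRing.scale/=. 
  rewrite mulr1; ring.
have -> : - (x / s ^+ 2) * (expR \o (fun y => e * y ^+ 2)) x =
  expR (e * x ^+ 2) * (e * (2 * x)).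
  rewrite /= mulrC; congr (_ * _); rewrite /e -mulr_natl; field; exact: sn0.
exact: (@is_derive1_comp _ expR (fun y : R => e * y ^+ 2)).
Qed.

(** Integration by parts in differential form: this primitive links the moment of order [n.+2] to
    the moment of order [n]. *)
Lemma is_derive_monomial_normal_fun n (x : R) :
  is_derive x 1 (fun x => - s ^+ 2 * x ^+ n.+1 * g x)
    (x ^+ n.+2 * g x - n.+1%:R * s ^+ 2 * (x ^+ n * g x)).
Proof.
have sn0 : s != 0 by rewrite gt_eqF.
have dg := is_derive_normal_fun x.
have dX : is_derive x 1 (fun y : R => y ^+ n.+1) (n.+1%:R * x ^+ n).
  apply: DeriveDef; first exact: exprn_derivable.
  by rewrite exp_derive /GRing.scale/= mulr1.
have := @is_deriveZ _ _ _ _ (- s ^+ 2) _ _ _ (is_deriveM dX dg).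
have -> : (- s ^+ 2) \*: ((fun y : R => y ^+ n.+1) * g) =
   (fun x => - s ^+ 2 * x ^+ n.+1 * g x).
  by apply/funext => y; rewrite -mulrA.
move=> D; apply: (is_derive_eq D); rewrite /GRing.scale/= !exprS.
by field; exact: sn0.
Qed.

(** The bound [expR y >= y ^+ 2 / 2] at [y = x ^+ 2 / (2 * s ^+ 2)] gives
    [g x <= 8 * s ^+ 4 / x ^+ 4], which settles exponents up to 3; exponent 3 is the boundary term
    of the fourth moment. *)
Lemma cvg_monomial_normal_fun n : (n <= 3)%N ->
  (fun k : nat => k%:R ^+ n * g k%:R) @ \oo --> (0 : R).
Proof.
move=> n3.
have kx (x : R) : 1 <= x -> `|x ^+ n * g x| <= (8 * s ^+ 4) * x^-1.
  move=> x1; have x0 : 0 < x by lra.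
  have y0 : 0 < x ^+ 2 / (s ^+ 2 *+ 2).
    by rewrite divr_gt0// ?exprn_gt0// mulrn_wgt0// exprn_gt0.
  rewrite ger0_norm; last by rewrite mulr_ge0 ?exprn_ge0 ?expR_ge0// ltW.
  rewrite normal_funE expRN ler_pdivrMr ?expR_gt0//.
  have := expR_ge1Dxn 1 (ltW y0); set E := expR _ => hE.
  have {}hE : (x ^+ 2 / (s ^+ 2 *+ 2)) ^+ 2 / 2 <= E.
    apply: le_trans hE; rewrite (_ : 2`!%:R = 2 :> R)// ; lra.
  apply: (@le_trans _ _ (8 * s ^+ 4 * x^-1 * ((x ^+ 2 / (s ^+ 2 *+ 2)) ^+ 2 / 2))); last first.
    by rewrite ler_wpM2l// mulr_ge0 ?invr_ge0 ?(ltW x0)// mulr_ge0// exprn_ge0 ?ltW.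
  have -> : 8 * s ^+ 4 * x^-1 * ((x ^+ 2 / (s ^+ 2 *+ 2)) ^+ 2 / 2) = x ^+ 3.
    by rewrite -mulr_natl; field; rewrite !gt_eqF.
  exact: ler_weXn2l.
apply/cvgrPdist_le => e e0.
near=> k.
rewrite sub0r normrN.
have k0 : 0 < k%:R :> R by near: k; exists 1%N => //= k; rewrite ltr0n.
apply: (le_trans (kx _ _)); first by rewrite ler1n -(ltr0n R).
rewrite ler_pdivrMr// [leRHS]mulrC -ler_pdivrMr//.
near: k; exact: nbhs_infty_ger.
Unshelve. all: by end_near. Qed.

Lemma ge0_cvg_integral_halfline (f : R -> R) : continuous f ->
  (forall x, 0 <= x -> 0 <= f x) ->
  (\int[mu]_(x in `[0%R, n%:R]) (f x)%:E)%E @[n --> \oo] -->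
  (\int[mu]_(x in `[0%R, +oo[) (f x)%:E)%E.
Proof.
move=> cf f0.
have -> : `[0, +oo[%classic = \bigcup_n `[0, n%:R]%classic :> set R.
  apply/seteqP; split=> [x|x [n _]] /=; rewrite !in_itv/= ?andbT; last by case/andP.
  move=> x0; exists (Num.truncn x).+1 => //=; rewrite in_itv/= x0 ltW//.
  exact: truncnS_gt.
have := @ge0_nondecreasing_set_cvg_integral _ (measurableTypeR R) R
  (fun n : nat => `[(0:R), (n%:R:R)]%classic) (EFin \o f) (@lebesgue_measure R).
apply => //.
- move=> m n mn; apply/subsetPset => x /=; rewrite !in_itv/= => /andP[-> /=] /le_trans; apply.
  by rewrite ler_nat.
- by move=> n; apply/measurable_EFinP; apply: measurable_funTS; exact: continuous_measurable_fun.
- by move=> n x /=; rewrite in_itv/= => /andP[x0 _]; rewrite lee_fin f0.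
Qed.

(** The fundamental theorem of calculus on [[0, k]], for the primitive above, then [k] to infinity.
    On the half-line all monomials are nonnegative, so the integrals converge monotonically; the
    boundary term at 0 vanishes because its exponent is [n.+1]. *)
Lemma integral_monomial_rec n (l : R) : (n <= 2)%N ->
  (\int[mu]_(x in `[0%R, +oo[) (x ^+ n * g x)%:E = l%:E)%E ->
  (\int[mu]_(x in `[0%R, +oo[) (x ^+ n.+2 * g x)%:E =
    (n.+1%:R * s ^+ 2 * l)%:E)%E.
Proof.
move=> n2 hl.
have g0 x : 0 <= g x by exact: expR_ge0.
have ge0 m x : 0 <= x -> 0 <= x ^+ m * g x by move=> x0; rewrite mulr_ge0 ?exprn_ge0.
have c m := @continuous_monomial_normal_fun m.
have L m := ge0_cvg_integral_halfline (c m) (ge0 m).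
apply: (cvg_unique _ (L n.+2)) => //.
set C := n.+1%:R * s ^+ 2.
have H : (((- s ^+ 2 * k%:R ^+ n.+1 * g k%:R)%:E +
   C%:E * \int[mu]_(x in `[0%R, k%:R]) (x ^+ n * g x)%:E)%E
   @[k --> \oo] --> (0%:E + C%:E * l%:E)%E).
  apply: cvgeD => //.
    apply: cvg_EFin; first by near=> k.
    rewrite -(mulr0 (- s ^+ 2)); apply: (@cvg_trans _ ((fun k : nat => - s ^+ 2 * (k%:R ^+ n.+1 * g k%:R)) @ \oo)).
      by apply: near_eq_cvg; near=> k; rewrite /= mulrA.
    by apply: cvgMr; exact: cvg_monomial_normal_fun.
  by apply: cvgeZl => //; rewrite -hl; exact: L.
rewrite add0e -EFinM in H.
apply: cvg_trans H; apply: near_eq_cvg; near=> k.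
have k0 : 0 < k%:R :> R by near: k; exists 1%N => //= k; rewrite ltr0n.
have I m : mu.-integrable `[0, k%:R] (EFin \o (fun x => x ^+ m * g x)).
  apply: continuous_compact_integrable; first exact: segment_compact.
  exact/continuous_subspaceT/c.
have D := @continuous_FTC2 R (fun x => x ^+ n.+2 * g x - C * (x ^+ n * g x))
   (fun x => - s ^+ 2 * x ^+ n.+1 * g x) 0 k%:R k0.
have {D} : (\int[mu]_(x in `[0%R, k%:R]) (x ^+ n.+2 * g x - C * (x ^+ n * g x))%:E =
  (- s ^+ 2 * k%:R ^+ n.+1 * g k%:R)%:E)%E.
  rewrite D.
  - by rewrite expr0n/= mulr0 mul0r sube0.
  - apply: continuous_subspaceT => x; apply: cvgB; first exact: c.
    by apply: cvgMr; exact: c.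
  - have cc : continuous (fun x : R => - s ^+ 2 * x ^+ n.+1 * g x).
      move=> x; apply: differentiable_continuous; apply/derivable1_diffP.
      by have [] := is_derive_monomial_normal_fun n x.
    split.
    + by move=> x _; have [] := is_derive_monomial_normal_fun n x.
    + by apply/cvg_at_right_filter; exact: cc.
    + by apply/cvg_at_left_filter; exact: cc.
  - by move=> x _; rewrite derive1E; exact: (@derive_val _ _ _ _ _ _ _ (is_derive_monomial_normal_fun n x)).
under eq_integral do rewrite EFinB (EFinM C).
rewrite integralB//=; [|exact: I|by apply: (integrableZl _ C (I n))].
rewrite integralZl//; last exact: I.
move=> <-; rewrite subeK//.
by rewrite fin_numM//; apply: integrable_fin_num => //; exact: I.
Unshelve. all: by end_near. Qed.


Lemma normal_peakV : (\int[mu]_x (g x)%:E)%E = (normal_peak s)^-1%:E.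
Proof.
have s0 : s != 0 by rewrite gt_eqF.
have p0 := normal_peak_gt0 s0.
have := integral_normal_pdf 0 s; rewrite normal_pdfE//.
under eq_integral do rewrite EFinM.
rewrite ge0_integralZl//=; last 3 first.
- apply/measurable_EFinP; exact: measurable_normal_fun.
- by move=> x _; rewrite lee_fin normal_fun_ge0.
- by rewrite lee_fin ltW.
rewrite -/g => /(congr1 (fun x => (normal_peak s)^-1%:E * x)%E).
by rewrite muleA -EFinM mulVf ?gt_eqF// mul1e mule1.
Qed.

Lemma integral_halfline_normal_fun :
  (\int[mu]_(x in `[0%R, +oo[) (g x)%:E)%E = (2^-1 * (normal_peak s)^-1)%:E.
Proof.
have := normal_peakV; rewrite ge0_symfun_integralT//.
- rewrite -set_itvcy => /(congr1 (fun x => 2^-1%:E * x)%E).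
  by rewrite muleA -EFinM mulVf// mul1e.
- by move=> x; exact: normal_fun_ge0.
- exact: continuous_normal_fun.
- by move=> x; rewrite /= !normal_funE sqrrN.
Qed.

Lemma integral_even_monomial_normal_fun n (l : R) :
  (\int[mu]_(x in `[0%R, +oo[) (x ^+ n.*2 * g x)%:E = l%:E)%E ->
  (\int[mu]_x (x ^+ n.*2 * g x)%:E = (2 * l)%:E)%E.
Proof.
move=> hl; rewrite ge0_symfun_integralT//.
- by rewrite -set_itvcy hl.
- by move=> x; rewrite mulr_ge0 ?expR_ge0// -muln2 exprM sqr_ge0.
- exact: continuous_monomial_normal_fun.
- by move=> x; rewrite /= !normal_funE sqrrN -muln2 mulnC !exprM sqrrN.
Qed.

Lemma integral_sqr_normal_pdf :
  (\int[mu]_x ((x ^+ 2)%:E * (normal_pdf 0 s x)%:E) = (s ^+ 2)%:E)%E.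
Proof.
have s0 : s != 0 by rewrite gt_eqF.
have p0 := normal_peak_gt0 s0.
rewrite normal_pdfE//.
under eq_integral do rewrite -EFinM mulrCA EFinM.
rewrite ge0_integralZl//=; last 3 first.
- by apply/measurable_EFinP; apply: continuous_measurable_fun; exact: continuous_monomial_normal_fun.
- by move=> x _; rewrite lee_fin mulr_ge0 ?sqr_ge0// normal_fun_ge0.
- by rewrite lee_fin ltW.
have := @integral_monomial_rec 0 (2^-1 * (normal_peak s)^-1) isT.
under eq_integral do rewrite expr0 mul1r.
move=> /(_ integral_halfline_normal_fun).
move=> /(@integral_even_monomial_normal_fun 1) ->; rewrite -EFinM; congr EFin.
by field; rewrite gt_eqF.
Qed.

Lemma integral_exp4_normal_pdf :
  (\int[mu]_x ((x ^+ 4)%:E * (normal_pdf 0 s x)%:E) = (3 * s ^+ 4)%:E)%E.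
Proof.
have s0 : s != 0 by rewrite gt_eqF.
have p0 := normal_peak_gt0 s0.
rewrite normal_pdfE//.
under eq_integral do rewrite -EFinM mulrCA EFinM.
rewrite ge0_integralZl//=; last 3 first.
- by apply/measurable_EFinP; apply: continuous_measurable_fun; exact: continuous_monomial_normal_fun.
- by move=> x _; rewrite lee_fin mulr_ge0 ?normal_fun_ge0// (_ : 4 = 2 * 2)%N// exprM sqr_ge0.
- by rewrite lee_fin ltW.
have := @integral_monomial_rec 0 (2^-1 * (normal_peak s)^-1) isT.
under eq_integral do rewrite expr0 mul1r.
move=> /(_ integral_halfline_normal_fun) /(@integral_monomial_rec 2 _ isT).
move=> /(@integral_even_monomial_normal_fun 2) ->; rewrite -EFinM; congr EFin.
by field; rewrite gt_eqF.
Qed.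

(** Reflection [x -> - x]. It yields the zero mean of the normal law, compared through its positive
    and negative parts so that only integrals of nonnegative functions occur. *)
Lemma integral_positive_part_normal_pdf :
  (\int[mu]_x ((Num.max x 0)%:E * (normal_pdf 0 s x)%:E) =
   \int[mu]_x ((Num.max (- x) 0)%:E * (normal_pdf 0 s x)%:E))%E.
Proof.
have s0 : s != 0 by rewrite gt_eqF.
pose h (x : R) : R := Num.max x 0 * normal_pdf 0 s x.
have hN x : (h \o -%R) x = Num.max (- x) 0 * normal_pdf 0 s x.
  by rewrite /h/= normal_pdfE//= -/g !normal_funE sqrrN.
have ch : continuous h.
  move=> x; apply: cvgM; last exact: continuous_normal_pdf.
  by apply: continuous_max; [exact: cvg_id|exact: cvg_cst].
have chN : continuous (h \o -%R).
  by move=> x; apply: continuous_comp; [exact: oppr_continuous|exact: ch].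
transitivity (\int[mu]_(x in `[0%R, +oo[) (h x)%:E)%E.
  rewrite [RHS]integral_mkcond; apply: eq_integral => x _.
  rewrite patchE; case: ifPn => [_|]; first by rewrite EFinM.
  rewrite notin_setE/= in_itv/= andbT => /negP; rewrite -ltNge => x0.
  by rewrite (_ : Num.max x 0 = 0) ?mul0e//; apply/max_idPr/ltW.
transitivity (\int[mu]_(x in `]-oo, (-0)%R]) ((h \o -%R) x)%:E)%E.
  rewrite ge0_integration_by_substitutionNy.
  - by apply: eq_integral => x _ /=; rewrite opprK.
  - exact: continuous_subspaceT.
  - move=> x _; rewrite hN mulr_ge0 ?normal_pdf_ge0//.
    by rewrite le_max lexx orbT.
rewrite oppr0 [LHS]integral_mkcond; apply: eq_integral => x _.
rewrite patchE; case: ifPn => [_|]; first by rewrite hN EFinM.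
rewrite notin_setE/= in_itv/= => /negP; rewrite -ltNge => x0.
by rewrite (_ : Num.max (- x) 0 = 0) ?mul0e//; apply/max_idPr; rewrite oppr_le0 ltW.
Qed.

(** The Radon-Nikodym derivative of the normal law and the explicit density have the same integral
    over every measurable set, hence agree almost everywhere. *)
Lemma ge0_integral_normal_prob (f : R -> R) : measurable_fun setT f ->
  (forall x, 0 <= f x) ->
  (\int[normal_prob 0 s]_x (f x)%:E =
   \int[mu]_x ((f x)%:E * (normal_pdf 0 s x)%:E))%E.
Proof.
move=> mf f0.
have dom := @normal_prob_dominates R 0 s.
have mpdf : measurable_fun setT (EFin \o normal_pdf 0 s).
  by apply/measurable_EFinP; exact: measurable_normal_pdf.
rewrite -(Radon_Nikodym_SigmaFinite.change_of_variables dom)//; last exact/measurable_EFinP.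
have fint := Radon_Nikodym_SigmaFinite.f_integrable dom.
apply: ae_eq_integral => //.
- by apply: emeasurable_funM; [exact/measurable_EFinP|exact: measurable_int fint].
- by apply: emeasurable_funM => //; exact/measurable_EFinP.
- apply: ae_eqe_mul2l; apply: integral_ae_eq => // E _ mE.
  by rewrite -(Radon_Nikodym_SigmaFinite.f_integral dom).
Qed.

End gaussian_moments.

Section normal_law.
Context {R : realType} {disp : measure_display} {T : measurableType disp}
  (P : probability T R).
Variables (X : T -> R) (v : R).
Hypotheses (mX : measurable_fun setT X) (v_gt0 : 0 < v)
  (X_law : has_normal_law P X v).

Lemma ge0_integral_normal_law (f : R -> R) : measurable_fun setT f ->
  (forall x, 0 <= f x) ->
  (\int[P]_o (f (X o))%:E =
   \int[lebesgue_measure]_x ((f x)%:E * (normal_pdf 0 (Num.sqrt v) x)%:E))%E.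
Proof.
move=> mf f0; rewrite -ge0_integral_normal_prob ?sqrtr_gt0//.
have mfE : measurable_fun setT (EFin \o f) by exact/measurable_EFinP.
pose mX' := isMeasurableFun.Build _ _ T (measurableTypeR R) X mX.
pose XX : {RV P >-> measurableTypeR R} := HB.pack X mX'.
have <- := @ge0_integral_distribution _ _ _ (measurableTypeR R) _ P XX (EFin \o f) mfE.
  apply: (@eq_measure_integral _ (measurableTypeR R) R setT (normal_prob 0 (Num.sqrt v)) (distribution P XX)).
  by move=> A mA _; exact: X_law.
by move=> x; rewrite /= lee_fin.
Qed.

Lemma normal_law_sqr : (\int[P]_o (X o ^+ 2)%:E = v%:E)%E.
Proof.
rewrite (ge0_integral_normal_law (f := fun x => x ^+ 2)).
- by rewrite integral_sqr_normal_pdf ?sqrtr_gt0// sqr_sqrtr// ltW.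
- exact: measurable_funX.
- by move=> x; exact: sqr_ge0.
Qed.

Lemma normal_law_exp4 : (\int[P]_o (X o ^+ 4)%:E = (3 * v ^+ 2)%:E)%E.
Proof.
rewrite (ge0_integral_normal_law (f := fun x => x ^+ 4)).
- rewrite integral_exp4_normal_pdf ?sqrtr_gt0//.
  by rewrite (_ : 4 = 2 * 2)%N// exprM sqr_sqrtr// ltW.
- exact: measurable_funX.
- by move=> x; rewrite (_ : 4 = 2 * 2)%N// exprM; exact: sqr_ge0.
Qed.

Lemma normal_law_L1_exp4 : L1 P (fun o => X o ^+ 4).
Proof.
apply: ge0_L1; first exact: measurable_funX.
- by move=> o; rewrite (_ : 4 = 2 * 2)%N// exprM; exact: sqr_ge0.
- by rewrite normal_law_exp4 ltry.
Qed.

Lemma normal_law_L1_sqr : L1 P (fun o => X o ^+ 2).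
Proof.
apply: ge0_L1; first exact: measurable_funX.
- by move=> o; exact: sqr_ge0.
- by rewrite normal_law_sqr ltry.
Qed.

Lemma normal_law_L1 : L1 P X.
Proof.
apply: (@L1_le _ _ _ P (fun o => 1 + X o ^+ 2)) => //.
- move=> o; rewrite -(real_normK (num_real (X o))).
  by have := sqr_ge0 (`|X o| - 1); have := normr_ge0 (X o); nra.
- by apply: L1D; [exact: L1_cst|exact: normal_law_L1_sqr].
Qed.

Lemma normal_law_mean : \int[P]_o (X o) = 0.
Proof.
have mp : measurable_fun setT (fun x : R => Num.max x 0) by exact: measurable_maxr.
have mn : measurable_fun setT (fun x : R => Num.max (- x) 0) by exact: measurable_maxr.
have Lp : L1 P (fun o => Num.max (X o) 0).
  apply: (@L1_le _ _ _ P (fun o => `|X o|)); last exact/L1_norm/normal_law_L1.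
    exact: (measurableT_comp mp mX).
  by move=> o; have [x0|x0] := leP (X o) 0; rewrite ?normr0 ?normr_ge0.
have Ln : L1 P (fun o => Num.max (- X o) 0).
  apply: (@L1_le _ _ _ P (fun o => `|X o|)); last exact/L1_norm/normal_law_L1.
    exact: (measurableT_comp mn mX).
  by move=> o; have [x0|x0] := leP (- X o) 0; rewrite ?normr0 ?normrN ?normr_ge0.
rewrite (_ : X = (fun o => Num.max (X o) 0 - Num.max (- X o) 0)); last first.
  by apply/funext => o; case: (leP (X o) 0); case: (leP (- X o) 0); lra.
rewrite ErB//; apply/eqP; rewrite subr_eq0; apply/eqP; congr fine.
rewrite (ge0_integral_normal_law mp); last by move=> x; rewrite le_max lexx orbT.
rewrite (ge0_integral_normal_law mn); last by move=> x; rewrite le_max lexx orbT.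
by rewrite integral_positive_part_normal_pdf ?sqrtr_gt0.
Qed.

End normal_law.

(** * Uniform integrability *)

Section equi_integrability.
Context {R : realType} {disp : measure_display} {T : measurableType disp}
  (P : probability T R) {I : Type}.
Implicit Types X Y : I -> T -> R.
Local Notation E f := (Rintegral P setT f).

(** The consequence of uniform integrability that the limits use. In this form, stability under sums
    is just the triangle inequality. *)
Definition equi_absolutely_continuous X : Prop :=
  forall e : R, 0 < e -> exists2 dlt : R, 0 < dlt &
    forall i A, measurable A -> (P A <= dlt%:E)%E ->
      E (fun o => \1_A o * `|X i o|) <= e.

Lemma Er_indic A : measurable A -> E \1_A = fine (P A).
Proof. by move=> mA; rewrite /Rintegral integral_indic// setIT. Qed.

Lemma L1_indic A : measurable A -> L1 P \1_A.
Proof. by move=> mA; apply: (@L1_bounded _ _ _ P 1) => // o; rewrite indicE; case: (_ \in _); rewrite ?normr1 ?normr0. Qed.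

(** Splitting at the level [K]: on [A], [|X|] is at most its part above [K] plus a constant times
    the indicator of [A]. *)
Lemma uniformly_integrable_eac (F : set (T -> R)) X :
  uniformly_integrable P F -> (forall i, F (X i)) -> equi_absolutely_continuous X.
Proof.
move=> [Fi Fu] FX e e0.
have e20 : 0 < e / 2 by rewrite divr_gt0.
have [K hK] := Fu _ e20.
(* The level [K] supplied by uniform integrability may be negative; [K'] is a positive level above
   it. *)
pose K' : R := `|K| + 1; have K'0 : 0 < K' by rewrite /K'; have h0 := normr_ge0 K; lra.
exists (e / 2 / K'); first by rewrite divr_gt0.
move=> i A mA PA; have Li : L1 P (X i) by have := Fi _ (FX i).
have mX := L1_measurable Li.
pose B := [set o | K < `|X i o|].
have mB : measurable B.
  by apply: measurable_set_lt => //; exact: measurableT_comp.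
apply: (@le_trans _ _ (E (fun o => \1_B o * `|X i o| + K' * \1_A o))).
  apply: Er_le.
  - by apply: L1_indic_mul => //; exact: L1_norm.
  - by apply: L1D; [apply: L1_indic_mul => //; exact: L1_norm|apply/L1Z/L1_indic].
  - move=> o; have X0 := normr_ge0 (X i o); have K0 := ler_norm K; have K1 := normr_ge0 K.
    have b1 : true%:R = 1 :> R by []. have b0 : false%:R = 0 :> R by [].
    rewrite !indicE /K'; have [oB|oB] := boolP (o \in B).
      by case: (o \in A); rewrite ?b1 ?b0; lra.
    have XK : `|X i o| <= K.
      by move: oB; rewrite notin_setE /B/= => /negP; rewrite -leNgt.
    by case: (o \in A); rewrite ?b1 ?b0; lra.
rewrite ErD ?ErZ ?Er_indic//; last 3 first.
- exact: L1_indic.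
- by apply: L1_indic_mul => //; exact: L1_norm.
- by apply/L1Z/L1_indic.
have h1 : E (fun o => \1_B o * `|X i o|) <= e / 2.
  rewrite -lee_fin EFin_Er; last by apply: L1_indic_mul => //; exact: L1_norm.
  apply: le_trans (hK _ (FX i)); rewrite [leRHS]integral_mkcond.
  rewrite le_eqVlt; apply/orP; left; apply/eqP; apply: eq_integral => o _.
  by rewrite patchE indicE; case: ifPn => _; rewrite ?mul1r ?mul0r.
have h2 : K' * fine (P A) <= e / 2.
  rewrite mulrC -ler_pdivlMr// -lee_fin fineK//; exact: fin_num_measure.
by rewrite [leRHS]splitr lerD.
Qed.

Lemma eacD X Y : (forall i, L1 P (X i)) -> (forall i, L1 P (Y i)) ->
  equi_absolutely_continuous X -> equi_absolutely_continuous Y ->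
  equi_absolutely_continuous (fun i o => X i o + Y i o).
Proof.
move=> LX LY hX hY e e0; have e20 : 0 < e / 2 by rewrite divr_gt0.
have [d1 d10 h1] := hX _ e20; have [d2 d20 h2] := hY _ e20.
exists (Num.min d1 d2); first by rewrite lt_min d10.
move=> i A mA PA.
have L f : L1 P f -> L1 P (fun o => \1_A o * `|f o|).
  by move=> fi; apply: L1_indic_mul => //; exact: L1_norm.
apply: (@le_trans _ _ (E (fun o => \1_A o * `|X i o| + \1_A o * `|Y i o|))).
  apply: Er_le; [exact/L/L1D|by apply: L1D; exact: L|].
  by move=> o; rewrite -mulrDr ler_wpM2l// ler_normD.
rewrite ErD; [|exact: L|exact: L]; rewrite [leRHS]splitr lerD//.
  by apply: h1 => //; rewrite (le_trans PA)// lee_fin ge_min lexx.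
by apply: h2 => //; rewrite (le_trans PA)// lee_fin ge_min lexx orbT.
Qed.

(** By the arithmetic-geometric inequality, [|X|] on [A] is at most [l * X ^+ 2 + l^-1] for every
    [l > 0]. *)
Lemma square_bounded_eac (C : R) X : (forall i, measurable_fun setT (X i)) ->
  (forall i, L1 P (fun o => X i o ^+ 2)) ->
  (forall i, E (fun o => X i o ^+ 2) <= C) -> equi_absolutely_continuous X.
Proof.
move=> mX LX hC e e0.
pose C' : R := `|C| + 1; have C'0 : 0 < C' by rewrite /C'; have h0 := normr_ge0 C; lra.
(* This [l] makes the quadratic term at most [e / 2] in mean; [dlt = e / 2 * l] does the same for
   the term [l^-1 * P A]. *)
pose l := e / 2 / C'; have l0 : 0 < l by rewrite !divr_gt0.
exists (e / 2 * l); first by rewrite mulr_gt0// divr_gt0.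
move=> i A mA PA.
have mi : measurable_fun setT (fun o => \1_A o * `|X i o|).
  by apply: measurable_funM => //; exact: measurableT_comp.
have Lg : L1 P (fun o => l * X i o ^+ 2 + l^-1 * \1_A o).
  by apply: L1D; [exact/L1Z/LX|exact/L1Z/L1_indic].
have le o : \1_A o * `|X i o| <= l * X i o ^+ 2 + l^-1 * \1_A o.
  have b1 : true%:R = 1 :> R by []. have b0 : false%:R = 0 :> R by [].
  rewrite indicE; case: (o \in A); rewrite ?b1 ?b0; last first.
    by rewrite mul0r mulr0 addr0 mulr_ge0 ?sqr_ge0// ltW.
  rewrite mul1r mulr1 -(real_normK (num_real (X i o))).
  have h : 0 <= l * (`|X i o| - (2 * l)^-1) ^+ 2 by rewrite mulr_ge0 ?sqr_ge0// ltW.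
  have h2 : 0 <= l^-1 by rewrite invr_ge0 ltW.
  have h3 : l * (`|X i o| - (2 * l)^-1) ^+ 2 = l * `|X i o| ^+ 2 - `|X i o| + 4^-1 * l^-1.
    by field; rewrite gt_eqF.
  lra.
apply: (@le_trans _ _ (E (fun o => l * X i o ^+ 2 + l^-1 * \1_A o))).
  apply: Er_le => //; apply: L1_le Lg => // o; rewrite ger0_norm// mulr_ge0//.
rewrite ErD ?ErZ ?Er_indic//; [|exact: L1_indic|exact: L1Z|exact/L1Z/L1_indic].
rewrite [leRHS]splitr lerD//.
  rewrite /l -(mulrA (e / 2)); apply: ler_piMr; first by rewrite divr_ge0 ?ltW.
  rewrite [leLHS]mulrC ler_pdivrMr// mul1r.
  by rewrite (le_trans (hC i))// /C'; have h0 := ler_norm C; lra.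
rewrite [leLHS]mulrC ler_pdivrMr// -lee_fin fineK//; exact: fin_num_measure.
Qed.

End equi_integrability.

Section ratio_convergence.
Context {R : realType} {disp : measure_display} {T : measurableType disp}
  (P : probability T R).
Variables (X W : nat -> T -> R) (C : R).
Local Notation E f := (Rintegral P setT f).
Hypotheses (LX : forall n, L1 P (X n)) (LW : forall n, L1 P (W n))
  (W1 : forall n o, 1 <= W n o) (WC : forall n, E (W n) <= C)
  (X_eac : equi_absolutely_continuous P X)
  (X_cvg : {ae P, forall o, X n o / W n o @[n --> \oo] --> (0 : R)}).

(* Outside an event of small probability, [`|X n| <= eta * W n]. *)
Lemma ratio_cvg_expectation : E (X n) @[n --> \oo] --> (0 : R).
Proof.
have mX n : measurable_fun setT (X n) by exact: L1_measurable.
have mW n : measurable_fun setT (W n) by exact: L1_measurable.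
apply/cvgrPdist_le => e e0.
have e20 : 0 < e / 2 by rewrite divr_gt0.
pose C' : R := `|C| + 1; have C'0 : 0 < C' by rewrite /C'; have h0 := normr_ge0 C; lra.
(* Chosen so that [eta * E (W n) <= e / 2]. *)
pose eta := e / 2 / C'; have eta0 : 0 < eta by rewrite !divr_gt0.
pose A n := [set o | eta * W n o < `|X n o|].
have mA n : measurable (A n).
  apply: measurable_set_lt; last exact: measurableT_comp.
  exact: measurable_funM.
have [dlt dlt0 hdlt] := X_eac e20.
(* Convergence of the ratio makes the indicators of [A n] eventually 0 almost surely; dominated
   convergence passes to their probabilities. *)
have PA0 : P (A n) @[n --> \oo] --> 0%E.
  have -> : (fun n => P (A n)) = (fun n => \int[P]_o (\1_(A n) o)%:E)%E.
    by apply/funext => n; rewrite integral_indic// setIT.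
  rewrite -(integral0 P setT).
  suff [] : [/\ P.-integrable setT (cst 0%E),
    [sequence (\int[P]_(o in setT) `|(\1_(A n) o)%:E - 0|)%E]_n @ \oo --> 0%E
    & [sequence (\int[P]_(o in setT) (\1_(A n) o)%:E)%E]_n @ \oo -->
      (\int[P]_(x in setT) 0)%E] by [].
  apply: (@dominated_convergence _ _ _ P setT measurableT _ _ (cst 1%E)) => //.
  - by move=> n; exact/measurable_EFinP.
  - apply: filterS X_cvg => o Xo _.
    apply: cvg_EFin; first by near=> n.
    apply: (@cvg_trans _ ((fun=> (0:R)) @ \oo)); last exact: cvg_cst.
    apply: near_eq_cvg; near=> n.
    rewrite /= indicE memNset// /A/= => /lt_geF/negP; apply.
    have : `|0 - X n o / W n o| <= eta.
      by near: n; move/cvgrPdist_le : Xo; exact.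
    rewrite sub0r normrN normrM normfV (ger0_norm (le_trans ler01 (W1 n o))).
    by rewrite ler_pdivrMr// (lt_le_trans ltr01).
  - exact: finite_measure_integrable_cst.
  - apply: aeW => o n _ /=; rewrite lee_fin indicE; case: (_ \in _); by rewrite ?normr1 ?normr0.
have hA : \forall n \near \oo, (P (A n) <= dlt%:E)%E.
  move/fine_cvgP : PA0 => [_ /cvgrPdist_le /(_ _ dlt0)].
  apply: filterS => n /=; rewrite sub0r normrN => h.
  rewrite -(@fineK _ (P (A n))); last exact: fin_num_measure.
  by rewrite lee_fin (le_trans _ h)// ler_norm.
near=> n; rewrite sub0r normrN.
have PAn : (P (A n) <= dlt%:E)%E by near: n.
apply: (le_trans (Er_norm (LX n))).
apply: (@le_trans _ _ (E (fun o => \1_(A n) o * `|X n o| + eta * W n o))).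
  apply: Er_le.
  - exact: L1_norm.
  - by apply: L1D; [apply: L1_indic_mul => //; exact: L1_norm|exact: L1Z].
  - move=> o; rewrite indicE; have [oA|oA] := boolP (o \in A n).
      by rewrite mul1r lerDl mulr_ge0// ?ltW// (lt_le_trans ltr01).
    by move: oA; rewrite notin_setE /A/= mul0r add0r leNgt => /negP.
rewrite ErD ?ErZ//; [|by apply: L1_indic_mul => //; exact: L1_norm|exact: L1Z].
rewrite [leRHS]splitr lerD//; first exact: hdlt.
rewrite /eta -(mulrA (e / 2)); apply: ler_piMr; first exact: ltW.
rewrite [leLHS]mulrC ler_pdivrMr// mul1r.
by rewrite (le_trans (WC n))// /C'; have h0 := ler_norm C; lra.
Unshelve. all: by end_near. Qed.

End ratio_convergence.

(** * Independence of the Wiener increments from the past *)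

Section independence.
Context {R : realType} {disp : measure_display} {T : measurableType disp}
  (P : probability T R).
Implicit Types X Y : T -> R.
Local Notation E f := (Rintegral P setT f).

Definition independent_RVs X Y : Prop := forall A B : set R,
  measurable A -> measurable B ->
  P (X @^-1` A `&` Y @^-1` B) = (P (X @^-1` A) * P (Y @^-1` B))%E.

(** The joint law of [X] and [Y] agrees with the product of their laws on rectangles, hence
    everywhere; Tonelli then factors the integral. *)
Lemma ge0_independent_expectation X Y (f g : R -> R) :
  measurable_fun setT X -> measurable_fun setT Y -> independent_RVs X Y ->
  measurable_fun setT f -> measurable_fun setT g ->
  (forall x, 0 <= f x) -> (forall x, 0 <= g x) ->
  (\int[P]_o (f (X o) * g (Y o))%:E =
   \int[P]_o (f (X o))%:E * \int[P]_o (g (Y o))%:E)%E.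
Proof.
move=> mX mY XY mf mg f0 g0.
pose RM := measurableTypeR R.
pose mX' := isMeasurableFun.Build _ _ T RM X mX.
pose X' : {RV P >-> RM} := HB.pack X mX'.
pose mY' := isMeasurableFun.Build _ _ T RM Y mY.
pose Y' : {RV P >-> RM} := HB.pack Y mY'.
have mZ : measurable_fun setT (fun o => (X o, Y o) : (RM * RM)%type).
  exact: measurable_fun_pair.
pose mZ' := isMeasurableFun.Build _ _ T (RM * RM)%type _ mZ.
pose Z' : {RV P >-> (RM * RM)%type} := HB.pack (fun o => (X o, Y o) : (RM * RM)%type) mZ'.
pose h (z : (RM * RM)%type) : \bar R := (f z.1 * g z.2)%:E.
have mfE : measurable_fun [set: RM] (EFin \o f) by exact/measurable_EFinP.
have mgE : measurable_fun [set: RM] (EFin \o g) by exact/measurable_EFinP.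
have mh : measurable_fun setT h.
  apply/measurable_EFinP; apply: measurable_funM.
    by apply: measurableT_comp => //; exact: measurable_fst.
  by apply: measurableT_comp => //; exact: measurable_snd.
have h0 z : (0 <= h z)%E by rewrite lee_fin mulr_ge0.
transitivity (\int[distribution P Z']_z h z)%E.
  by rewrite ge0_integral_distribution.
transitivity (\int[distribution P X' \x distribution P Y']_z h z)%E.
  apply: eq_measure_integral => A mA _; apply/esym.
  by apply: product_measure_unique.
rewrite fubini_tonelli1// /fubini_F/=.
under eq_integral => x _.
  under eq_integral do rewrite /h/= EFinM.
  rewrite ge0_integralZl//=; last 2 first.
  - by move=> y _; rewrite lee_fin.
  - by rewrite lee_fin.
  over.
rewrite ge0_integralZr//=; last 2 first.
- by move=> x _; rewrite lee_fin.
- by apply: integral_ge0 => y _; rewrite lee_fin.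
congr (_ * _)%E.
  by apply: (ge0_integral_distribution X' mfE) => y; rewrite /= lee_fin.
by apply: (ge0_integral_distribution Y' mgE) => y; rewrite /= lee_fin.
Qed.

Lemma independent_L1 X Y : independent_RVs X Y -> L1 P X -> L1 P Y ->
  L1 P (fun o => X o * Y o).
Proof.
move=> XY LX LY; have mX := L1_measurable LX; have mY := L1_measurable LY.
apply/integrableP; split; first by apply/measurable_EFinP; exact: measurable_funM.
under eq_integral do rewrite /= normrM.
rewrite (ge0_independent_expectation (f := fun x => `|x|) (g := fun x => `|x|))//.
by rewrite -(EFin_Er (L1_norm LX)) -(EFin_Er (L1_norm LY)) -EFinM ltry.
Qed.

Lemma independent_expectation X Y : independent_RVs X Y -> L1 P X -> L1 P Y ->
  E (fun o => X o * Y o) = E X * E Y.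
Proof.
move=> XY LX LY; have mX := L1_measurable LX; have mY := L1_measurable LY.
pose p (x : R) : R := Num.max x 0; pose n (x : R) : R := Num.max (- x) 0.
have mp : measurable_fun setT p by exact: measurable_maxr.
have mn : measurable_fun setT n by exact: measurable_maxr.
have p0 x : 0 <= p x by rewrite le_max lexx orbT.
have n0 x : 0 <= n x by rewrite le_max lexx orbT.
have pnE x : x = p x - n x.
  by rewrite /p /n; case: (leP x 0); case: (leP (- x) 0); lra.
have Lp Z : L1 P Z -> L1 P (fun o => p (Z o)).
  move=> LZ; apply: (@L1_le _ _ _ P (fun o => `|Z o|)); last exact: L1_norm.
    exact: (measurableT_comp mp (L1_measurable LZ)).
  by move=> o; rewrite /p; have [x0|x0] := leP (Z o) 0; rewrite ?normr0 ?normr_ge0.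
have Ln Z : L1 P Z -> L1 P (fun o => n (Z o)).
  move=> LZ; apply: (@L1_le _ _ _ P (fun o => `|Z o|)); last exact: L1_norm.
    exact: (measurableT_comp mn (L1_measurable LZ)).
  by move=> o; rewrite /n; have [x0|x0] := leP (- Z o) 0; rewrite ?normr0 ?normrN ?normr_ge0.
have K (f g : R -> R) : measurable_fun setT f -> measurable_fun setT g ->
    (forall x, 0 <= f x) -> (forall x, 0 <= g x) ->
    L1 P (fun o => f (X o)) -> L1 P (fun o => g (Y o)) ->
    L1 P (fun o => f (X o) * g (Y o)) /\
    E (fun o => f (X o) * g (Y o)) = E (fun o => f (X o)) * E (fun o => g (Y o)).
  move=> mf mg f0 g0 Lf Lg.
  have H : (\int[P]_o (f (X o) * g (Y o))%:E =
      (E (fun o => f (X o)) * E (fun o => g (Y o)))%:E)%E.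
    by rewrite ge0_independent_expectation// EFinM !EFin_Er.
  split; last exact: ErE.
  apply: ge0_L1; last by rewrite H ltry.
    apply: measurable_funM; [exact: L1_measurable Lf|exact: L1_measurable Lg].
  by move=> o; rewrite mulr_ge0.
have [L1a Ea] := K p p mp mp p0 p0 (Lp _ LX) (Lp _ LY).
have [L1b Eb] := K p n mp mn p0 n0 (Lp _ LX) (Ln _ LY).
have [L1c Ec] := K n p mn mp n0 p0 (Ln _ LX) (Lp _ LY).
have [L1d Ed] := K n n mn mn n0 n0 (Ln _ LX) (Ln _ LY).
have EX : E X = E (fun o => p (X o)) - E (fun o => n (X o)).
  by rewrite -ErB; [apply: eq_Rintegral => o _; exact: pnE|exact: Lp|exact: Ln].
have EY : E Y = E (fun o => p (Y o)) - E (fun o => n (Y o)).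
  by rewrite -ErB; [apply: eq_Rintegral => o _; exact: pnE|exact: Lp|exact: Ln].
transitivity (E (fun o => (p (X o) * p (Y o) - p (X o) * n (Y o)) -
                         (n (X o) * p (Y o) - n (X o) * n (Y o)))).
  apply: eq_Rintegral => o _; rewrite {1}(pnE (X o)) {1}(pnE (Y o)); ring.
rewrite !ErB//; [|exact: L1B|exact: L1B].
rewrite Ea Eb Ec Ed EX EY; ring.
Qed.

(** For fixed [B], both sides are finite measures in [A] that agree on a family stable under
    intersection and containing the whole space, hence on the sigma-algebra it generates. *)
Lemma independent_of_generated (H : set (set T)) Y :
  H `<=` measurable -> H setT -> setI_closed H -> measurable_fun setT Y ->
  (forall A B, H A -> measurable B ->
    P (A `&` Y @^-1` B) = (P A * P (Y @^-1` B))%E) ->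
  forall A B, <<s H >> A -> measurable B ->
    P (A `&` Y @^-1` B) = (P A * P (Y @^-1` B))%E.
Proof.
move=> Hm HT HI mY HY A B sA mB.
have mYB : measurable (Y @^-1` B) by rewrite -[_ @^-1` _]setTI; exact: mY.
pose c : {nonneg R} := NngNum (fine_ge0 (measure_ge0 P (Y @^-1` B))).
have cE : c%:num%:E = P (Y @^-1` B) by rewrite /= fineK//; exact: fin_num_measure.
have := @g_sigma_algebra_measure_unique _ R T H Hm (fun=> setT) (fun=> HT) _
  (mrestr P mYB) (mscale c P) HI _ _ A sA.
rewrite /mrestr/= /mscale/= cE muleC; apply.
- by rewrite bigcup_const//; exists 0%N.
- by move=> C HC; rewrite /mrestr HY// muleC.
- by move=> _; rewrite /mrestr setTI (le_lt_trans (probability_le1 _ mYB))// ltry.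
Qed.


(** The intersection-stable family consists of the cylinders with no constraint at [i0]; that free
    slot then receives [B] in the product rule. *)
Lemma mutually_independent_generated (I : finType) (X : I -> T -> R) (i0 : I) :
  (forall i, measurable_fun setT (X i)) -> mutually_independent P X ->
  forall A B,
    <<s [set E | exists (i : I) (B : set R),
           [/\ i != i0, measurable B & E = X i @^-1` B] ]>> A ->
    measurable B -> P (A `&` X i0 @^-1` B) = (P A * P (X i0 @^-1` B))%E.
Proof.
move=> mX XI A B sA mB.
have mXB i C : measurable C -> measurable (X i @^-1` C).
  by move=> mC; rewrite -[_ @^-1` _]setTI; exact: mX.
pose H : set (set T) := [set E | exists C : I -> set R,
  [/\ forall i, measurable (C i), C i0 = setT &
      E = \bigcap_(i in [set: I]) (X i @^-1` C i)] ].
apply: (@independent_of_generated H) => //.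
- move=> _ [C [mC _ ->]]; apply: fin_bigcap_measurable => //.
  by move=> i _; exact: mXB.
- exists (fun=> setT); split => //; apply/seteqP; split => // o _ i _ //.
- move=> _ _ [C [mC Ci ->]] [D [mD Di ->]]; exists (fun i => C i `&` D i); split.
  + by move=> i; exact: measurableI.
  + by rewrite Ci Di setTI.
  + apply/seteqP; split=> [x [oC oD] i _|x CD].
      by split; [exact: oC|exact: oD].
    by split=> i _; have [] := CD i Logic.I.
- move=> _ D [C [mC Ci ->]] mD.
  have := XI (fun i => if i == i0 then D else C i).
  have mCD i : measurable (if i == i0 then D else C i) by case: ifP.
  move=> /(_ mCD); rewrite (bigD1 i0)//= eqxx => h.
  have -> : \bigcap_(i in [set: I]) X i @^-1` C i `&` X i0 @^-1` D =
     \bigcap_(i in [set: I]) X i @^-1` (if i == i0 then D else C i).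
    apply/seteqP; split=> [x [oC oD] i _|x CD].
      by case: eqP => [->//|_]; exact: oC.
    split; last by have := CD i0 Logic.I; rewrite eqxx.
    move=> i _; have := CD i Logic.I; case: eqP => // -> _.
    by rewrite Ci.
  rewrite h muleC; congr (_ * _)%E.
  rewrite XI// [RHS](bigD1 i0)//= Ci preimage_setT probability_setT mul1e.
  by apply: eq_bigr => i /negbTE ->.
- apply: smallest_sub sA; first exact: smallest_sigma_algebra.
  move=> _ [i [C [ii0 mC ->]]]; apply: sub_sigma_algebra.
  exists (fun j => if j == i then C else setT); split.
  + by move=> j; case: ifP.
  + by rewrite eq_sym (negbTE ii0).
  + apply/seteqP; split=> [x Co j _|x CD]; first by case: eqP => [->|].
    by have := CD i Logic.I; rewrite eqxx.
Qed.

End independence.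

(** Places [[s', s]] as step number 0 of a strictly increasing grid that passes through [t] and all
    the times of [l], the shape in which independence of Wiener increments is available. *)
Lemma strict_grid {R : realType} (s' s t : R) (l : seq R) :
  s' < s -> s <= t -> {in l, forall r, s <= r <= t} ->
  exists (g : nat -> R) (n : nat),
    [/\ g 0%N = s', g 1%N = s, forall k, g k < g k.+1, (0 < n)%N /\ g n = t &
        {in l, forall r, exists2 m, (0 < m <= n)%N & r = g m}].
Proof.
move=> s's st ls.
pose L := sort <=%O (undup (s :: t :: l)).
have memL r : (r \in L) = (r \in s :: t :: l) by rewrite mem_sort mem_undup.
have sL : sorted <%O L by rewrite sort_lt_sorted undup_uniq.
have Lge r : r \in L -> s <= r <= t.
  rewrite memL !inE => /or3P[/eqP->|/eqP->|/ls//]; by rewrite ?lexx ?st.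
pose n := size L.
have sinL : s \in L by rewrite memL mem_head.
have tinL : t \in L by rewrite memL !inE eqxx orbT.
have n0 : (0 < n)%N by rewrite /n; case: (L) sinL.
have Lnth k : (k < n)%N -> s <= nth 0 L k <= t by move=> kn; apply/Lge/mem_nth.
have Llt := sorted_ltn_nth lt_trans 0 sL.
have L0 : nth 0 L 0 = s.
  apply/eqP; rewrite eq_le; have /andP[-> _] := Lnth _ n0; rewrite andbT.
  rewrite -(nth_index 0 sinL); have [->//|/ltW//] : index s L = 0%N \/ nth 0 L 0 < nth 0 L (index s L).
  case E : (index s L) => [|k]; first by left.
  by right; apply: Llt; rewrite ?inE// -E index_mem.
have Ln : nth 0 L n.-1 = t.
  apply/eqP; rewrite eq_le; have /andP[_ ->] := Lnth n.-1 ltac:(by rewrite prednK).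
  rewrite /= -{1}(nth_index 0 tinL).
  have := tinL; rewrite -index_mem -/n => tn.
  have : (index t L <= n.-1)%N by rewrite -ltnS prednK.
  rewrite leq_eqVlt => /orP[/eqP->//|h]; apply/ltW/Llt => //.
  by rewrite inE -/n prednK.
(* Beyond the sorted list the grid continues past [t] by unit steps, because [standard_Wiener]
   speaks of infinite increasing sequences. *)
pose g k := if k is k'.+1 then
  (if (k' < n)%N then nth 0 L k' else t + (k' - n)%:R + 1) else s'.
exists g, n; split => //.
- by rewrite /= n0 L0.
- case=> [|k] /=; first by rewrite n0 L0.
  case: ifPn => kn; case: ifPn => kn'.
  + by apply: Llt => //; rewrite inE.
  + have /andP[_ h] := Lnth _ kn; have : 0 <= (k.+1 - n)%:R :> R by []; lra.
  + by move: kn; rewrite (ltn_trans (ltnSn k) kn').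
  + have nk : (n <= k)%N by rewrite leqNgt.
    by rewrite subSn// -natr1; lra.
- by split => //; rewrite -(prednK n0) /= prednK// leqnn Ln.
- move=> r rl; exists (index r L).+1.
    by rewrite ltnS leq0n /= /n index_mem memL !inE rl !orbT.
  have rL : r \in L by rewrite memL !inE rl !orbT.
  by rewrite /= -/n index_mem rL nth_index.
Qed.

Section Wiener_independence.
Context {R : realType} {d : nat} {disp : measure_display}
  {T : measurableType disp} (P : probability T R).
Variables (t0 t : R) (w : R -> T -> 'rV[R]_d).
Hypothesis hw : standard_Wiener P t0 w.

Lemma measurable_increment r s i : t0 <= r -> t0 <= s ->
  measurable_fun setT (increment w r s i).
Proof. by case: hw => mw _ _ _ _ t0r t0s; apply: measurable_funB; exact: mw. Qed.

(* Everything the [i]-th increment over [s', s] has to be independent of: the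
   past at [s], seen only at the times in [l], and the other coordinates of the
   same increment. *)
Definition past_generators (s' s : R) (i : 'I_d) (l : R -> Prop) : set (set T) :=
  [set E | exists (r : R) (j : 'I_d) (B : set R),
     [/\ s <= r <= t, l r, measurable B & E = increment w r t j @^-1` B] \/
     [/\ j != i, measurable B & E = increment w s' s j @^-1` B] ].

(** Each generator of the past is a function of grid increments other than the one of step 0 and
    coordinate [i]: past increments use later steps, and the other coordinates of step 0 carry a
    different index. *)
Lemma finite_past_independent s' s i (l : seq R) A B :
  t0 <= s' -> s' < s -> s <= t ->
  <<s past_generators s' s i (fun r => r \in l) >> A -> measurable B ->
  P (A `&` increment w s' s i @^-1` B) =
    (P A * P (increment w s' s i @^-1` B))%E.
Proof.
move=> t0s' s's st sA mB.
pose l' := [seq r <- l | s <= r <= t].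
have hl' : {in l', forall r, s <= r <= t} by move=> r; rewrite mem_filter => /andP[].
have [g [n [g0 g1 glt [n0 gn] hl]]] := strict_grid s's st hl'.
have gt0 k : t0 <= g k.
  by elim: k => [|k ih]; [rewrite g0|rewrite (le_trans ih)// ltW].
pose X (ki : 'I_n * 'I_d) : T -> R := increment w (g ki.1) (g ki.1.+1) ki.2.
have mX ki : measurable_fun setT (X ki) by apply: measurable_increment.
have indep : mutually_independent P X.
  by case: hw => _ _ _ _; apply => //; rewrite g0.
pose i0 : 'I_n * 'I_d := (Ordinal n0, i).
have XE : X i0 = increment w s' s i by rewrite /X/= g0 g1.
rewrite -XE; apply: (mutually_independent_generated mX indep) => //.
set G := [set E | _].
apply: smallest_sub sA; first exact: smallest_sigma_algebra.
pose TG := g_sigma_algebraType G.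
have mXG ki : ki != i0 -> measurable_fun [set: TG] (X ki : TG -> R).
  move=> ki0 _ C mC; rewrite setTI; apply: sub_sigma_algebra.
  by exists ki, C.
(* Increments that start at a grid point of positive index are sums of steps other than step 0; the
   condition [0 < m] is what excludes step 0. *)
have mS m p j : (0 < m <= p)%N -> (p <= n)%N ->
    measurable_fun [set: TG] (increment w (g m) (g p) j : TG -> R).
  move=> /andP[m0]; elim: p => [|p ih]; first by rewrite leqNgt m0.
  rewrite leq_eqVlt => /orP[/eqP<- _|mp pn].
    by rewrite /increment; under eq_fun do rewrite subrr; exact: measurable_cst.
  have -> : increment w (g m) (g p.+1) j =
      (fun o => increment w (g m) (g p) j o + X (Ordinal pn, j) o).
    by apply/funext => o; rewrite /X /increment/=; ring.
  apply: measurable_funD; first by apply: ih; rewrite // ltnW.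
  by apply: mXG; rewrite xpair_eqE negb_and -val_eqE/= -lt0n (leq_trans m0).
have mI C (f : T -> R) : measurable_fun [set: TG] (f : TG -> R) -> measurable C ->
    <<s G >> (f @^-1` C).
  by move=> mf mC; have := mf measurableT _ mC; rewrite setTI.
move=> _ [r [j [C [[srt rl mC ->]|[ji mC ->]]]]].
  have [m mn rE] : exists2 m, (0 < m <= n)%N & r = g m.
    by apply: hl; rewrite mem_filter srt.
  by rewrite rE -gn; apply: mI => //; apply: mS => //.
have -> : increment w s' s j = X (Ordinal n0, j) by rewrite /X/= g0 g1.
by apply: mI => //; apply: mXG; rewrite xpair_eqE negb_and ji orbT.
Qed.

(** Events that look at finitely many past times form an intersection-stable family, since two lists
    of times can be concatenated, and they generate the whole past. *)
Lemma past_independent s' s i A B : t0 <= s' -> s' < s -> s <= t ->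
  <<s past_generators s' s i setT >> A -> measurable B ->
  P (A `&` increment w s' s i @^-1` B) =
    (P A * P (increment w s' s i @^-1` B))%E.
Proof.
move=> t0s' s's st sA mB.
have t0s : t0 <= s by rewrite (le_trans t0s')// ltW.
have mpre r r' j C : t0 <= r -> t0 <= r' -> measurable C ->
    measurable (increment w r r' j @^-1` C).
  by move=> h h' mC; rewrite -[_ @^-1` _]setTI; exact: measurable_increment.
have Gm l : past_generators s' s i l `<=` measurable.
  move=> _ [r [j [C [[/andP[sr rt] _ mC ->]|[_ mC ->]]]]]; apply: mpre => //.
  + exact: le_trans sr.
  + exact: le_trans st.
have sGm l : <<s past_generators s' s i l >> `<=` measurable.
  by apply: smallest_sub; [exact: sigma_algebra_measurable|exact: Gm].
have Gsub (l l' : R -> Prop) : (forall r, l r -> l' r) ->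
    <<s past_generators s' s i l >> `<=` <<s past_generators s' s i l' >>.
  move=> ll'; apply: sub_sigma_algebra2 => _ [r [j [C [[sr lr mC ->]|[ji mC ->]]]]];
    exists r, j, C; [left; split => //; exact: ll'|by right].
pose H : set (set T) := [set E | exists l : seq R,
  <<s past_generators s' s i (fun r => r \in l) >> E].
apply: (@independent_of_generated _ _ _ _ H) => //.
- by move=> E [l] /sGm.
- exists [::]; exact: (@measurableT _ (g_sigma_algebraType (past_generators s' s i (fun r => r \in [::])))).
- move=> E F [l lE] [l' lF]; exists (l ++ l').
  apply: (@measurableI _ (g_sigma_algebraType (past_generators s' s i (fun r => r \in l ++ l')))).
    by apply: Gsub lE => r rl; rewrite mem_cat rl.
  by apply: Gsub lF => r rl; rewrite mem_cat rl orbT.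
- exact: measurable_increment.
- by move=> E D [l lE] mD; exact: finite_past_independent lE mD.
- apply: smallest_sub sA; first exact: smallest_sigma_algebra.
  move=> _ [r [j [C [[sr lr mC ->]|[ji mC ->]]]]]; apply: sub_sigma_algebra.
    exists [:: r]; apply: sub_sigma_algebra; exists r, j, C; left; split => //.
    exact: mem_head.
  by exists [::]; apply: sub_sigma_algebra; exists r, j, C; right.
Qed.

End Wiener_independence.

(** * Adapted variables and the centred noises of one step *)

Section noise.
Context {R : realType} {d : nat} {disp : measure_display}
  {T : measurableType disp} (P : probability T R).
Variables (t0 t : R) (w : R -> T -> 'rV[R]_d).
Hypothesis hw : standard_Wiener P t0 w.
Local Notation E f := (Rintegral P setT f).
Implicit Types (s u : R) (X Y : T -> R).

Definition backward_generators s : set (set T) :=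
  [set E | exists (r : R) (i : 'I_d) (B : set R),
    [/\ s <= r <= t, measurable B & E = increment w r t i @^-1` B]].

(** With the sigma-algebra packaged as a measurable space, adaptedness is ordinary measurability and
    inherits its closure under sums, products and compositions. *)
Definition backward_past s := g_sigma_algebraType (backward_generators s).

Definition adapted s (X : T -> R) :=
  measurable_fun [set: backward_past s] (X : backward_past s -> R).

Lemma adaptedP s X : adapted s X <->
  forall B, measurable B -> backward_filtration w t s (X @^-1` B).
Proof.
split=> [aX B mB|aX _ B mB]; first by have := aX measurableT _ mB; rewrite setTI.
by rewrite setTI; exact: aX.
Qed.

Lemma backward_filtration_subset s u : u <= s ->
  backward_filtration w t s `<=` backward_filtration w t u.
Proof.
move=> us; apply: sub_sigma_algebra2 => _ [r [i [B [/andP[sr rt] mB ->]]]].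
by exists r, i, B; split => //; rewrite (le_trans us).
Qed.

Lemma adapted_subset s u X : u <= s -> adapted s X -> adapted u X.
Proof.
by move=> us /adaptedP aX; apply/adaptedP => B mB; apply: (backward_filtration_subset us); exact: aX.
Qed.

Lemma backward_filtration_measurable s : t0 <= s ->
  backward_filtration w t s `<=` measurable.
Proof.
move=> t0s; apply: smallest_sub; first exact: sigma_algebra_measurable.
move=> _ [r [i [B [/andP[sr rt] mB ->]]]].
rewrite -[_ @^-1` _]setTI; apply: (measurable_increment hw) => //.
- exact: le_trans sr.
- exact: le_trans (le_trans sr rt).
Qed.

Lemma adapted_measurable s X : t0 <= s -> adapted s X -> measurable_fun setT X.
Proof.
move=> t0s /adaptedP aX _ B mB; rewrite setTI.
by apply: (backward_filtration_measurable t0s); exact: aX.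
Qed.

Lemma adapted_increment_to_end s r i : s <= r <= t -> adapted s (increment w r t i).
Proof.
move=> srt; apply/adaptedP => B mB; apply: sub_sigma_algebra.
by exists r, i, B.
Qed.

Lemma adapted_increment s u i : u <= s -> s <= t -> adapted u (increment w u s i).
Proof.
move=> us st.
have -> : increment w u s i = (fun o => increment w u t i o - increment w s t i o).
  by apply/funext => o; rewrite /increment; ring.
apply: measurable_funB; apply: adapted_increment_to_end;
  by rewrite ?lexx ?us ?st ?(le_trans us).
Qed.


(* The centred noises of a second-order expansion: [inl i] stands for [dw_i],
   [inr (i, i)] for [dw_i ^+ 2 - ds] and [inr (i, k)] with [i != k] for [dw_k * dw_i]. *)
Definition noise u s (j : 'I_d + 'I_d * 'I_d) : T -> R :=
  match j with
  | inl i => increment w u s i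
  | inr (i, k) => if i == k then (fun o => increment w u s i o ^+ 2 - (s - u))
                  else (fun o => increment w u s k o * increment w u s i o)
  end.

Section step.
Variables (u s : R).
Hypotheses (t0u : t0 <= u) (us : u < s) (st : s <= t).

Let h0 : 0 < s - u. Proof. by rewrite subr_gt0. Qed.
Let mi i : measurable_fun setT (increment w u s i).
Proof. by apply: (measurable_increment hw) => //; rewrite (le_trans t0u)// ltW. Qed.
Let law i : has_normal_law P (increment w u s i) (s - u).
Proof. by case: hw => _ _ _ hlaw _; exact: hlaw. Qed.

Lemma adapted_noise j : adapted u (noise u s j).
Proof.
have ai i : adapted u (increment w u s i) by apply: adapted_increment => //; exact: ltW.
case: j => [i|[i k]] //=; case: ifP => _; last exact: measurable_funM (ai k) (ai i).
by apply: measurable_funB; [exact: measurable_funX (ai i)|exact: measurable_cst].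
Qed.

Lemma backward_past_subset i :
  backward_filtration w t s `<=` <<s past_generators t w u s i setT >>.
Proof.
apply: sub_sigma_algebra2 => _ [r [j [B [srt mB ->]]]].
by exists r, j, B; left.
Qed.

Lemma adapted_independent i X : adapted s X ->
  independent_RVs P X (increment w u s i).
Proof.
move=> /adaptedP aX A B mA mB.
by apply: (past_independent hw t0u us st) => //; apply: backward_past_subset; exact: aX.
Qed.

Lemma adapted_mul_independent i k X : k != i -> adapted s X ->
  independent_RVs P (fun o => X o * increment w u s k o) (increment w u s i).
Proof.
move=> ki aX A B mA mB.
apply: (past_independent hw t0u us st) => //.
pose G := past_generators t w u s i setT.
have mX : measurable_fun [set: g_sigma_algebraType G] (X : g_sigma_algebraType G -> R).
  move=> _ C mC; rewrite setTI; apply: backward_past_subset.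
  by move/adaptedP : aX; exact.
have mk : measurable_fun [set: g_sigma_algebraType G]
    (increment w u s k : g_sigma_algebraType G -> R).
  move=> _ C mC; rewrite setTI; apply: sub_sigma_algebra.
  by exists s, k, C; right.
by have := measurable_funM mX mk measurableT mA; rewrite setTI.
Qed.

(** The process runs backward, so the past is known at the later end [s] and the noise of [[u, s]]
    is still to come. For a product of two different coordinates, one factor is absorbed into the
    past: [X * dw_k] is independent of the centred [dw_i]. *)
Lemma noise_mul j X : adapted s X -> L1 P X ->
  L1 P (fun o => X o * noise u s j o) /\ E (fun o => X o * noise u s j o) = 0.
Proof.
have t0s : t0 <= s by rewrite (le_trans t0u)// ltW.
have Li i : L1 P (increment w u s i) := normal_law_L1 (mi i) h0 (law i).
have Ei i : E (increment w u s i) = 0 := normal_law_mean (mi i) h0 (law i).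
move=> aX LX; case: j => [i|[i k]] /=.
  have XY := adapted_independent i aX; split; first exact: independent_L1.
  by rewrite independent_expectation// Ei mulr0.
have [_|ik] := eqVneq i k.
  set Y := fun o => increment w u s i o ^+ 2 - (s - u).
  have XY : independent_RVs P X Y.
    move=> A B mA mB.
    have mf : measurable_fun setT (fun x : R => x ^+ 2 - (s - u)).
      by apply: measurable_funB => //; exact: measurable_funX.
    have := adapted_independent i aX mA (mf measurableT B mB).
    by rewrite setTI.
  have LY2 := normal_law_L1_sqr (mi i) h0 (law i).
  have LY : L1 P Y by apply: L1B => //; exact: L1_cst.
  split; first exact: independent_L1.
  rewrite independent_expectation//.
  rewrite (_ : E Y = 0) ?mulr0// /Y ErB//; last exact: L1_cst.
  by rewrite Er_cst (ErE (normal_law_sqr (mi i) h0 (law i))) subrr.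
have XY := adapted_mul_independent (k := k) (i := i) _ aX.
rewrite eq_sym in ik.
have LXk : L1 P (fun o => X o * increment w u s k o).
  by apply: independent_L1 => //; exact: adapted_independent.
have -> : (fun o => X o * (increment w u s k o * increment w u s i o)) =
  (fun o => X o * increment w u s k o * increment w u s i o).
  by apply/funext => o; rewrite mulrA.
split; first by apply: independent_L1 => //; exact: XY.
by rewrite independent_expectation// ?Ei ?mulr0//; exact: XY.
Qed.

(** One bound for the three kinds, with [h = s - u]: the second moments are [h] for [dw_i],
    [2 * h ^+ 2] for [dw_i ^+ 2 - h], and at most [3 * h ^+ 2] for a mixed product, by
    [2 * x * y <= x ^+ 2 + y ^+ 2] and the fourth moments. *)
Lemma noise_sqr j : L1 P (fun o => noise u s j o ^+ 2) /\
  E (fun o => noise u s j o ^+ 2) <= (s - u) + 3 * (s - u) ^+ 2.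
Proof.
set h := s - u.
have L2 i := normal_law_L1_sqr (mi i) h0 (law i).
have L4 i := normal_law_L1_exp4 (mi i) h0 (law i).
have E2 i : E (fun o => increment w u s i o ^+ 2) = h.
  exact: ErE (normal_law_sqr (mi i) h0 (law i)).
have E4 i : E (fun o => increment w u s i o ^+ 4) = 3 * h ^+ 2.
  exact: ErE (normal_law_exp4 (mi i) h0 (law i)).
have h2 := sqr_ge0 h.
case: j => [i|[i k]] /=; first by rewrite E2; split => //; rewrite lerDl; lra.
case: ifPn => ik.
  have -> : (fun o => (increment w u s i o ^+ 2 - (s - u)) ^+ 2) =
    (fun o => (increment w u s i o ^+ 4 + h ^+ 2) - 2 * h * increment w u s i o ^+ 2).
    by apply/funext => o; rewrite /h; ring.
  split; first by apply: L1B; [apply: L1D => //; exact: L1_cst|exact: L1Z].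
  rewrite ErB; [|by apply: L1D => //; exact: L1_cst|exact: L1Z].
  rewrite ErD//; last exact: L1_cst.
  rewrite ErZ// Er_cst E2 E4.
  by rewrite -/h; have := h0; rewrite -/h; nra.
pose b o := 2^-1 * (increment w u s k o ^+ 4 + increment w u s i o ^+ 4).
have Lb : L1 P b by apply: L1Z; exact: L1D.
have le o : (increment w u s k o * increment w u s i o) ^+ 2 <= b o.
  have := sqr_ge0 (increment w u s k o ^+ 2 - increment w u s i o ^+ 2).
  by rewrite /b; set x := increment _ _ _ _ _; set y := increment _ _ _ _ _; nra.
have L : L1 P (fun o => (increment w u s k o * increment w u s i o) ^+ 2).
  apply: L1_le Lb; first by apply: measurable_funX; exact: measurable_funM.
  by move=> o; rewrite ger0_norm ?sqr_ge0.
split => //; apply: (le_trans (Er_le L Lb le)).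
rewrite /b ErZ ?ErD ?E4//; last exact: L1D.
by have := h0; rewrite -/h; nra.
Qed.

Lemma Er_sum_increment_sqr :
  L1 P (fun o => \sum_i increment w u s i o ^+ 2) /\
  E (fun o => \sum_i increment w u s i o ^+ 2) = d%:R * (s - u).
Proof.
have L2 i := normal_law_L1_sqr (mi i) h0 (law i).
split; first exact: L1_sum.
rewrite Er_sum//.
under eq_bigr do rewrite (ErE (normal_law_sqr (mi _) h0 (law _))).
by rewrite sumr_const card_ord mulr_natl.
Qed.

End step.
End noise.

(** * Martingale transforms *)

Lemma sqr_sum_le {R : realType} (J : finType) (x : J -> R) :
  (\sum_j x j) ^+ 2 <= #|J|%:R * \sum_j x j ^+ 2.
Proof.
rewrite expr2 mulr_suml.
have -> : #|J|%:R * \sum_j x j ^+ 2 = \sum_i \sum_j 2^-1 * (x i ^+ 2 + x j ^+ 2).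
  transitivity (\sum_i (2^-1 * (#|J|%:R * x i ^+ 2) + 2^-1 * \sum_j x j ^+ 2)).
    rewrite big_split/= -!mulr_sumr sumr_const mulr_natl -mulr_natr.
    by rewrite -[LHS]mulr1; field.
  apply: eq_bigr => i _; rewrite -mulr_sumr big_split/= -mulrDr; congr (_ * (_ + _)).
  by rewrite sumr_const mulr_natl.
apply: ler_sum => i _; rewrite mulr_sumr; apply: ler_sum => j _.
have h := sqr_ge0 (x i - x j); nra.
Qed.

Section martingale_transform.
Context {R : realType} {d : nat} {disp : measure_display}
  {T : measurableType disp} (P : probability T R).
Variables (t0 t : R) (w : R -> T -> 'rV[R]_d).
Hypothesis hw : standard_Wiener P t0 w.
Local Notation E f := (Rintegral P setT f).
Local Notation J := ('I_d + 'I_d * 'I_d)%type.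
Variables (N : nat) (s : nat -> R) (h C : R) (c : nat -> J -> T -> R).
Hypotheses (h_gt0 : 0 < h) (s_step : forall k, s k - s k.+1 = h)
  (t0sN : t0 <= s N) (s0t : s 0%N <= t)
  (c_adapted : forall k j, (k < N)%N -> adapted t w (s k) (c k j))
  (c_bounded : forall k j o, (k < N)%N -> `|c k j o| <= C).

(** The times [s k] decrease, and [c k j] is adapted at the later end [s k] of its step: this is
    predictability in reversed time. *)
Definition transform n o : R :=
  \sum_(k < n) \sum_j c k j o * noise w (s k.+1) (s k) j o.

(** The Cauchy-Schwarz inequality over the index set of the noises, then the common bound on their
    second moments. *)
Definition transform_bound : R := (C * #|{: J}|%:R) ^+ 2 * (h + 3 * h ^+ 2).

Let sS k : s k.+1 < s k. Proof. by rewrite -subr_gt0 s_step. Qed.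

Let s_le k n : (k <= n)%N -> s n <= s k.
Proof.
elim: n => [|n ih]; first by rewrite leqn0 => /eqP ->.
by rewrite leq_eqVlt => /orP[/eqP->//|/ih]; apply/le_trans/ltW.
Qed.

Let t0s k : (k <= N)%N -> t0 <= s k.
Proof. by move=> kN; apply: (le_trans t0sN); exact: s_le. Qed.

Let st k : s k <= t. Proof. by apply: le_trans s0t; exact: s_le. Qed.

Lemma transformS n o : transform n.+1 o =
  transform n o + \sum_j c n j o * noise w (s n.+1) (s n) j o.
Proof. by rewrite /transform big_ord_recr. Qed.

Lemma adapted_transform n : (n <= N)%N -> adapted t w (s n) (transform n).
Proof.
elim: n => [|n ih] nN.
  by rewrite /adapted /transform; under eq_fun do rewrite big_ord0; exact: measurable_cst.
have -> : transform n.+1 = (fun o => transform n o + \sum_j c n j o * noise w (s n.+1) (s n) j o).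
  by apply/funext => o; exact: transformS.
apply: measurable_funD.
  by apply: (adapted_subset (ltW (sS n))); apply: ih; exact: ltnW.
apply: measurable_sum => j; apply: measurable_funM.
  by apply: (adapted_subset (ltW (sS n))); exact: c_adapted.
exact: adapted_noise.
Qed.

Let step_mul n X : (n < N)%N -> adapted t w (s n) X -> L1 P X ->
  L1 P (fun o => X o * \sum_j c n j o * noise w (s n.+1) (s n) j o) /\
  E (fun o => X o * \sum_j c n j o * noise w (s n.+1) (s n) j o) = 0.
Proof.
move=> nN aX LX.
have K j := @noise_mul _ _ _ _ _ _ _ _ hw _ _ (t0s nN) (sS n) (st n) j
  (fun o => c n j o * X o).
have Lc j : L1 P (fun o => c n j o * X o).
  apply: (@L1_mul_bounded _ _ _ _ C) => //; last by move=> o; exact: c_bounded.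
  exact: (adapted_measurable hw (t0s (ltnW nN)) (c_adapted j nN)).
have ac j : adapted t w (s n) (fun o => c n j o * X o).
  exact: measurable_funM (c_adapted j nN) aX.
have -> : (fun o => X o * \sum_j c n j o * noise w (s n.+1) (s n) j o) =
  (fun o => \sum_j (c n j o * X o) * noise w (s n.+1) (s n) j o).
  by apply/funext => o; rewrite mulr_sumr; apply: eq_bigr => j _; ring.
split; first by apply: L1_sum => j; have [] := K j (ac j) (Lc j).
rewrite Er_sum => [|j]; last by have [] := K j (ac j) (Lc j).
by rewrite big1// => j _; have [] := K j (ac j) (Lc j).
Qed.

Let step_sqr n : (n < N)%N ->
  L1 P (fun o => (\sum_j c n j o * noise w (s n.+1) (s n) j o) ^+ 2) /\
  E (fun o => (\sum_j c n j o * noise w (s n.+1) (s n) j o) ^+ 2) <= transform_bound.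
Proof.
move=> nN.
have K j := @noise_sqr _ _ _ _ _ _ _ hw _ _ (t0s nN) (sS n) j.
pose b o := #|{: J}|%:R * \sum_j C ^+ 2 * noise w (s n.+1) (s n) j o ^+ 2.
have Lj j : L1 P (fun o => C ^+ 2 * noise w (s n.+1) (s n) j o ^+ 2).
  by apply: L1Z; have [] := K j.
have Lb : L1 P b by apply/L1Z/L1_sum.
have le o : (\sum_j c n j o * noise w (s n.+1) (s n) j o) ^+ 2 <= b o.
  apply: (le_trans (sqr_sum_le _)); rewrite ler_wpM2l//.
  apply: ler_sum => j _; rewrite exprMn ler_wpM2r ?sqr_ge0//.
  rewrite -[c _ _ _ ^+ 2]real_normK ?num_real// lerXn2r ?nnegrE//.
    by rewrite (le_trans (normr_ge0 (c n j o)))// c_bounded.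
  exact: c_bounded.
have L : L1 P (fun o => (\sum_j c n j o * noise w (s n.+1) (s n) j o) ^+ 2).
  apply: L1_le Lb; last by move=> o; rewrite ger0_norm ?sqr_ge0.
  apply: measurable_funX; apply: measurable_sum => j; apply: measurable_funM.
    exact: (adapted_measurable hw (t0s (ltnW nN)) (c_adapted j nN)).
  apply: (adapted_measurable hw (t0s nN)); exact: adapted_noise.
split => //; apply: (le_trans (Er_le L Lb le)).
rewrite /b ErZ; last exact: L1_sum.
rewrite Er_sum// (_ : transform_bound =
  #|{: J}|%:R * \sum_(j : J) C ^+ 2 * (h + 3 * h ^+ 2)); last first.
  by rewrite sumr_const -mulr_natl /transform_bound; ring.
rewrite ler_wpM2l//.
apply: ler_sum => j _; have [Lj2 Ej2] := K j.
by rewrite ErZ// ler_wpM2l ?sqr_ge0//; move: Ej2; rewrite s_step.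
Qed.

(** Orthogonality of martingale differences: in the square of a sum, the cross term of the last step
    with the earlier ones has mean 0, so second moments add up. *)
Lemma transform_moments n : (n <= N)%N ->
  [/\ L1 P (transform n), E (transform n) = 0,
      L1 P (fun o => transform n o ^+ 2) &
      E (fun o => transform n o ^+ 2) <= n%:R * transform_bound].
Proof.
elim: n => [|n ih] nN.
  have -> : transform 0 = (fun=> 0) by apply/funext => o; rewrite /transform big_ord0.
  split; rewrite ?Er_cst ?expr0n ?mul0r//; exact: L1_cst.
have [LV EV LV2 EV2] := ih (ltnW nN).
have aV := adapted_transform (ltnW nN).
have [L2 E2] := step_sqr nN.
have [L11 E11] := step_mul nN (@measurable_cst _ _ _ _ _ (1:R)) (L1_cst P 1).
have [LVv EVv] := step_mul nN aV LV.
set v := fun o => \sum_j c n j o * noise w (s n.+1) (s n) j o.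
have Lv : L1 P v by move: L11; under eq_fun do rewrite mul1r.
have Ev : E v = 0 by move: E11; under eq_Rintegral do rewrite mul1r.
have -> : transform n.+1 = (fun o => transform n o + v o).
  by apply/funext => o; exact: transformS.
have e2 : (fun o => (transform n o + v o) ^+ 2) =
    (fun o => (transform n o ^+ 2 + 2 * (transform n o * v o)) + v o ^+ 2).
  by apply/funext => o; ring.
have La : L1 P (fun o => transform n o ^+ 2 + 2 * (transform n o * v o)).
  by apply: L1D => //; exact: L1Z.
split.
- exact: L1D.
- by rewrite ErD// EV Ev addr0.
- by rewrite e2; exact: L1D.
- rewrite e2 ErD// ErD//; last exact: L1Z.
  by rewrite ErZ// EVv mulr0 addr0 -natr1 mulrDl mul1r lerD.
Qed.

End martingale_transform.

(** * Second-order expansions *)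

Section line_derivatives.
Context {R : realType} {V : normedModType R}.
Implicit Types (f : V -> R) (x v : V).

(** A directional derivative is by definition a derivative in one real variable; the chain rule and
    the mean value theorem of the real line become available through this equivalence. *)
Lemma is_derive_lineP f x v df :
  is_derive x v f df <-> is_derive (0 : R) 1 (fun h : R => f (h *: v + x)) df.
Proof.
have E : (fun h : R => h^-1 *: ((f \o shift x) (h *: v) - f x)) =
    (fun h : R => h^-1 *: (((fun h : R => f (h *: v + x)) \o shift 0) (h *: 1) -
      (fun h : R => f (h *: v + x)) 0)).
  by apply/funext => h /=; rewrite addr0 scale0r add0r [_%:A]mulr1.
by split => -[dv De]; split; move: dv De; rewrite /derivable /derive E.
Qed.

Lemma is_derive_along_line f x v (r df : R) : is_derive (r *: v + x) v f df ->
  is_derive r 1 (fun h : R => f (h *: v + x)) df.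
Proof.
move=> /is_derive_lineP D.
have ds : is_derive r 1 (fun h : R => h - r) 1.
  have := is_deriveB (is_derive_id r 1) (is_derive_cst r r 1).
  by rewrite subr0; apply.
have {}D : is_derive ((fun h : R => h - r) r) 1 (fun h : R => f (h *: v + (r *: v + x))) df.
  by rewrite subrr.
have := @is_derive1_comp _ (fun h : R => f (h *: v + (r *: v + x)))
  (fun h : R => h - r) r _ _ D ds; rewrite mulr1.
rewrite (_ : _ \o _ = (fun h : R => f (h *: v + x)))//.
by apply/funext => h /=; rewrite addrA -scalerDl subrK.
Qed.

Lemma is_derive_expR_comp f x v df : is_derive x v f df ->
  is_derive x v (fun y => expR (f y)) (expR (f x) * df).
Proof.
move=> /is_derive_lineP D; apply/is_derive_lineP.
have := @is_derive1_comp _ expR _ 0 _ _ (is_derive_expR _) D.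
by rewrite scale0r add0r.
Qed.

Lemma is_derive_mulr f (g : V -> R) x v (df dg : R) :
  is_derive x v f df -> is_derive x v g dg ->
  is_derive x v (fun y => f y * g y) (f x * dg + g x * df).
Proof. by move=> Df Dg; exact: is_deriveM Df Dg. Qed.

Lemma is_derive_addr f (g : V -> R) x v (df dg : R) :
  is_derive x v f df -> is_derive x v g dg ->
  is_derive x v (fun y => f y + g y) (df + dg).
Proof. by move=> Df Dg; exact: is_deriveD Df Dg. Qed.

Lemma is_derive_scaler k f x v (df : R) :
  is_derive x v f df -> is_derive x v (fun y => k * f y) (k * df).
Proof. by move=> Df; exact: is_deriveZ Df. Qed.

End line_derivatives.

Lemma is_derive_mulrr {R : realType} (r u : R) : is_derive u (1 : R) (fun u : R => u * r) r.
Proof.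
have D := is_derive_mulr (is_derive_id u (1 : R)) (is_derive_cst r u (1 : R)).
by apply: (is_derive_eq D); rewrite mulr0 add0r mulr1.
Qed.

Section line_mean_value.
Context {R : realType} {V : normedModType R}.
Implicit Types (f : V -> R) (x v : V).

Lemma is_derive_along_scaled_line f x v (r u df : R) :
  is_derive ((u * r) *: v + x) v f df ->
  is_derive u (1 : R) (fun u : R => f ((u * r) *: v + x)) (df * r).
Proof.
move=> /is_derive_along_line D.
exact: (@is_derive1_comp _ (fun h : R => f (h *: v + x)) (fun u : R => u * r)
  u _ _ D (is_derive_mulrr r u)).
Qed.

(** The segment is parametrized by a fraction in [[0, 1]], so that both signs of [r] are treated at
    once. *)
Lemma line_MVT f x v (r : R) (df : V -> R) :
  (forall y, is_derive y v f (df y)) ->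
  exists2 th : R, 0 <= th <= 1 &
    f (r *: v + x) - f x = r * df ((th * r) *: v + x).
Proof.
move=> D.
pose g (u : R) : R := f ((u * r) *: v + x).
have Dg (u : R) : is_derive u (1:R) g (df ((u * r) *: v + x) * r).
  exact: is_derive_along_scaled_line.
have cg : {within `[0, 1], continuous g}.
  apply: continuous_subspaceT => u.
  by apply/differentiable_continuous/derivable1_diffP; have [] := Dg u.
have [th th01] := @MVT_segment R g _ 0 1 ler01 (fun u _ => Dg u) cg.
rewrite subr0 mulr1 /g mul1r mul0r scale0r add0r => ->.
by exists th; [move: th01; rewrite in_itv|rewrite mulrC].
Qed.

(* Applying the mean value theorem twice avoids assuming that the second
   derivative is continuous. *)
Lemma line_Taylor2 f x v (r c e : R) (df ddf : V -> R) :
  (forall y, is_derive y v f (df y)) -> (forall y, is_derive y v df (ddf y)) ->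
  (forall th, 0 <= th <= 1 -> `|ddf ((th * r) *: v + x) - c| <= e) ->
  `|f (r *: v + x) - f x - r * df x - 2^-1 * c * r ^+ 2| <= e * r ^+ 2.
Proof.
move=> D DD he.
(* The error of the quadratic approximation at the fraction [u] of the segment; its derivative is
   [r] times the error of the linear approximation of [df], to which the mean value theorem applies
   again. *)
pose g (u : R) : R := f ((u * r) *: v + x) - u * r * df x - 2^-1 * c * (u * r) ^+ 2.
have Dg (u : R) : is_derive u (1:R) g (r * (df ((u * r) *: v + x) - df x - c * (u * r))).
  have d1 := is_derive_mulrr r u.
  have d2 := is_derive_along_scaled_line (D ((u * r) *: v + x)).
  have d3 := is_derive_mulr d1 (is_derive_cst (df x) u (1 : R)).
  have d4 := is_derive_scaler (2^-1 * c) (is_derive_mulr d1 d1).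
  have := is_deriveB (is_deriveB d2 d3) d4.
  rewrite (_ : _ - _ - _ = g); last by apply/funext.
  by move=> Dg; apply: (is_derive_eq Dg); rewrite /cst; field.
have cg : {within `[0, 1], continuous g}.
  apply: continuous_subspaceT => u.
  by apply/differentiable_continuous/derivable1_diffP; have [] := Dg u.
have [th th01] := @MVT_segment R g _ 0 1 ler01 (fun u _ => Dg u) cg.
rewrite subr0 mulr1 {1 2}/g !mul1r !mul0r scale0r add0r expr0n/= mulr0 !subr0.
have [th' th'01 E] := line_MVT x (th * r) DD.
rewrite E => E'.
have -> : f (r *: v + x) - f x - r * df x - 2^-1 * c * r ^+ 2 =
   r * (th * r * ddf (th' * (th * r) *: v + x) - c * (th * r)) by lra.
have -> : r * (th * r * ddf (th' * (th * r) *: v + x) - c * (th * r)) =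
  th * r ^+ 2 * (ddf (th' * (th * r) *: v + x) - c) by ring.
rewrite mulrC normrM; apply: ler_pM => //.
  by rewrite mulrA; apply: he; move: th01; rewrite in_itv/= => /andP[]; nra.
rewrite ger0_norm; last by rewrite mulr_ge0 ?sqr_ge0//; move: th01; rewrite in_itv/= => /andP[].
by rewrite ler_piMl ?sqr_ge0//; move: th01; rewrite in_itv/= => /andP[].
Qed.

End line_mean_value.

Section coordinate_Taylor.
Context {R : realType} {d : nat}.
Implicit Types (x y z : 'rV[R]_d) (i j : 'I_d).

Definition in_box x y z : Prop := forall k, exists2 th : R, 0 <= th <= 1 &
  z 0 k = x 0 k + th * (y 0 k - x 0 k).

Variables (g : 'rV[R]_d -> R) (g1 : 'I_d -> 'rV[R]_d -> R)
  (g2 : 'I_d -> 'I_d -> 'rV[R]_d -> R) (x y : 'rV[R]_d) (e : R).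
Hypotheses (Dg : forall z i, is_derive z (delta_mx 0 i) g (g1 i z))
  (Dg1 : forall z i j, is_derive z (delta_mx 0 j) (g1 i) (g2 i j z))
  (osc : forall z i j, in_box x y z -> `|g2 i j z - g2 i j x| <= e).

Let v i := y 0 i - x 0 i.

(* The path from [x] to [y] that moves one coordinate at a time. *)
Let corner (m : nat) : 'rV[R]_d := \row_(k < d) (if (k < m)%N then y 0 k else x 0 k).

Let corner0 : corner 0 = x.
Proof. by apply/rowP => k; rewrite mxE. Qed.

Let cornerd : corner d = y.
Proof. by apply/rowP => k; rewrite mxE ltn_ord. Qed.

Let cornerS i : corner i.+1 = v i *: delta_mx 0 i + corner i.
Proof.
apply/rowP => k; rewrite !mxE eqxx/= ltnS leq_eqVlt /v.
have [->|ki] := eqVneq k i; first by rewrite eqxx ltnn/= mulr1 subrK.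
by rewrite (inj_eq val_inj) (negbTE ki)/= mulr0 add0r.
Qed.

Let box_corner i (th : R) : 0 <= th <= 1 ->
  in_box x y ((th * v i) *: delta_mx 0 i + corner i).
Proof.
move=> th01 k; rewrite !mxE eqxx/=; have [->|ki] := eqVneq k i.
  by exists th => //; rewrite ltnn /v mulr1 addrC.
rewrite mulr0 add0r; case: ifP => _; first by exists 1; rewrite ?lexx ?ler01//; ring.
by exists 0; rewrite ?lexx ?ler01//; ring.
Qed.

(** Along the [i]-th edge a one-dimensional expansion is made at the corner. Moving its first
    derivative back from the corner to [x] crosses the earlier edges [j < i] and produces the mixed
    terms, which is why they come once per pair [j < i], with full coefficient. *)
Lemma coordinate_Taylor2 :
  `|g y - g x - \sum_i v i * g1 i x - \sum_i 2^-1 * g2 i i x * v i ^+ 2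
    - \sum_(i < d) \sum_(j < d | (j < i)%N) g2 i j x * (v j * v i)|
  <= e * (\sum_i `|v i|) ^+ 2.
Proof.
have e0 (i : 'I_d) : 0 <= e.
  apply: (le_trans (normr_ge0 (g2 i i x - g2 i i x))); apply: osc => k.
  by exists 0; rewrite ?lexx ?ler01//; ring.
have gE : g y - g x = \sum_(i < d) (g (corner i.+1) - g (corner i)).
  have := @telescope_sumr _ 0 d (fun m => g (corner m)) (leq0n d).
  by rewrite big_mkord cornerd corner0 => ->.
have T1 i : `|g (corner i.+1) - g (corner i) - v i * g1 i (corner i)
    - 2^-1 * g2 i i x * v i ^+ 2| <= e * v i ^+ 2.
  rewrite cornerS; apply: line_Taylor2 => // th th01.
  by apply: osc; exact: box_corner.
have T2 i : `|g1 i (corner i) - g1 i x - \sum_(j < d | (j < i)%N) g2 i j x * v j| <=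
    e * \sum_(j < d | (j < i)%N) `|v j|.
  have -> : g1 i (corner i) - g1 i x =
      \sum_(j < d | (j < i)%N) (g1 i (corner j.+1) - g1 i (corner j)).
    have := @telescope_sumr _ 0 i (fun m => g1 i (corner m)) (leq0n i).
    rewrite big_mkord corner0 => <-.
    by rewrite (big_ord_widen _ (fun m => g1 i (corner m.+1) - g1 i (corner m)) (ltnW (ltn_ord i))).
  rewrite -sumrB mulr_sumr; apply: le_trans (ler_norm_sum _ _ _) _.
  apply: ler_sum => j _.
  have [th th01] := line_MVT (corner j) (v j) (fun z => Dg1 z i j).
  rewrite cornerS => ->; rewrite [g2 i j x * _]mulrC -mulrBr normrM mulrC.
  by rewrite ler_wpM2r//; apply: osc; exact: box_corner.
rewrite gE -!sumrB; apply: le_trans (ler_norm_sum _ _ _) _.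
rewrite expr2 mulr_suml mulr_sumr; apply: ler_sum => i _.
have -> : g (corner i.+1) - g (corner i) - v i * g1 i x - 2^-1 * g2 i i x * v i ^+ 2 -
    \sum_(j < d | (j < i)%N) g2 i j x * (v j * v i) =
  (g (corner i.+1) - g (corner i) - v i * g1 i (corner i) - 2^-1 * g2 i i x * v i ^+ 2) +
  v i * (g1 i (corner i) - g1 i x - \sum_(j < d | (j < i)%N) g2 i j x * v j).
  rewrite [in RHS]mulrBr mulr_sumr.
  under [X in _ = _ + (_ - X)]eq_bigr do rewrite [v i * _]mulrC -mulrA.
  ring.
apply: le_trans (ler_normD _ _) _.
rewrite normrM; apply: (@le_trans _ _ (e * v i ^+ 2 + `|v i| * (e * \sum_(j < d | (j < i)%N) `|v j|))).
  by rewrite lerD// ler_wpM2l.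
rewrite [leRHS]mulrA -[v i ^+ 2]real_normK ?num_real//.
have -> : e * `|v i| ^+ 2 + `|v i| * (e * \sum_(j < d | (j < i)%N) `|v j|) =
  e * `|v i| * (`|v i| + \sum_(j < d | (j < i)%N) `|v j|) by ring.
rewrite ler_wpM2l ?mulr_ge0//; first exact: e0.
rewrite [leRHS](bigID (fun j : 'I_d => (j < i)%N))/= [leLHS]addrC lerD2l.
by rewrite [leRHS](bigD1 i) ?ltnn//= lerDl sumr_ge0.
Qed.

End coordinate_Taylor.

(** From [expR (- z) >= 1 - z] follows [expR z * (1 - z) <= 1], hence
    [(expR z - 1 - z) * (1 - z) <= z ^+ 2], while [1 - z >= 1 / 2]. *)
Lemma expR_second_order {R : realType} (z : R) : `|z| <= 2^-1 ->
  `|expR z - 1 - z| <= 2 * z ^+ 2.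
Proof.
rewrite ler_norml => /andP[z1 z2].
have h1 := expR_ge1Dx z; have h2 := expR_ge1Dx (- z).
have h3 : expR z * expR (- z) = 1 by rewrite -expRD subrr expR0.
have h4 : expR z * (1 - z) <= 1 by rewrite -[leRHS]h3 ler_wpM2l ?expR_ge0.
rewrite ger0_norm; last lra.
set E := expR z in h1 h3 h4 *.
have h5 : (E - 1 - z) * (1 - z) <= z ^+ 2 by nra.
nra.
Qed.

(** * One backward step of length [h], reduced to inequalities between numbers *)

Section one_step_estimate.
Context {R : realType} {d : nat}.
Variables (sigma beta C eta h : R) (f0 fu fs ft c : R).
Variables (b f1 v D : 'I_d -> R) (f2 : 'I_d -> 'I_d -> R).
Hypotheses (sigma_ge0 : 0 <= sigma) (beta_ge0 : 0 <= beta) (C_ge1 : 1 <= C)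
  (h_gt0 : 0 < h) (h_eta : h <= eta) (eta_le1 : eta <= 1)
  (eta_small : beta * eta * C <= 2^-1).
Hypotheses (fuC : `|fu| <= C) (cC : `|c| <= C)
  (bC : forall i, `|b i| <= C) (f1C : forall i, `|f1 i| <= C)
  (f2C : forall i j, `|f2 i j| <= C) (D_eta : forall i, `|D i| <= eta).
Hypotheses (Hu : `|fu - f0| <= eta) (Ht : `|fu - fs + h * ft| <= eta * h)
  (Hs : `|fs - f0 - \sum_i v i * f1 i - \sum_i 2^-1 * f2 i i * v i ^+ 2
     - \sum_(i < d) \sum_(j < d | (j < i)%N) f2 i j * (v j * v i)|
     <= eta * (\sum_i `|v i|) ^+ 2)
  (Hv : forall i, `|v i + h * b i + sigma * D i| <= eta * h)
  (generator : beta * c * f0 - ft - \sum_i b i * f1 i =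
     - (sigma ^+ 2 / 2) * \sum_i f2 i i).

(** For a step from [s] back to [u]: [f0], [fs], [fu] are the values of [f] at [(s, x s)],
    [(s, x u)], [(u, x u)]; [v] is the displacement [x u - x s], [D] the noise [w s - w u]; the
    other letters are coefficients at [(s, x s)]. To leading order [v] is [- sigma * D], and the
    diagonal squares are centred by [h]. *)
Definition step_main : R :=
  \sum_i (- sigma * f1 i) * D i
  + \sum_i (sigma ^+ 2 / 2 * f2 i i) * (D i ^+ 2 - h)
  + \sum_(i < d) \sum_(j < d | (j < i)%N) (sigma ^+ 2 * f2 i j) * (D j * D i).

(** In order: the exponential beyond first order; its linear part times [fu - f0]; the time
    increment; the drift error in the first-order term; the replacement of [v j * v i] by
    [sigma ^+ 2 * (D j * D i)] in the diagonal and mixed terms; the Taylor remainder in space. *)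
Definition step_constant : R :=
  2 * beta ^+ 2 * C ^+ 3 + beta * C + 1 + d%:R * C
  + (d%:R + d%:R ^+ 2) * (C * (4 * C ^+ 2 + 4 * sigma * C))
  + d%:R * (d%:R * (8 * C ^+ 2) + 2 * sigma ^+ 2).

Let eta0 : 0 < eta. Proof. exact: lt_le_trans h_eta. Qed.

Let rhoC i : `|v i + sigma * D i| <= 2 * C * h.
Proof.
have -> : v i + sigma * D i = (v i + h * b i + sigma * D i) - h * b i by ring.
apply: le_trans (ler_normB _ _) _.
have h1 := Hv i; have h2 : `|h * b i| <= h * C by rewrite normrM gtr0_norm// ler_wpM2l// ltW.
have h3 : eta * h <= C * h by rewrite ler_wpM2r ?(ltW h_gt0)// (le_trans eta_le1).
lra.
Qed.

(** With [r = v + sigma * D], of order [h], the difference consists of one product of two [r] and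
    two products of [r] with [sigma * D]; the bounds [h <= eta] and [|D| <= eta] make all of them of
    order [eta * h]. *)
Let prodC i j : `|v j * v i - sigma ^+ 2 * (D j * D i)| <=
  (4 * C ^+ 2 + 4 * sigma * C) * (eta * h).
Proof.
pose r k := v k + sigma * D k.
have rC k : `|r k| <= 2 * C * h := rhoC k.
have -> : v j * v i - sigma ^+ 2 * (D j * D i) =
  r j * r i - sigma * (D j * r i) - sigma * (D i * r j) by rewrite /r; ring.
have Ch0 : 0 <= 2 * C * h by apply: le_trans (rC i).
have m1 : `|r j * r i| <= (2 * C * h) * (2 * C * h) by rewrite normrM ler_pM.
have m2 k l : `|sigma * (D k * r l)| <= sigma * (eta * (2 * C * h)).
  by rewrite normrM (ger0_norm sigma_ge0) ler_wpM2l// normrM ler_pM.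
have m3 : h * h <= eta * h by rewrite ler_wpM2r// ltW.
have m4 : (2 * C * h) * (2 * C * h) <= 4 * C ^+ 2 * (eta * h).
  have -> : (2 * C * h) * (2 * C * h) = 4 * C ^+ 2 * (h * h) by ring.
  by rewrite ler_wpM2l// mulr_ge0// sqr_ge0.
apply: le_trans (ler_normB _ _) _.
have m5 := ler_normB (r j * r i) (sigma * (D j * r i)).
have m6 := m2 j i; have m7 := m2 i j.
have -> : (4 * C ^+ 2 + 4 * sigma * C) * (eta * h) =
  4 * C ^+ 2 * (eta * h) + sigma * (eta * (2 * C * h)) + sigma * (eta * (2 * C * h)) by ring.
lra.
Qed.

Lemma step_estimate :
  `|expR (beta * h * c) * fu - f0 - step_main| <=
  step_constant * eta * (h + \sum_i D i ^+ 2).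
Proof.
have C0 : 0 <= C by exact: le_trans ler01 _.
have eh0 : 0 <= eta * h by rewrite mulr_ge0// ltW.
set z := beta * h * c.
have zC : `|z| <= beta * h * C.
  by rewrite /z normrM ger0_norm ?mulr_ge0 ?(ltW h_gt0)// ler_wpM2l// mulr_ge0// ltW.
have zh : `|z| <= 2^-1.
  apply: (le_trans zC); apply: le_trans eta_small.
  by rewrite ler_wpM2r// ler_wpM2l.
have E1 : `|(expR z - 1 - z) * fu| <= 2 * beta ^+ 2 * C ^+ 3 * (eta * h).
  rewrite normrM; apply: (@le_trans _ _ (2 * z ^+ 2 * C)).
    by rewrite ler_pM// expR_second_order.
  have z2 : z ^+ 2 <= (beta * h * C) ^+ 2.
    rewrite -[z ^+ 2]real_normK ?num_real// lerXn2r// nnegrE//.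
    exact: le_trans zC.
  have hh : h * h <= eta * h by rewrite ler_wpM2r// ltW.
  have z3 : (beta * h * C) ^+ 2 <= beta ^+ 2 * C ^+ 2 * (eta * h).
    have -> : (beta * h * C) ^+ 2 = beta ^+ 2 * C ^+ 2 * (h * h) by ring.
    by rewrite ler_wpM2l// mulr_ge0// sqr_ge0.
  have -> : 2 * beta ^+ 2 * C ^+ 3 * (eta * h) = 2 * (beta ^+ 2 * C ^+ 2 * (eta * h)) * C by ring.
  by rewrite ler_wpM2r// ler_wpM2l// (le_trans z2).
have E2 : `|z * (fu - f0)| <= beta * C * (eta * h).
  rewrite normrM (_ : beta * C * (eta * h) = (beta * h * C) * eta); last by ring.
  exact: ler_pM.
have E4 : eta * (\sum_i `|v i|) ^+ 2 <=
    d%:R * (d%:R * (8 * C ^+ 2) + 2 * sigma ^+ 2) * (eta * (h + \sum_i D i ^+ 2)).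
  have vi i : `|v i| ^+ 2 <= 8 * C ^+ 2 * h + 2 * sigma ^+ 2 * D i ^+ 2.
    pose r := v i + sigma * D i.
    have rC : r ^+ 2 <= (2 * C * h) ^+ 2.
      rewrite -[r ^+ 2]real_normK ?num_real// lerXn2r ?nnegrE// ?mulr_ge0 ?(ltW h_gt0)//.
      exact: rhoC.
    have hh : h * h <= h by rewrite ler_piMr// ?(ltW h_gt0)// (le_trans h_eta).
    have r2 : (2 * C * h) ^+ 2 <= 4 * C ^+ 2 * h.
      have -> : (2 * C * h) ^+ 2 = 4 * C ^+ 2 * (h * h) by ring.
      by rewrite ler_wpM2l// mulr_ge0// sqr_ge0.
    rewrite real_normK ?num_real// (_ : v i = r - sigma * D i); last by rewrite /r; ring.
    have h5 := sqr_ge0 (r + sigma * D i).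
    have -> : (r - sigma * D i) ^+ 2 =
      2 * r ^+ 2 + 2 * sigma ^+ 2 * D i ^+ 2 - (r + sigma * D i) ^+ 2 by ring.
    lra.
  have S0 : 0 <= \sum_i D i ^+ 2 by apply: sumr_ge0 => i _; exact: sqr_ge0.
  apply: (@le_trans _ _ (eta * (d%:R * (d%:R * (8 * C ^+ 2 * h) + 2 * sigma ^+ 2 * \sum_i D i ^+ 2)))).
    rewrite ler_wpM2l ?(ltW eta0)//; apply: (le_trans (sqr_sum_le _)); rewrite card_ord ler_wpM2l//.
    apply: (@le_trans _ _ (\sum_(i < d) (8 * C ^+ 2 * h + 2 * sigma ^+ 2 * D i ^+ 2))).
      exact: ler_sum.
    by rewrite big_split/= sumr_const card_ord -mulr_sumr -[_ *+ d]mulr_natl.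
  set S := \sum_i D i ^+ 2 in S0 *.
  have -> : d%:R * (d%:R * (8 * C ^+ 2) + 2 * sigma ^+ 2) * (eta * (h + S)) =
    eta * (d%:R * (d%:R * (8 * C ^+ 2 * h) + 2 * sigma ^+ 2 * S)) +
    eta * (d%:R * (d%:R * (8 * C ^+ 2) * S + 2 * sigma ^+ 2 * h)) by ring.
  rewrite lerDl; have s2 := sqr_ge0 sigma; have c2 := sqr_ge0 C.
  apply: mulr_ge0; first exact: ltW.
  apply: mulr_ge0 => //; apply: addr_ge0; last by apply: mulr_ge0; [exact: mulr_ge0|exact: ltW].
  by apply: mulr_ge0 => //; apply: mulr_ge0 => //; exact: mulr_ge0.
have E5 : `|\sum_i f1 i * (v i + h * b i + sigma * D i)| <= d%:R * C * (eta * h).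
  apply: le_trans (ler_norm_sum _ _ _) _.
  have -> : d%:R * C * (eta * h) = \sum_(i < d) C * (eta * h).
    by rewrite sumr_const card_ord -[RHS]mulr_natl; ring.
  by apply: ler_sum => i _; rewrite normrM ler_pM.
set L := 4 * C ^+ 2 + 4 * sigma * C.
have E6 : `|\sum_i 2^-1 * f2 i i * (v i ^+ 2 - sigma ^+ 2 * D i ^+ 2)| <= d%:R * (C * L) * (eta * h).
  apply: le_trans (ler_norm_sum _ _ _) _.
  have -> : d%:R * (C * L) * (eta * h) = \sum_(i < d) C * (L * (eta * h)).
    by rewrite sumr_const card_ord -[RHS]mulr_natl; ring.
  apply: ler_sum => i _; rewrite normrM ler_pM//; last by rewrite !expr2; exact: prodC.
  rewrite normrM ger0_norm// (le_trans _ (f2C i i))// ler_piMl//; lra.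
have E7 : `|\sum_(i < d) \sum_(j < d | (j < i)%N)
    f2 i j * (v j * v i - sigma ^+ 2 * (D j * D i))| <= d%:R ^+ 2 * (C * L) * (eta * h).
  have L0 : 0 <= C * (L * (eta * h)).
    rewrite mulr_ge0// mulr_ge0// addr_ge0 ?mulr_ge0 ?sqr_ge0//.
  apply: le_trans (ler_norm_sum _ _ _) _.
  have -> : d%:R ^+ 2 * (C * L) * (eta * h) = \sum_(i < d) \sum_(j < d) C * (L * (eta * h)).
    by rewrite !sumr_const !card_ord -[RHS]mulr_natl -[X in _ = _ * X]mulr_natl; ring.
  apply: ler_sum => i _; apply: le_trans (ler_norm_sum _ _ _) _.
  apply: (@le_trans _ _ (\sum_(j < d | (j < i)%N) C * (L * (eta * h)))).
    by apply: ler_sum => j _; rewrite normrM ler_pM.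
  by rewrite [leRHS](bigID (fun j : 'I_d => (j < i)%N))/= lerDl sumr_ge0.
have Hs' := Hs; set e4 := fs - f0 - _ - _ - _ in Hs'.
(* An exact identity: [generator] cancels every term of order [h], and each of the seven summands
   left has been bounded above. *)
have key : expR z * fu - f0 - step_main =
   (expR z - 1 - z) * fu + z * (fu - f0) + (fu - fs + h * ft) + e4
   + \sum_i f1 i * (v i + h * b i + sigma * D i)
   + \sum_i 2^-1 * f2 i i * (v i ^+ 2 - sigma ^+ 2 * D i ^+ 2)
   + \sum_(i < d) \sum_(j < d | (j < i)%N) f2 i j * (v j * v i - sigma ^+ 2 * (D j * D i)).
  have -> : \sum_i f1 i * (v i + h * b i + sigma * D i) =
      \sum_i v i * f1 i + h * \sum_i b i * f1 i - \sum_i (- sigma * f1 i) * D i.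
    rewrite mulr_sumr -big_split/= -sumrB; apply: eq_bigr => i _; ring.
  have -> : \sum_i 2^-1 * f2 i i * (v i ^+ 2 - sigma ^+ 2 * D i ^+ 2) =
      \sum_i 2^-1 * f2 i i * v i ^+ 2 - h * (sigma ^+ 2 / 2) * \sum_i f2 i i
       - \sum_i (sigma ^+ 2 / 2 * f2 i i) * (D i ^+ 2 - h).
    rewrite mulr_sumr -!sumrB; apply: eq_bigr => i _; ring.
  have -> : \sum_(i < d) \sum_(j < d | (j < i)%N) f2 i j * (v j * v i - sigma ^+ 2 * (D j * D i)) =
      \sum_(i < d) \sum_(j < d | (j < i)%N) f2 i j * (v j * v i) -
      \sum_(i < d) \sum_(j < d | (j < i)%N) (sigma ^+ 2 * f2 i j) * (D j * D i).
    rewrite -sumrB; apply: eq_bigr => i _; rewrite -sumrB; apply: eq_bigr => j _; ring.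
  rewrite /e4 /step_main /z; move: generator.
  set S1 := \sum_i b i * f1 i; set S2 := \sum_i f2 i i => gen.
  have -> : S1 = beta * c * f0 - ft + sigma ^+ 2 / 2 * S2.
    have -> : S1 = beta * c * f0 - ft - (beta * c * f0 - ft - S1) by ring.
    by rewrite gen; ring.
  ring.
have S0 : 0 <= \sum_i D i ^+ 2 by apply: sumr_ge0 => i _; exact: sqr_ge0.
have N7 (a1 a2 a3 a4 a5 a6 a7 : R) : `|a1 + a2 + a3 + a4 + a5 + a6 + a7| <=
    `|a1| + `|a2| + `|a3| + `|a4| + `|a5| + `|a6| + `|a7|.
  by do 6!(apply: (le_trans (ler_normD _ _)); rewrite lerD2r).
rewrite key; apply: (le_trans (N7 _ _ _ _ _ _ _)).
have E4' := le_trans Hs' E4.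
have eS0 : 0 <= eta * \sum_i D i ^+ 2 by rewrite mulr_ge0// ltW.
(* The total weight of the six bounds in [eta * h] alone; adding [k * eta] times the sum of squares
   brings them to the common form [h + \sum_i D i ^+ 2]. *)
pose k := 2 * beta ^+ 2 * C ^+ 3 + beta * C + 1 + d%:R * C
  + (d%:R + d%:R ^+ 2) * (C * L).
have k0 : 0 <= k.
  rewrite /k /L; do !apply: addr_ge0 => //; rewrite ?mulr_ge0 ?addr_ge0 ?mulr_ge0 ?exprn_ge0//.
have kS := mulr_ge0 k0 eS0.
have -> : step_constant * eta * (h + \sum_i D i ^+ 2) =
  (2 * beta ^+ 2 * C ^+ 3 * (eta * h) + beta * C * (eta * h) + eta * h +
   d%:R * (d%:R * (8 * C ^+ 2) + 2 * sigma ^+ 2) * (eta * (h + \sum_i D i ^+ 2)) +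
   d%:R * C * (eta * h) + d%:R * (C * L) * (eta * h) + d%:R ^+ 2 * (C * L) * (eta * h))
  + k * (eta * \sum_i D i ^+ 2) by rewrite /step_constant /k /L; ring.
rewrite -[X in X <= _]addr0; apply: lerD => //.
by do !(apply: lerD => //).
Qed.

End one_step_estimate.

(** * The backward equation *)

Section time_box.
Context {R : realType} {d : nat}.
Implicit Types (F : R * 'rV[R]_d -> R) (z : R * 'rV[R]_d).

Definition time_box (a t K : R) : set (R * 'rV[R]_d) :=
  [set z : R * 'rV[R]_d | a <= z.1 <= t /\ forall i, `|z.2 0 i| <= K].

Lemma time_box_compact a t K : compact (time_box a t K).
Proof.
have -> : time_box a t K =
    `[a, t]%classic `*` [set v : 'rV[R]_d | forall i, `[- K, K]%classic (v ord0 i)].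
  apply/seteqP; split=> z [] /=.
    by rewrite in_itv/= => -> h; split => // i; rewrite in_itv/= -ler_norml.
  by rewrite in_itv/= => h1 h; split => // i; have := h i; rewrite in_itv/= -ler_norml.
apply: compact_setX; first exact: segment_compact.
apply: (@rV_compact R d (fun=> `[- K, K]%classic)) => i; exact: segment_compact.
Qed.

(** [F] is continuous in the full space at the points of [A], so [z'] is not asked to lie in [A]:
    the intermediate points of the expansions only have to be close to the path. *)
Lemma compact_uniformly_continuous (A : set (R * 'rV[R]_d)) F : compact A ->
  (forall z, A z -> {for z, continuous F}) -> forall e, 0 < e ->
  exists2 dlt : R, 0 < dlt & forall z z', A z -> `|z.1 - z'.1| < dlt ->
    (forall i, `|z.2 0 i - z'.2 0 i| < dlt) -> `|F z - F z'| <= e.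
Proof.
move=> cA cF e e0.
have e20 : 0 < e / 2 by rewrite divr_gt0.
pose P (dlt : R) z := forall z', `|z.1 - z'.1| < dlt ->
    (forall i, `|z.2 0 i - z'.2 0 i| < dlt) -> `|F z - F z'| <= e.
have cov : \forall dlt \near (0 : R)^'+, A `<=` P dlt.
  move/compact_near_coveringP : cA; apply => z Az.
  have := cF z Az; move/cvgrPdist_le => /(_ _ e20) /nbhs_ballP[r /= r0 hr].
  have r20 : 0 < r / 2 by rewrite divr_gt0.
  exists (ball z (r / 2), [set x | 0 < x < r / 2]) => /=.
    split; first exact: nbhsx_ballx.
    near=> x; rewrite /= ; apply/andP; split; near: x.
      exact: nbhs_right_gt.
    exact: nbhs_right_lt.
  move=> [x dlt] /= [[zx1 zx2] /andP[dlt0 dltr]] z' h1 h2.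
  rewrite [e]splitr; have -> : F x - F z' = (F z - F z') - (F z - F x) by ring.
  apply: (le_trans (ler_normB _ _)); apply: lerD.
    apply: hr; split => /=.
      rewrite /ball/= (splitr r); have -> : z.1 - z'.1 = (z.1 - x.1) + (x.1 - z'.1) by ring.
      by apply: (le_lt_trans (ler_normD _ _)); rewrite ltrD// (lt_trans h1).
    case: zx2 => _ zx2.
    split => // i j; rewrite (ord1 i).
    have zxj := zx2 0 j.
    rewrite /ball/= (splitr r).
    have -> : z.2 0 j - z'.2 0 j = (z.2 0 j - x.2 0 j) + (x.2 0 j - z'.2 0 j) by ring.
    by apply: (le_lt_trans (ler_normD _ _)); rewrite ltrD// (lt_trans (h2 j)).
  apply: hr; split => /=; first by apply: lt_trans zx1 _; lra.
  case: zx2 => _ zx2; split => // i j; apply: lt_trans (zx2 i j) _; lra.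
near (0 : R)^'+ => dlt.
have AP : A `<=` P dlt by near: dlt.
exists dlt; first by near: dlt; exact: nbhs_right_gt.
by move=> z z' Az; exact: AP.
Unshelve. all: by end_near. Qed.

Lemma time_box_bounded (a t K : R) F :
  (forall z, time_box a t K z -> {for z, continuous F}) ->
  exists2 C : R, 0 < C & forall z, time_box a t K z -> `|F z| <= C.
Proof.
move=> cF.
have cFK : compact (F @` time_box a t K).
  apply: continuous_compact; last exact: time_box_compact.
  by apply: continuous_in_subspaceT => z; rewrite inE; exact: cF.
have [M [_ hM]] := compact_bounded cFK.
exists (`|M| + 1); first by rewrite ltr_wpDl.
move=> z Az; apply: hM; last by exists z.
by rewrite (le_lt_trans (ler_norm M))// ltrDl.
Qed.

(** Times after [t0] form an open set, on which continuity within the domain is continuity in the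
    full space. *)
Lemma jointly_continuous_at (I : set R) (g : R -> 'rV[R]_d -> R) (t0 : R) :
  (forall s, t0 < s -> I s) -> jointly_continuous I g ->
  forall z : R * 'rV[R]_d, t0 < z.1 ->
    {for z, continuous (fun z : R * 'rV[R]_d => g z.1 z.2)}.
Proof.
move=> t0I cg z t0z.
pose O : set (R * 'rV[R]_d) := fst @^-1` `]t0, +oo[%classic.
have oO : open O.
  by apply: open_comp => [y _|]; [exact: cvg_fst|exact: interval_open].
have : {within O, continuous (fun z : R * 'rV[R]_d => g z.1 z.2)}.
  apply: continuous_subspaceW cg => y; rewrite /O/= in_itv/= andbT; exact: t0I.
rewrite continuous_open_subspace// => /(_ z); apply.
by rewrite inE /O/= in_itv/= andbT.
Qed.

End time_box.

Section backward_equation.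
Context {R : realType} {d : nat}.
Variable t0 : R.
Implicit Types (g : R -> 'rV[R]_d -> R).

Definition continuous_after g : Prop := forall z : R * 'rV[R]_d, t0 < z.1 ->
  {for z, continuous (fun z : R * 'rV[R]_d => g z.1 z.2)}.

Lemma continuous_afterM g1 g2 : continuous_after g1 -> continuous_after g2 ->
  continuous_after (fun s x => g1 s x * g2 s x).
Proof. by move=> c1 c2 z tz; apply: cvgM; [exact: c1|exact: c2]. Qed.

Lemma continuous_afterD g1 g2 : continuous_after g1 -> continuous_after g2 ->
  continuous_after (fun s x => g1 s x + g2 s x).
Proof. by move=> c1 c2 z tz; apply: cvgD; [exact: c1|exact: c2]. Qed.

Lemma continuous_afterZ k g : continuous_after g ->
  continuous_after (fun s x => k * g s x).
Proof. by move=> cg z tz; apply: cvgMr; exact: cg. Qed.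

Lemma continuous_after_expR g : continuous_after g ->
  continuous_after (fun s x => expR (g s x)).
Proof.
move=> cg z tz; apply: (@cvg_comp _ _ _ (fun z : R * 'rV[R]_d => g z.1 z.2) expR).
  exact: cg.
exact: continuous_expR.
Qed.

(** The interface between the Fokker-Planck equation and the expansion: everything used about [f]
    and the coefficients, at times after [t0] only, with the derivatives named as functions. *)
Record backward_equation (beta sigma : R) (f : R -> 'rV[R]_d -> R)
    (f1 : 'I_d -> R -> 'rV[R]_d -> R) (f2 : 'I_d -> 'I_d -> R -> 'rV[R]_d -> R)
    (ft c : R -> 'rV[R]_d -> R) (b : 'I_d -> R -> 'rV[R]_d -> R) : Prop := {
  beq_f : continuous_after f ;
  beq_f1 : forall i, continuous_after (f1 i) ;
  beq_f2 : forall i j, continuous_after (f2 i j) ;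
  beq_ft : continuous_after ft ;
  beq_c : continuous_after c ;
  beq_b : forall i, continuous_after (b i) ;
  beq_D1 : forall s x i, t0 < s -> is_derive x (delta_mx 0 i) (f s) (f1 i s x) ;
  beq_D2 : forall s x i j, t0 < s ->
    is_derive x (delta_mx 0 j) (f1 i s) (f2 i j s x) ;
  beq_Dt : forall s x, t0 < s -> is_derive s (1 : R) (f^~ x) (ft s x) ;
  beq_generator : forall s x, t0 < s ->
    beta * c s x * f s x - ft s x - \sum_i b i s x * f1 i s x =
    - (sigma ^+ 2 / 2) * \sum_i f2 i i s x }.

Variables (mu beta : R) (U p : R -> 'rV[R]_d -> R).
Hypotheses (mu_gt0 : 0 < mu) (beta_gt0 : 0 < beta)
  (hU : regular_potential t0 U) (hp : Fokker_Planck_solution mu beta t0 U p).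

Definition weighted s x : R := expR (beta * U s x) * p s x.

(* The substitution [p = exp (- beta U) f] turns the Fokker-Planck equation into
   the backward equation of the diffusion with the zero-order term
   [beta (d_s U) f]. *)
Lemma weighted_backward_equation (dU : R -> 'rV[R]_d -> R) :
  jointly_continuous `[t0, +oo[ dU ->
  (forall s x, t0 < s -> is_derive s (1 : R) (U^~ x) (dU s x)) ->
  exists f1 f2 ft, backward_equation beta (Num.sqrt (2 * mu / beta)) weighted
    f1 f2 ft dU (fun i s x => mu * partial i (U s) x).
Proof.
move=> cdU DU.
have [cU [dU1 dU2 cU1 cU2] _] := hU.
have [cp [dp_t cpt] [dp1 dp2 cp1 cp2] FP] := hp.
have Iint s : t0 < s -> `[t0, +oo[%classic s by rewrite /= in_itv/= andbT; exact: ltW.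
have Iopen s : t0 < s -> `]t0, +oo[%classic s by rewrite /= in_itv/= andbT.
pose U1 i s x := partial i (U s) x.
pose U2 i j s x := partial j (partial i (U s)) x.
pose p1 i s x := partial i (p s) x.
pose p2 i j s x := partial j (partial i (p s)) x.
pose pt s x := time_deriv p s x.
pose e s x := expR (beta * U s x).
have cc I g : (forall s, t0 < s -> I s) -> jointly_continuous I g -> continuous_after g.
  by move=> h cg; exact: jointly_continuous_at h cg.
have {}cU : continuous_after U by exact: cc cU.
have {}cp : continuous_after p by exact: cc cp.
have {}cpt : continuous_after pt by exact: cc cpt.
have {}cU1 i : continuous_after (U1 i) by exact: cc (cU1 i).
have {}cU2 i j : continuous_after (U2 i j) by exact: cc (cU2 i j).
have {}cp1 i : continuous_after (p1 i) by exact: cc (cp1 i).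
have {}cp2 i j : continuous_after (p2 i j) by exact: cc (cp2 i j).
have {}cdU : continuous_after dU by exact: cc cdU.
have ce : continuous_after e by apply/continuous_after_expR/continuous_afterZ.
have DU1 s x i : t0 < s -> is_derive x (delta_mx 0 i) (U s) (U1 i s x).
  by move=> ts; apply: derivableP; apply: dU1; exact: Iint.
have DU2 s x i j : t0 < s -> is_derive x (delta_mx 0 j) (U1 i s) (U2 i j s x).
  by move=> ts; apply: derivableP; apply: dU2; exact: Iint.
have Dp1 s x i : t0 < s -> is_derive x (delta_mx 0 i) (p s) (p1 i s x).
  by move=> ts; apply: derivableP; apply: dp1; exact: Iopen.
have Dp2 s x i j : t0 < s -> is_derive x (delta_mx 0 j) (p1 i s) (p2 i j s x).
  by move=> ts; apply: derivableP; apply: dp2; exact: Iopen.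
have Dpt s x : t0 < s -> is_derive s (1 : R) (p^~ x) (pt s x).
  by move=> ts; rewrite /pt /time_deriv derive1E; apply: derivableP; apply: dp_t; exact: Iopen.
have De s x i : t0 < s -> is_derive x (delta_mx 0 i) (e s) (e s x * (beta * U1 i s x)).
  by move=> ts; apply: is_derive_expR_comp; apply: is_derive_scaler; exact: DU1.
exists (fun i s x => e s x * (p1 i s x + beta * (U1 i s x * p s x))).
exists (fun i j s x =>
  e s x * (p2 i j s x + beta * (U1 i s x * p1 j s x + p s x * U2 i j s x)) +
  (p1 i s x + beta * (U1 i s x * p s x)) * (e s x * (beta * U1 j s x))).
exists (fun s x => e s x * pt s x + p s x * (e s x * (beta * dU s x))).
have cg i := continuous_afterD (cp1 i) (continuous_afterZ (k := beta) (continuous_afterM (cU1 i) cp)).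
have cf1 i := continuous_afterM ce (cg i).
split.
- exact: continuous_afterM ce cp.
- by move=> i; exact: cf1.
- move=> i j; apply: (continuous_afterD (continuous_afterM ce (continuous_afterD (cp2 i j)
    (continuous_afterZ (k := beta) (continuous_afterD (continuous_afterM (cU1 i) (cp1 j))
      (continuous_afterM cp (cU2 i j))))))).
  exact: continuous_afterM (cg i) (continuous_afterM ce (continuous_afterZ (k := beta) (cU1 j))).
- exact: (continuous_afterD (continuous_afterM ce cpt) (continuous_afterM cp
    (continuous_afterM ce (continuous_afterZ (k := beta) cdU)))).
- by [].
- by move=> i; exact: continuous_afterZ (cU1 i).
- move=> s x i ts; apply: (is_derive_eq (is_derive_mulr (De s x i ts) (Dp1 s x i ts))); ring.
- move=> s x i j ts; exact: (is_derive_mulr (De s x j ts) (is_derive_addr (Dp2 s x i j ts)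
    (is_derive_scaler beta (is_derive_mulr (DU2 s x i j ts) (Dp1 s x j ts))))).
- move=> s x ts; exact: (is_derive_mulr
    (is_derive_expR_comp (is_derive_scaler beta (DU s x ts))) (Dpt s x ts)).
- move=> s x ts; have := FP s x ts.
  have -> : divergence (fun y => p s y *: grad (U s) y) x =
      \sum_i (p s x * U2 i i s x + U1 i s x * p1 i s x).
    apply: eq_bigr => i _; rewrite /partial.
    have D := is_derive_mulr (Dp1 s x i ts) (DU2 s x i i ts).
    have <- := @derive_val _ _ _ _ _ _ _ D.
    by congr ('D_ _ _ _); apply/funext => y; rewrite !mxE.
  have -> : laplacian (p s) x = \sum_i p2 i i s x.
    apply: eq_bigr => i _; rewrite /p2 /partial; congr ('D_ _ _ _).
    by apply/funext => y; rewrite !mxE.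
  rewrite -/(pt s x) sqr_sqrtr; last by rewrite divr_ge0 ?mulr_ge0 ?ltW.
  move=> fp.
  have -> : pt s x = mu * (\sum_i (p s x * U2 i i s x + U1 i s x * p1 i s x)) +
    mu / beta * \sum_i p2 i i s x by lra.
  rewrite /weighted -/(e s x).
  have -> : \sum_i (mu * partial i (U s) x) * (e s x * (p1 i s x + beta * (U1 i s x * p s x))) =
     e s x * mu * \sum_i U1 i s x * (p1 i s x + beta * (U1 i s x * p s x)).
    by rewrite mulr_sumr; apply: eq_bigr => i _; rewrite /U1; ring.
  set A := e s x * (mu * _ + mu / beta * _).
  (* The zero-order term cancels the time derivative of the weight. *)
  have -> : beta * dU s x * (e s x * p s x) - (A + p s x * (e s x * (beta * dU s x))) -
     e s x * mu * \sum_i U1 i s x * (p1 i s x + beta * (U1 i s x * p s x)) =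
    - (A + e s x * mu * \sum_i U1 i s x * (p1 i s x + beta * (U1 i s x * p s x))) by ring.
  rewrite mulNr; congr (- _).
  (* Since [sigma ^+ 2 / 2 = mu / beta], what remains is an identity for each coordinate
     separately. *)
  rewrite /A mulrDr !mulrA !mulr_sumr -!big_split/=; apply: eq_bigr => i _.
  by field; rewrite gt_eqF.
Qed.

End backward_equation.

(** * Expansion along a path *)

Section segment_functions.
Context {R : realType}.
Implicit Types (g : R -> R) (a t s u e : R).
Local Notation mu := (@lebesgue_measure R).

Lemma segment_uniformly_continuous a t g : {within `[a, t], continuous g} ->
  forall e, 0 < e -> exists2 dlt : R, 0 < dlt &
    forall s u, a <= s <= t -> a <= u <= t -> `|s - u| < dlt -> `|g s - g u| <= e.
Proof.
move=> /subspace_continuousP cg e e0.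
have e20 : 0 < e / 2 by rewrite divr_gt0.
pose A : set R := `[a, t]%classic.
have AE s : A s = (a <= s <= t) by rewrite /A/= in_itv.
pose P (dlt : R) (s : R) := A s -> forall u, A u -> `|s - u| < dlt -> `|g s - g u| <= e.
have cov : \forall dlt \near (0 : R)^'+, A `<=` P dlt.
  have := @segment_compact R a t; move/compact_near_coveringP; apply => z Az.
  have := cg z Az; move/cvgrPdist_le => /(_ _ e20) /nbhs_ballP[r /= r0 hr].
  have r20 : 0 < r / 2 by rewrite divr_gt0.
  exists (ball z (r / 2), [set x | 0 < x < r / 2]) => /=.
    split; first exact: nbhsx_ballx.
    near=> x; rewrite /= ; apply/andP; split; near: x.
      exact: nbhs_right_gt.
    exact: nbhs_right_lt.
  move=> [x dlt] /= [zx /andP[dlt0 dltr]] Ax u Au h1.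
  rewrite /ball/= in zx.
  rewrite [e]splitr; have -> : g x - g u = (g z - g u) - (g z - g x) by ring.
  apply: (le_trans (ler_normB _ _)); apply: lerD; apply: hr => //.
    rewrite /ball/= (splitr r); have -> : z - u = (z - x) + (x - u) by ring.
    by apply: (le_lt_trans (ler_normD _ _)); rewrite ltrD// (lt_trans h1).
  by rewrite /ball/=; apply: lt_trans zx _; rewrite ltr_pdivrMr// mulr_natr mulr2n ltrDl.
near (0 : R)^'+ => dlt.
have AP : A `<=` P dlt by near: dlt.
exists dlt; first by near: dlt; exact: nbhs_right_gt.
by move=> s u hs hu; apply: AP; rewrite ?AE.
Unshelve. all: by end_near. Qed.

Lemma segment_integrable a t g : {within `[a, t], continuous g} ->
  mu.-integrable `[a, t] (EFin \o g).
Proof. by move=> cg; apply: continuous_compact_integrable => //; exact: segment_compact. Qed.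

Lemma segment_subspace a t s u g : a <= u -> s <= t ->
  {within `[a, t], continuous g} -> {within `[u, s], continuous g}.
Proof.
move=> au st; apply: continuous_subspaceW => r /=; rewrite !in_itv/= => /andP[ur rs].
by rewrite (le_trans au ur) (le_trans rs st).
Qed.

Lemma Rintegral_segmentD a t s g : a <= s <= t -> {within `[a, t], continuous g} ->
  \int[mu]_(r in `[a, t]) g r =
  \int[mu]_(r in `[a, s]) g r + \int[mu]_(r in `[s, t]) g r.
Proof.
move=> /andP[as_ st] cg; have ig := segment_integrable cg.
have := @Rintegral_itvB _ g (BLeft a) (BRight t) s ig.
rewrite !bnd_simp => /(_ as_ st).
rewrite Rintegral_itv_obnd_cbnd.
  by move=> <-; ring.
apply: integrableS (segment_integrable (segment_subspace as_ (lexx t) cg)) => //.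
exact: subset_itv_oc_cc.
Qed.

Lemma Rintegral_segment_approx u s g v e : u <= s ->
  {within `[u, s], continuous g} ->
  (forall r, u <= r <= s -> `|g r - v| <= e) ->
  `|\int[mu]_(r in `[u, s]) g r - v * (s - u)| <= e * (s - u).
Proof.
move=> us cg ge; have ig := segment_integrable cg.
have lE : fine (mu `[u, s]%classic) = s - u.
  rewrite lebesgue_measure_itv/= lte_fin; have [//|su] := ltP u s.
  by rewrite /=; apply/esym/eqP; rewrite subr_eq0 eq_le us su.
have ic c : mu.-integrable `[u, s] (EFin \o (fun=> c)).
  by apply: segment_integrable; apply: continuous_subspaceT => x; exact: cvg_cst.
have cE c : \int[mu]_(r in `[u, s]) c = c * (s - u) by rewrite Rintegral_cst// lE.
rewrite -(cE v) -(RintegralB _ ig (ic v))//.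
have igv : mu.-integrable `[u, s] (EFin \o (fun r => g r - v)).
  by apply: (@integrableB _ _ _ mu _ _ (EFin \o g) (EFin \o (fun=> v))) => //; exact: ic.
apply: (le_trans (le_normr_Rintegral _ igv)) => //.
rewrite -(cE e); apply: le_Rintegral => //.
exact: (integrable_norm igv).
Qed.

Lemma expR_lipschitz (x y B : R) : x <= B -> y <= B ->
  `|expR x - expR y| <= expR B * `|x - y|.
Proof.
wlog yx : x y / y <= x => [h|xB yB].
  by move=> xB yB; have [/h|/ltW/h] := leP y x; [apply|rewrite distrC (distrC x); apply].
rewrite !ger0_norm ?subr_ge0 ?ler_expR//.
apply: (@le_trans _ _ (expR x * (x - y))); last by rewrite ler_wpM2r ?subr_ge0// ler_expR.
have h := expR_ge1Dx (y - x).
have -> : expR y = expR x * expR (y - x) by rewrite -expRD addrC subrK.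
have h0 := expR_gt0 x; nra.
Qed.

End segment_functions.

Section path_expansion.
Context {R : realType} {d : nat}.
Local Notation mu := (@lebesgue_measure R).
Variables (t0 a t beta sigma : R) (f : R -> 'rV[R]_d -> R)
  (f1 : 'I_d -> R -> 'rV[R]_d -> R) (f2 : 'I_d -> 'I_d -> R -> 'rV[R]_d -> R)
  (ft c : R -> 'rV[R]_d -> R) (b : 'I_d -> R -> 'rV[R]_d -> R).
Hypotheses (beq : backward_equation t0 beta sigma f f1 f2 ft c b)
  (t0a : t0 < a) (at_ : a < t) (beta_ge0 : 0 <= beta) (sigma_ge0 : 0 <= sigma).
Variables (x w : R -> 'rV[R]_d).
Hypotheses (cx : {within `[a, t], continuous x})
  (cw : {within `[a, t], continuous w})
  (xE : forall u s i, a <= u -> u <= s -> s <= t ->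
    x u 0 i - x s 0 i =
    - (\int[mu]_(r in `[u, s]) b i r (x r)) - sigma * (w s 0 i - w u 0 i)).

Lemma coordinate_path_continuous (y : R -> 'rV[R]_d) i :
  {within `[a, t], continuous y} ->
  {within `[a, t], continuous (fun r => y r 0 i)}.
Proof.
move=> cy r; apply: (@continuous_comp _ _ _ (y : subspace _ -> 'rV[R]_d)
  (fun v : 'rV[R]_d => v 0 i)); first exact: cy.
exact: coord_continuous.
Qed.

Lemma along_path_continuous g : continuous_after t0 g ->
  {within `[a, t], continuous (fun r => g r (x r))}.
Proof.
move=> cg; apply/subspace_continuousP => s As.
have /subspace_continuousP/(_ s As) cxs := cx.
have t0s : t0 < s.
  by move: As => /=; rewrite in_itv/= => /andP[as_ _]; exact: lt_le_trans as_.
apply: (@cvg_comp _ _ _ (fun r => (r, x r)) (fun z : R * 'rV[R]_d => g z.1 z.2)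
  _ (nbhs (s, x s))); last exact: (cg (s, x s)).
exact: (@cvg_pair _ _ _ _ (nbhs s) (nbhs (x s)) _ _ _ id x (cvg_within _) cxs).
Qed.

Lemma near_oscillation (g : R -> R) e : {within `[a, t], continuous g} -> 0 < e ->
  \forall h \near (0 : R)^'+, forall s u, a <= u -> u <= s -> s <= t -> s - u <= h ->
    `|g s - g u| <= e.
Proof.
move=> cg e0; have [dlt dlt0 hd] := segment_uniformly_continuous cg e0.
near=> h => s u au us st suh; apply: hd; rewrite ?au ?st ?(le_trans us)//.
- by rewrite (le_trans au).
- rewrite ger0_norm ?subr_ge0//; apply: (le_lt_trans suh).
  by near: h; exact: nbhs_right_lt.
Unshelve. all: by end_near. Qed.

Lemma path_bounded : exists K : R, forall r i, a <= r <= t -> `|x r 0 i| <= K.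
Proof.
have hi i : exists K : R, 0 <= K /\ forall r, a <= r <= t -> `|x r 0 i| <= K.
  have ck : compact ((fun r => x r 0 i) @` `[a, t]%classic).
    apply: continuous_compact; last exact: segment_compact.
    exact: coordinate_path_continuous.
  have [M [_ hM]] := compact_bounded ck.
  exists (`|M| + 1); split; first by rewrite addr_ge0.
  move=> r art; apply: hM; first by rewrite (le_lt_trans (ler_norm M))// ltrDl.
  by exists r => //=; rewrite in_itv.
have [K hK] := choice hi.
exists (\sum_i K i) => r i art; have [_ h] := hK i.
apply: (le_trans (h r art)); rewrite (bigD1 i)//= lerDl; apply: sumr_ge0 => j _.
by have [] := hK j.
Qed.

Definition step_remainder (h s : R) : R :=
  expR (beta * h * c s (x s)) * f (s - h) (x (s - h)) - f s (x s) -
  step_main sigma h (fun i => f1 i s (x s)) (fun i => w s 0 i - w (s - h) 0 i)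
    (fun i j => f2 i j s (x s)).

Lemma near_uniform g (K e : R) : continuous_after t0 g -> 0 < e ->
  \forall dlt \near (0 : R)^'+, forall z z' : R * 'rV[R]_d,
    a <= z.1 <= t -> (forall i, `|z.2 0 i| <= K) -> `|z.1 - z'.1| < dlt ->
    (forall i, `|z.2 0 i - z'.2 0 i| < dlt) -> `|g z.1 z.2 - g z'.1 z'.2| <= e.
Proof.
move=> cg e0.
have cg' z : time_box a t K z ->
    {for z, continuous (fun z : R * 'rV[R]_d => g z.1 z.2)}.
  by move=> [/andP[az _] _]; apply: cg; exact: lt_le_trans az.
have [dlt dlt0 hd] := compact_uniformly_continuous (@time_box_compact R d a t K) cg' e0.
near=> r => z z' az zK h1 h2.
have rd : r < dlt by near: r; exact: nbhs_right_lt.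
by apply: hd => // [|i]; apply: lt_trans rd.
Unshelve. all: by end_near. Qed.

(** Continuity on the compact time box. The bound holds on the whole box and not just along one
    path, so it serves both the pathwise remainder, with the path's own [K], and the transform, with
    a [K] common to all paths. *)
Lemma coefficients_bounded (K : R) : exists2 C : R, 1 <= C &
  forall s (y : 'rV[R]_d), a <= s <= t -> (forall i, `|y 0 i| <= K) ->
  [/\ `|f s y| <= C, `|c s y| <= C, forall i, `|b i s y| <= C,
      forall i, `|f1 i s y| <= C & forall i j, `|f2 i j s y| <= C].
Proof.
have bd g : continuous_after t0 g -> exists C : R, 0 <= C /\
    forall s (y : 'rV[R]_d), a <= s <= t -> (forall i, `|y 0 i| <= K) -> `|g s y| <= C.
  move=> cg; have [C C0 hC] := @time_box_bounded R d a t K (fun z => g z.1 z.2)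
    (fun z h => cg z (lt_le_trans t0a (proj1 (andP h.1)))).
  by exists C; split; [exact: ltW|move=> s y ast yK; apply: (hC (s, y))].
have [Cf [Cf0 hf]] := bd _ (beq_f beq).
have [Cc [Cc0 hc]] := bd _ (beq_c beq).
have cb i : continuous_after t0 (b i) by apply: (beq_b beq).
have c1 i : continuous_after t0 (f1 i) by apply: (beq_f1 beq).
have c2 (ij : 'I_d * 'I_d) : continuous_after t0 (f2 ij.1 ij.2) by apply: (beq_f2 beq).
have [Cb hb] := choice (fun i => bd _ (cb i)).
have [C1 h1] := choice (fun i => bd _ (c1 i)).
have [C2 h2] := choice (fun ij : 'I_d * 'I_d => bd _ (c2 ij)).
have pos (I : finType) (F : I -> R) (i : I) : (forall j, 0 <= F j) -> F i <= \sum_j F j.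
  by move=> F0; rewrite (bigD1 i)//= lerDl sumr_ge0.
have Sb0 : 0 <= \sum_i Cb i by apply: sumr_ge0 => i _; have [] := hb i.
have S10 : 0 <= \sum_i C1 i by apply: sumr_ge0 => i _; have [] := h1 i.
have S20 : 0 <= \sum_ij C2 ij by apply: sumr_ge0 => i _; have [] := h2 i.
exists (1 + Cf + Cc + \sum_i Cb i + \sum_i C1 i + \sum_ij C2 ij); first lra.
move=> s y ast yK; split.
- by have h := hf s y ast yK; lra.
- by have h := hc s y ast yK; lra.
- move=> i; have [_ /(_ s y ast yK) h] := hb i.
  by have h' := pos _ Cb i (fun j => (hb j).1); lra.
- move=> i; have [_ /(_ s y ast yK) h] := h1 i.
  by have h' := pos _ C1 i (fun j => (h1 j).1); lra.
- move=> i j; have [_ /(_ s y ast yK) h] := h2 (i, j).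
  by have h' := pos _ C2 (i, j) (fun j => (h2 j).1); lra.
Qed.

(** Uniform continuity of the path and of the coefficients provides, for small [h], all the
    hypotheses of [step_estimate] with the same [eta], uniformly in the position of the step. *)
Lemma near_step_remainder (C eta : R) : 1 <= C -> 0 < eta -> eta <= 1 ->
  beta * eta * C <= 2^-1 ->
  (forall s, a <= s <= t -> [/\ `|f s (x s)| <= C, `|c s (x s)| <= C,
    forall i, `|b i s (x s)| <= C, forall i, `|f1 i s (x s)| <= C &
    forall i j, `|f2 i j s (x s)| <= C]) ->
  \forall h \near (0 : R)^'+, forall s, a <= s - h -> s <= t ->
    `|step_remainder h s| <= step_constant (d := d) sigma beta C * eta *
      (h + \sum_i (w s 0 i - w (s - h) 0 i) ^+ 2).
Proof.
move=> C1 eta0 eta1 small bC.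
have cf2 (ij : 'I_d * 'I_d) : continuous_after t0 (f2 ij.1 ij.2) by apply: (beq_f2 beq).
have cb i : continuous_after t0 (b i) by apply: (beq_b beq).
have [K xK] := path_bounded.
(* One [dlt] for the time derivative and all second derivatives, which are evaluated off the path;
   [f] and the drift are compared along the path only. *)
have [dlt dlt0 [ut u2]] : exists2 dlt : R, 0 < dlt &
    (forall z z' : R * 'rV[R]_d,
      a <= z.1 <= t -> (forall i, `|z.2 0 i| <= K) -> `|z.1 - z'.1| < dlt ->
      (forall i, `|z.2 0 i - z'.2 0 i| < dlt) ->
      `|ft z.1 z.2 - ft z'.1 z'.2| <= eta) /\
    (forall ij : 'I_d * 'I_d, forall z z' : R * 'rV[R]_d,
      a <= z.1 <= t -> (forall i, `|z.2 0 i| <= K) -> `|z.1 - z'.1| < dlt ->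
      (forall i, `|z.2 0 i - z'.2 0 i| < dlt) ->
      `|f2 ij.1 ij.2 z.1 z.2 - f2 ij.1 ij.2 z'.1 z'.2| <= eta).
  have nt := near_uniform K (beq_ft beq) eta0.
  have n2 := filter_forall _ (fun ij : 'I_d * 'I_d =>
    near_uniform K (cf2 ij) eta0).
  near (0 : R)^'+ => dlt; exists dlt; first by near: dlt; exact: nbhs_right_gt.
  by split; near: dlt; [exact: nt|exact: n2].
have dlt20 : 0 < dlt / 2 by rewrite divr_gt0.
have nf := near_oscillation (along_path_continuous (beq_f beq)) eta0.
have nb := filter_forall _ (fun i =>
  near_oscillation (along_path_continuous (cb i)) eta0).
have nw := filter_forall _ (fun i =>
  near_oscillation (coordinate_path_continuous (i := i) cw) eta0).
have nx := filter_forall _ (fun i =>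
  near_oscillation (coordinate_path_continuous (i := i) cx) dlt20).
near=> h.
have h0 : 0 < h by near: h; exact: nbhs_right_gt.
have heta : h <= eta by near: h; exact: nbhs_right_le.
have hdlt : h < dlt by near: h; exact: nbhs_right_lt.
have of_ : forall s u, a <= u -> u <= s -> s <= t -> s - u <= h ->
  `|f s (x s) - f u (x u)| <= eta by near: h; exact: nf.
have ob : forall i s u, a <= u -> u <= s -> s <= t -> s - u <= h ->
  `|b i s (x s) - b i u (x u)| <= eta by near: h; exact: nb.
have ow : forall i s u, a <= u -> u <= s -> s <= t -> s - u <= h ->
  `|w s 0 i - w u 0 i| <= eta by near: h; exact: nw.
have ox : forall i s u, a <= u -> u <= s -> s <= t -> s - u <= h ->
  `|x s 0 i - x u 0 i| <= dlt / 2 by near: h; exact: nx.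
move=> s au st; set u := s - h in au *.
have us : u <= s by rewrite /u gerBl ltW.
have suh : s - u = h by rewrite /u; ring.
have as_ : a <= s by exact: le_trans us.
have t0s : t0 < s by exact: lt_le_trans as_.
have ast : a <= s <= t by rewrite as_.
have [fC cC bbC f1C f2C] := bC s ast.
have [fuC _ _ _ _] : [/\ `|f u (x u)| <= C, `|c u (x u)| <= C,
    forall i, `|b i u (x u)| <= C, forall i, `|f1 i u (x u)| <= C &
    forall i j, `|f2 i j u (x u)| <= C] by apply: bC; rewrite au (le_trans us).
have oxs i : `|x s 0 i - x u 0 i| < dlt.
  by apply: (@le_lt_trans _ _ (dlt / 2)); [apply: ox; rewrite ?suh|rewrite ltr_pdivrMr// mulr_natr mulr2n ltrDl].
apply: (@step_estimate _ _ _ _ C _ _ _ _ (f s (x u)) (ft s (x s)) _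
  (fun i => b i s (x s)) _ (fun i => x u 0 i - x s 0 i)) => //.
- by move=> i; apply: ow; rewrite ?suh.
- by rewrite distrC; apply: of_; rewrite ?suh.
- have us' : u < s by rewrite /u gtrBl.
  have Dt r : r \in `]u, s[ -> is_derive r (1 : R) (f^~ (x u)) (ft r (x u)).
    rewrite in_itv/= => /andP[ur rs]; apply: (beq_Dt beq).
    exact: lt_trans (lt_le_trans t0a au) ur.
  have Dc : {within `[u, s], continuous (f^~ (x u))}.
    apply: continuous_in_subspaceT => r; rewrite inE/= in_itv/= => /andP[ur rs].
    apply: differentiable_continuous; apply/derivable1_diffP.
    have [] // := beq_Dt beq (x u) (lt_le_trans (lt_le_trans t0a au) ur).
  have [xi] := MVT us' Dt Dc; rewrite in_itv/= => /andP[uxi xis] E.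
  have -> : f u (x u) - f s (x u) + h * ft s (x s) =
      (ft s (x s) - ft xi (x u)) * h.
    have -> : f u (x u) - f s (x u) = - (ft xi (x u) * (s - u)).
      by rewrite -E opprB.
    by rewrite suh; ring.
  rewrite normrM (gtr0_norm h0) ler_wpM2r// ?(ltW h0)//.
  apply: (ut (s, x s) (xi, x u)) => //=; first by move=> i; exact: xK.
  rewrite gtr0_norm ?subr_gt0//; apply: lt_trans hdlt; rewrite -suh.
  by rewrite ltrD2l ltrN2.
- apply: (@coordinate_Taylor2 R d (f s) (fun i => f1 i s) (fun i j => f2 i j s) (x s) (x u) eta).
  + by move=> z i; exact: (beq_D1 beq).
  + by move=> z i j; exact: (beq_D2 beq).
  + move=> z i j zb; rewrite distrC; apply: (u2 (i, j) (s, x s) (s, z)) => //=.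
    * by move=> k; exact: xK.
    * by rewrite subrr normr0.
    * move=> k; have [th /andP[th0 th1] ->] := zb k.
      have -> : x s 0 k - (x s 0 k + th * (x u 0 k - x s 0 k)) =
        th * (x s 0 k - x u 0 k) by ring.
      rewrite normrM ger0_norm//; apply: le_lt_trans (oxs k).
      by rewrite ler_piMl.
(* The noise cancels exactly, and the drift integral is [h] times the drift at the later end up to
   [eta * h]. *)
- move=> i; rewrite xE//.
  have cbx : {within `[u, s], continuous (fun r => b i r (x r))}.
    exact: segment_subspace au st (along_path_continuous (cb i)).
  have ge r : u <= r <= s -> `|b i r (x r) - b i s (x s)| <= eta.
    move=> /andP[ur rs]; rewrite distrC; apply: ob => //; first exact: le_trans ur.
    by rewrite -suh lerD2l lerN2.
  have := Rintegral_segment_approx us cbx ge; rewrite suh; apply: le_trans.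
  rewrite -normrN le_eqVlt; apply/orP; left; apply/eqP.
  by congr `|_|; rewrite -/u; ring.
- exact: (beq_generator beq).
Unshelve. all: by end_near. Qed.

Definition path_grid (h : R) (k : nat) : R := t - k%:R * h.

(* Replacing the time integral of [c] by a Riemann sum makes adaptedness immediate:
   no measurability of path integrals is needed. *)
Definition discount (h : R) (k : nat) : R :=
  expR (beta * \sum_(j < k) h * c (path_grid h j) (x (path_grid h j))).

Definition path_main (h : R) (k : nat) : R :=
  step_main sigma h (fun i => f1 i (path_grid h k) (x (path_grid h k)))
    (fun i => w (path_grid h k) 0 i - w (path_grid h k.+1) 0 i)
    (fun i j => f2 i j (path_grid h k) (x (path_grid h k))).

Definition Feynman_Kac (s : R) : R :=
  expR (beta * \int[mu]_(r in `[s, t]) c r (x r)) * f s (x s).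

Lemma path_gridS h k : path_grid h k.+1 = path_grid h k - h.
Proof. by rewrite /path_grid -natr1; ring. Qed.

Lemma path_grid_le h k : 0 < h -> path_grid h k <= t.
Proof. by move=> h0; rewrite /path_grid gerBl mulr_ge0// ltW. Qed.

Lemma path_grid_ge h k n : 0 < h -> (k <= n)%N -> path_grid h n <= path_grid h k.
Proof. by move=> h0 kn; rewrite /path_grid lerD2l lerN2 ler_pM2r// ler_nat. Qed.

Lemma discountS h k : discount h k.+1 =
  discount h k * expR (beta * h * c (path_grid h k) (x (path_grid h k))).
Proof. by rewrite /discount big_ord_recr/= -expRD; congr expR; ring. Qed.

(** The one-step factor inside [step_remainder] is the ratio of consecutive discounts, so the
    discounted values of [f] telescope. *)
Lemma discounted_telescope h n :
  discount h n * f (path_grid h n) (x (path_grid h n)) - f t (x t) -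
    \sum_(k < n) discount h k * path_main h k =
  \sum_(k < n) discount h k * step_remainder h (path_grid h k).
Proof.
elim: n => [|n ih].
  rewrite !big_ord0 /discount big_ord0 mulr0 expR0 mul1r.
  by rewrite /path_grid mul0r !subr0 subrr.
rewrite !big_ord_recr/= -ih discountS /step_remainder /path_main path_gridS; ring.
Qed.

Lemma Riemann_sum_approx g (h e : R) n : 0 < h -> a <= path_grid h n ->
  {within `[a, t], continuous g} ->
  (forall s u, a <= u -> u <= s -> s <= t -> s - u <= h -> `|g s - g u| <= e) ->
  `|\int[mu]_(r in `[path_grid h n, t]) g r - \sum_(k < n) h * g (path_grid h k)|
    <= e * (n%:R * h).
Proof.
move=> h0 + cg osc; elim: n => [|n ih] an.
  rewrite big_ord0 mul0r mulr0 subr0 /path_grid mul0r subr0.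
  have ctt : {within `[t, t], continuous g} by exact: segment_subspace (ltW at_) (lexx t) cg.
  have := @Rintegral_segment_approx _ t t g (g t) 0 (lexx t) ctt.
  rewrite subrr !mulr0 subr0; apply => r /andP[tr rt].
  by have -> : r = t by [apply/eqP; rewrite eq_le rt tr]; rewrite subrr normr0.
have us : path_grid h n.+1 <= path_grid h n by exact: path_grid_ge.
have st : path_grid h n <= t by exact: path_grid_le.
have an' : a <= path_grid h n by exact: le_trans us.
have step : `|\int[mu]_(r in `[path_grid h n.+1, path_grid h n]) g r -
    h * g (path_grid h n)| <= e * h.
  have suh : path_grid h n - path_grid h n.+1 = h by rewrite path_gridS; ring.
  have := @Rintegral_segment_approx _ _ _ g (g (path_grid h n)) e us
    (segment_subspace an st cg).
  rewrite suh [g _ * h]mulrC; apply => r /andP[ur rs].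
  rewrite distrC; apply: osc => //; first exact: le_trans ur.
  by rewrite -[leRHS]suh lerD2l lerN2.
rewrite big_ord_recr/=.
have H := @Rintegral_segmentD _ (path_grid h n.+1) t (path_grid h n) g.
rewrite H ?us//; last exact: segment_subspace an (lexx t) cg.
set I1 := Rintegral _ _ _ in step *; set I2 := Rintegral _ _ _ in ih *.
have -> : I1 + I2 - (\sum_(k < n) h * g (path_grid h k) + h * g (path_grid h n)) =
  (I2 - \sum_(k < n) h * g (path_grid h k)) + (I1 - h * g (path_grid h n)) by ring.
apply: (le_trans (ler_normD _ _)).
have -> : e * (n.+1%:R * h) = e * (n%:R * h) + e * h by rewrite -natr1; ring.
by rewrite lerD// ih.
Qed.

Lemma step_constant_ge0 (C : R) : 0 <= C -> 0 <= step_constant (d := d) sigma beta C.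
Proof.
move=> C0; rewrite /step_constant; do !apply: addr_ge0 => //;
  by rewrite ?mulr_ge0 ?addr_ge0 ?mulr_ge0 ?exprn_ge0 ?addr_ge0 ?mulr_ge0 ?exprn_ge0.
Qed.

(** Two errors are added: the discounted one-step remainders, and the Riemann sum in place of the
    integral in the exponent. The mesh is chosen before [n], because [n] is going to be the exit
    index of the path. *)
Lemma near_path_expansion e : 0 < e -> \forall h \near (0 : R)^'+, forall n,
  a <= path_grid h n ->
  `|Feynman_Kac (path_grid h n) - f t (x t) -
      \sum_(k < n) discount h k * path_main h k| <=
    e * (1 + \sum_(k < n) \sum_i (w (path_grid h k) 0 i - w (path_grid h k.+1) 0 i) ^+ 2).
Proof.
move=> e0; have [K xK] := path_bounded.
have [C C1 bC'] := coefficients_bounded K.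
have bC s : a <= s <= t -> [/\ `|f s (x s)| <= C, `|c s (x s)| <= C,
    forall i, `|b i s (x s)| <= C, forall i, `|f1 i s (x s)| <= C &
    forall i j, `|f2 i j s (x s)| <= C].
  by move=> ast; apply: bC' => // i; exact: xK.
have C0 : 0 <= C by exact: le_trans ler01 _.
pose A := expR (beta * (C * (t - a))).
have A0 : 0 < A by exact: expR_gt0.
pose k := step_constant (d := d) sigma beta C.
have k0 : 0 <= k by exact: step_constant_ge0.
have ta0 : 0 < t - a by rewrite subr_gt0.
(* [A * k] comes from the one-step remainders and [C * A * beta] from the Riemann sum; the factor
   [t - a + 1] absorbs [t - a + S] into [1 + S]. *)
pose B := (A * k + C * A * beta) * (t - a + 1).
have B0 : 0 <= B.
  by rewrite /B; move: (t - a) (ltW ta0) (ltW A0) => L L0 A0'; rewrite !(mulr_ge0, addr_ge0).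
have [eta eta0 [eta1 small etaB]] : exists2 eta : R, 0 < eta &
    [/\ eta <= 1, beta * eta * C <= 2^-1 & eta * B <= e].
  have bC1 : 0 < 2 * (beta * C + 1) by rewrite mulr_gt0// ltr_wpDl ?mulr_ge0.
  have B1 : 0 < B + 1 by rewrite ltr_wpDl.
  near (0 : R)^'+ => eta; exists eta; first by near: eta; exact: nbhs_right_gt.
  have eta0 : 0 < eta by near: eta; exact: nbhs_right_gt.
  split; first by near: eta; exact: nbhs_right_le.
  - have : eta <= (2 * (beta * C + 1))^-1 by near: eta; apply: nbhs_right_le; rewrite invr_gt0.
    rewrite -[_^-1]mul1r ler_pdivlMr// => h; have := mulr_ge0 beta_ge0 C0; nra.
  - have : eta <= e / (B + 1) by near: eta; apply: nbhs_right_le; rewrite divr_gt0.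
    by rewrite ler_pdivlMr// => h; nra.
have nc := near_oscillation (along_path_continuous (beq_c beq)) eta0.
have ns := near_step_remainder C1 eta0 eta1 small bC.
near=> h.
have h0 : 0 < h by near: h; exact: nbhs_right_gt.
have oc : forall s u, a <= u -> u <= s -> s <= t -> s - u <= h ->
  `|c s (x s) - c u (x u)| <= eta by near: h; exact: nc.
have os : forall s, a <= s - h -> s <= t -> `|step_remainder h s| <= k * eta *
      (h + \sum_i (w s 0 i - w (s - h) 0 i) ^+ 2) by near: h; exact: ns.
move=> n an.
have nh : n%:R * h <= t - a by move: an; rewrite /path_grid; lra.
have nt j : path_grid h j <= t by exact: path_grid_le.
have aj j : (j <= n)%N -> a <= path_grid h j <= t.
  by move=> jn; rewrite nt andbT (le_trans an)// path_grid_ge.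
have sumC m : (m <= n)%N ->
    \sum_(j < m) h * c (path_grid h j) (x (path_grid h j)) <= C * (t - a).
  move=> mn; apply: (@le_trans _ _ (\sum_(j < m) h * C)).
    apply: ler_sum => j _; rewrite ler_wpM2l ?(ltW h0)//.
    have jn : (j <= n)%N by rewrite (leq_trans (ltnW (ltn_ord j))).
    by have [_ hc _ _ _] := bC _ (aj j jn); exact: le_trans (ler_norm _) hc.
  rewrite sumr_const card_ord -mulr_natl.
  have -> : m%:R * (h * C) = C * (m%:R * h) by ring.
  by rewrite ler_wpM2l// (le_trans _ nh)// ler_wpM2r ?(ltW h0)// ler_nat.
have discA m : (m <= n)%N -> discount h m <= A.
  by move=> mn; rewrite ler_expR ler_wpM2l// sumC.
pose S := \sum_(k < n) \sum_i (w (path_grid h k) 0 i - w (path_grid h k.+1) 0 i) ^+ 2.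
have S0 : 0 <= S by do 2!apply: sumr_ge0 => ? _; exact: sqr_ge0.
have E1 : `|discount h n * f (path_grid h n) (x (path_grid h n)) - f t (x t) -
    \sum_(k < n) discount h k * path_main h k| <= A * k * eta * (t - a + S).
  rewrite discounted_telescope; apply: (le_trans (ler_norm_sum _ _ _)).
  apply: (@le_trans _ _ (\sum_(j < n) (A * k * eta * (h +
      \sum_i (w (path_grid h j) 0 i - w (path_grid h j.+1) 0 i) ^+ 2)))).
    apply: ler_sum => j _; rewrite normrM -!mulrA ler_pM//.
      by rewrite ger0_norm ?expR_ge0// discA// ltnW.
    rewrite mulrA path_gridS; apply: os => //.
    by rewrite -path_gridS; have /andP[] := aj _ (ltn_ord j).
  rewrite -mulr_sumr; apply: ler_wpM2l; first by rewrite !mulr_ge0// ltW.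
  by rewrite big_split/= lerD2r sumr_const card_ord -mulr_natl.
have E2 : `|Feynman_Kac (path_grid h n) -
    discount h n * f (path_grid h n) (x (path_grid h n))| <= C * A * beta * (eta * (t - a)).
  have an' : path_grid h n <= t by exact: nt.
  have cc := along_path_continuous (beq_c beq).
  rewrite /Feynman_Kac /discount -mulrBl normrM.
  have -> : C * A * beta * (eta * (t - a)) = A * (beta * (eta * (t - a))) * C by ring.
  have [fC _ _ _ _] := bC _ (aj n (leqnn n)).
  apply: ler_pM => //.
  have Ra := Riemann_sum_approx h0 an cc oc.
  set I1 := Rintegral _ _ _ in Ra *; set I2 := \sum_(k < n) _ in Ra *.
  have I1C : I1 <= C * (t - a).
    have := @Rintegral_segment_approx _ (path_grid h n) t (fun r => c r (x r)) 0 C an'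
      (segment_subspace an (lexx t) cc).
    rewrite mul0r subr0 => H; apply: (le_trans (ler_norm _)).
    apply: (@le_trans _ _ (C * (t - path_grid h n))).
      apply: H => r /andP[gr rt]; rewrite subr0.
      by have [] := bC r; rewrite ?rt ?(le_trans an).
    by rewrite ler_wpM2l// lerD2l lerN2.
  apply: (@le_trans _ _ (A * `|beta * I1 - beta * I2|)).
    by apply: expR_lipschitz; rewrite ler_wpM2l// sumC.
  rewrite ler_wpM2l ?(ltW A0)// -mulrBr normrM (ger0_norm beta_ge0) ler_wpM2l//.
  by apply: (le_trans Ra); rewrite ler_wpM2l// ltW.
rewrite -/S.
have -> : Feynman_Kac (path_grid h n) - f t (x t) - \sum_(k < n) discount h k * path_main h k =
  (Feynman_Kac (path_grid h n) - discount h n * f (path_grid h n) (x (path_grid h n))) +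
  (discount h n * f (path_grid h n) (x (path_grid h n)) - f t (x t) -
    \sum_(k < n) discount h k * path_main h k) by ring.
apply: (le_trans (ler_normD _ _)); apply: (le_trans (lerD E2 E1)).
apply: (@le_trans _ _ (eta * B * (1 + S))); last by rewrite ler_wpM2r// addr_ge0.
have -> : eta * B * (1 + S) = C * A * beta * (eta * (t - a)) + A * k * eta * (t - a + S) +
  eta * (C * A * beta * (1 + (t - a + 1) * S) + A * k * (1 + (t - a) * S)) by rewrite /B; ring.
rewrite lerDl; move: (t - a) (ltW ta0) (ltW A0) (ltW eta0) => L L0 A0' eta0'.
by rewrite !(mulr_ge0, addr_ge0).
Unshelve. all: by end_near. Qed.

End path_expansion.

(** * Exit times and passage to the limit *)

Section vector_valued_measurability.
Context {R : realType} {d : nat} {disp : measure_display} {T : measurableType disp}.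
Variable Y : T -> 'rV[R]_d.
Hypothesis mY : forall i, measurable_fun setT (fun o => Y o 0 i).

Lemma measurable_box (z : 'rV[R]_d) (r : R) : measurable (Y @^-1` ball z r).
Proof.
have [r0|r0] := leP r 0.
  have -> : Y @^-1` ball z r = set0; last exact: measurable0.
  by apply/seteqP; split => // om [+ _]; rewrite ltNge r0.
have -> : Y @^-1` ball z r =
    \bigcap_(i in [set: 'I_d]) ((fun o => Y o 0 i) @^-1` `]z 0 i - r, z 0 i + r[).
  apply/seteqP; split => om.
    move=> [_ h] i _ /=; rewrite in_itv/= -ltr_distl distrC; exact: h.
  move=> h; split => // i j; rewrite (ord1 i); have := h j Logic.I.
  by rewrite /= in_itv/= -ltr_distl distrC.
apply: fin_bigcap_measurable => // i _.
rewrite -[X in measurable X]setTI; exact: mY.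
Qed.

(** Adaptedness is given coordinate by coordinate. An open set of row vectors is a countable union
    of balls with rational centres and radii [1 / n.+1], and a ball is a product of intervals. *)
Lemma measurable_continuous_comp (phi : 'rV[R]_d -> R) : continuous phi ->
  measurable_fun setT (phi \o Y).
Proof.
move=> cphi; apply: (measurability _ (RGenOpens.measurableE R)) => // _ [_ [a [b ->]] <-].
rewrite setTI; set O := phi @^-1` `]a, b[%classic.
have oO : open O by apply: open_comp => [x _|]; [exact: cphi|exact: interval_open].
have -> : (phi \o Y) @^-1` `]a, b[%classic = Y @^-1` O by [].
pose D : set ('rV[rat]_d * nat) := [set qn |
  ball (map_mx ratr qn.1 : 'rV[R]_d) qn.2.+1%:R^-1 `<=` O].
have -> : Y @^-1` O = \bigcup_qn (if qn \in D then
    Y @^-1` ball (map_mx ratr qn.1 : 'rV[R]_d) qn.2.+1%:R^-1 else set0).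
  apply/seteqP; split => om; last first.
    by move=> [qn _]; case: ifPn => //; rewrite inE => h; exact: h.
  move=> Oo; have /nbhs_ballP[r /= r0 hr] : nbhs (Y om) O by exact: open_nbhs_nbhs.
  have [n nr] : exists n, n.+1%:R^-1 < r / 2.
    by have := @near_infty_natSinv_lt R (PosNum (divr_gt0 r0 (ltr0Sn R 1))) => -[n _ /(_ n (leqnn n)) h]; exists n.
  have n0 : 0 < n.+1%:R^-1 :> R by rewrite invr_gt0.
  have hq i : exists q : rat, ratr q \in `](Y om 0 i) - n.+1%:R^-1, Y om 0 i + n.+1%:R^-1[.
    by apply: rat_in_itvoo; rewrite ltrD2l gt0_cp.
  have [q qE] := choice hq.
  exists (\row_i q i, n) => //.
  have qY i : `|ratr (q i) - Y om 0 i| < n.+1%:R^-1.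
    by have := qE i; rewrite in_itv/= ltr_distl.
  rewrite ifT; first by split => // i j; rewrite (ord1 i) /ball/= !mxE; exact: qY.
  rewrite inE => z [_ hz]; apply: hr; split => // i j.
  have := hz i j; rewrite (ord1 i) /ball/= !mxE => hzj; have hqj := qY j.
  rewrite (splitr r).
  have -> : Y om 0 j - z 0 j = (ratr (q j) - z 0 j) - (ratr (q j) - Y om 0 j) by ring.
  by apply: (le_lt_trans (ler_normB _ _)); rewrite ltrD// (lt_trans _ nr).
apply: countable_bigcupT_measurable; first exact: countableP.
move=> qn; case: ifP => _; [exact: measurable_box|exact: measurable0].
Qed.

End vector_valued_measurability.

Section stopped_expansion.
Context {R : realType} {d : nat} {disp : measure_display}
  {T : measurableType disp} (P : probability T R).
Local Notation mu := (@lebesgue_measure R).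
Local Notation E f := (Rintegral P setT f).
Local Notation J := ('I_d + 'I_d * 'I_d)%type.
Variables (t0 a t beta sigma K : R) (w Q : R -> T -> 'rV[R]_d) (N : nat).
Variables (f : R -> 'rV[R]_d -> R)
  (f1 : 'I_d -> R -> 'rV[R]_d -> R) (f2 : 'I_d -> 'I_d -> R -> 'rV[R]_d -> R)
  (ft c : R -> 'rV[R]_d -> R) (b : 'I_d -> R -> 'rV[R]_d -> R).
Hypotheses (hw : standard_Wiener P t0 w)
  (beq : backward_equation t0 beta sigma f f1 f2 ft c b)
  (t0a : t0 < a) (at_ : a < t) (beta_ge0 : 0 <= beta) (sigma_ge0 : 0 <= sigma)
  (N_gt0 : (0 < N)%N).
Hypothesis Q_adapted : forall s i, t0 <= s <= t ->
  adapted t w s (fun om => Q s om 0 i).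

Let h : R := (t - a) / N%:R.
Let grid k : R := path_grid t h k.

Let h0 : 0 < h. Proof. by rewrite divr_gt0 ?subr_gt0 ?ltr0n. Qed.

Let gridN : grid N = a.
Proof. by rewrite /grid /path_grid /h mulrC divfK ?pnatr_eq0 -?lt0n//; ring. Qed.

Let grid_int k : (k <= N)%N -> t0 <= grid k <= t.
Proof.
move=> kN; rewrite path_grid_le// andbT (le_trans (ltW t0a))// -gridN.
exact: path_grid_ge.
Qed.

Let grid_int' k : (k <= N)%N -> a <= grid k <= t.
Proof.
by move=> kN; rewrite path_grid_le// andbT -gridN; exact: path_grid_ge.
Qed.

Definition outside om k : bool := [exists i, K < `|Q (grid k) om 0 i|].

(** [find] returns the length [N] when no grid time of index below [N] is outside; since
    [grid N = a], a path that stays in the box is stopped at [a]. *)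
Definition exit_index om : nat := find (outside om) (iota 0 N).

Definition exit_time om : R := grid (exit_index om).

Lemma exit_index_le om : (exit_index om <= N)%N.
Proof. by rewrite (leq_trans (find_size _ _))// size_iota. Qed.

Lemma exit_index_outside om k : (k < N)%N -> outside om k -> (exit_index om <= k)%N.
Proof.
move=> kN ok; rewrite leqNgt; apply/negP => /(before_find 0%N).
by rewrite nth_iota// add0n ok.
Qed.

Lemma outside_exit_index om : (exit_index om < N)%N -> outside om (exit_index om).
Proof.
move=> nN; have := nN; rewrite -[X in (_ < X)%N](size_iota 0 N) -has_find => /(nth_find 0%N).
by rewrite nth_iota.
Qed.

Lemma before_exit om k : (k < exit_index om)%N -> forall i, `|Q (grid k) om 0 i| <= K.
Proof.
move=> kn i; rewrite leNgt; apply/negP => Ki.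
have kN : (k < N)%N by exact: leq_trans (exit_index_le om).
have /(exit_index_outside kN) : outside om k by apply/existsP; exists i.
by rewrite leqNgt kn.
Qed.

Lemma exit_time_int om : a <= exit_time om <= t.
Proof. exact/grid_int'/exit_index_le. Qed.

Lemma exit_time_inside om :
  (forall r i, a <= r <= t -> `|Q r om 0 i| <= K) -> exit_time om = a.
Proof.
move=> inK; rewrite /exit_time -gridN; congr grid; apply/eqP.
rewrite eqn_leq exit_index_le/= leqNgt; apply/negP => nN.
have /existsP[i] := outside_exit_index nN.
by rewrite ltNge inK// grid_int'// ltnW.
Qed.

Let Q_adapted_grid k i : (k <= N)%N -> adapted t w (grid k) (fun om => Q (grid k) om 0 i).
Proof. by move=> kN; apply: Q_adapted; exact: grid_int. Qed.

Lemma outside_measurable k : (k <= N)%N ->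
  backward_filtration w t (grid k) [set om | outside om k].
Proof.
move=> kN.
have -> : [set om | outside om k] = \bigcup_(i in [set: 'I_d])
    ((fun om => `|Q (grid k) om 0 i|) @^-1` `]K, +oo[%classic).
  apply/seteqP; split => om.
    by move=> /existsP[i Ki]; exists i => //=; rewrite in_itv/= Ki.
  by move=> [i _] /=; rewrite in_itv/= andbT => Ki; apply/existsP; exists i.
apply: (@fin_bigcup_measurable _ (backward_past t w (grid k))) => // i _.
have aQ : adapted t w (grid k) (fun om => `|Q (grid k) om 0 i|).
  exact: measurableT_comp (@normr_measurable R setT) (Q_adapted_grid i kN).
by move/adaptedP: aQ; exact.
Qed.

(** For [s] after [a], being stopped by [s] means being outside at some grid time [grid k >= s], and
    that event already belongs to the smaller filtration at [grid k]. For [s <= a] the event is the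
    whole space. *)
Lemma exit_time_stopping : backward_stopping_time t0 w t exit_time.
Proof.
split=> [om|s /andP[t0s st]].
  by have /andP[h1 h2] := exit_time_int om; rewrite h2 andbT (le_trans (ltW t0a)).
have [sa|as_] := leP s a.
  have -> : [set om | s <= exit_time om] = setT.
    apply/seteqP; split => // om _ /=.
    by have /andP[h1 h2] := exit_time_int om; exact: le_trans h1.
  exact: (@measurableT _ (backward_past t w s)).
have -> : [set om | s <= exit_time om] =
  \bigcup_(k in [set: 'I_N]) (if s <= grid k then [set om | outside om k] else set0).
  apply/seteqP; split => om /=.
    move=> sn; have nN : (exit_index om < N)%N.
      rewrite ltn_neqAle exit_index_le andbT; apply/eqP => nN.
      by move: sn; rewrite /exit_time nN gridN leNgt as_.
    exists (Ordinal nN) => //=; rewrite ifT//; exact: outside_exit_index.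
  move=> [k _]; case: ifP => // sk ok; apply: (le_trans sk).
  by apply: path_grid_ge => //; exact: exit_index_outside.
apply: (@fin_bigcup_measurable _ (backward_past t w s)) => // k _.
case: ifP => sk; last exact: (@measurable0 _ (backward_past t w s)).
apply: (backward_filtration_subset sk); apply: outside_measurable; exact: ltnW.
Qed.

Definition before om k : R := (k < exit_index om)%N%:R.

Lemma before_adapted k : (k < N)%N -> adapted t w (grid k) (before^~ k).
Proof.
move=> kN.
pose A := \bigcap_(j in [set: 'I_k.+1]) ~` [set om | outside om j].
have mA : measurable (A : set (backward_past t w (grid k))).
  apply: fin_bigcap_measurable => // j _; apply: measurableC.
  apply: (@backward_filtration_subset _ _ _ _ _ _ (grid j)); last first.
    by apply: outside_measurable; rewrite (leq_trans _ (ltnW kN))// -ltnS.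
  by apply: path_grid_ge => //; rewrite -ltnS.
have -> : (before^~ k) = \1_A :> (backward_past t w (grid k) -> R).
  apply/funext => om; rewrite indicE /before; congr (_%:R); congr nat_of_bool.
  apply/idP/idP => [kn|].
    rewrite inE => j _ /= oj; have jk : (j <= k)%N by rewrite -ltnS.
    have := exit_index_outside (leq_ltn_trans jk kN) oj.
    by rewrite leqNgt (leq_ltn_trans jk kn).
  rewrite inE => Aom; rewrite ltnNge; apply/negP => nk.
  have nk' : (exit_index om < k.+1)%N by rewrite ltnS.
  apply: (Aom (Ordinal nk') Logic.I) => /=.
  by apply: outside_exit_index; exact: leq_ltn_trans kN.
exact: measurable_indic.
Qed.

(** Indexed to match [noise]; a pair [(i, j)] with [i < j] gets 0 because the expansion lists each
    mixed term once, with [j < i]. *)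
Definition coefficient om k (j : J) : R :=
  match j with
  | inl i => - sigma * f1 i (grid k) (Q (grid k) om)
  | inr (i, j) =>
      if i == j then sigma ^+ 2 / 2 * f2 i i (grid k) (Q (grid k) om)
      else if (j < i)%N then sigma ^+ 2 * f2 i j (grid k) (Q (grid k) om) else 0
  end.

Definition stopped_coefficient k j om : R :=
  before om k * discount t beta c (Q^~ om) h k * coefficient om k j.

Definition stopped_main om : R :=
  \sum_(k < exit_index om) discount t beta c (Q^~ om) h k *
    path_main t sigma f1 f2 (Q^~ om) (w^~ om) h k.

Lemma coefficient_main om k :
  \sum_j coefficient om k j * noise w (grid k.+1) (grid k) j om =
  path_main t sigma f1 f2 (Q^~ om) (w^~ om) h k.
Proof.
rewrite big_sumType /path_main /step_main -[RHS]addrA; congr (_ + _).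
transitivity (\sum_i \sum_j coefficient om k (inr (i, j)) *
    noise w (grid k.+1) (grid k) (inr (i, j)) om).
  by rewrite pair_big; apply: eq_bigr => -[i j] _.
rewrite -big_split; apply: eq_bigr => i _.
rewrite (bigD1 i)//= eqxx; congr (_ * _ + _).
  by rewrite /increment /grid path_gridS; congr (_ - _); ring.
rewrite [RHS]big_mkcond/= [RHS](bigD1 i)//= ltnn add0r; apply: eq_bigr => j ji.
by rewrite eq_sym (negbTE ji); case: ifP => _; rewrite ?mul0r// /increment; ring.
Qed.

(** The factor [before] turns a sum of random length into a transform with [N] steps; it is adapted
    at the later end of its step, so the noise stays centred. *)
Lemma transform_main om :
  transform w grid stopped_coefficient N om = stopped_main om.
Proof.
rewrite /transform /stopped_main.
rewrite (big_ord_widen N (fun k => discount t beta c (Q^~ om) h k *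
    path_main t sigma f1 f2 (Q^~ om) (w^~ om) h k) (exit_index_le om)).
rewrite [RHS]big_mkcond/=; apply: eq_bigr => k _.
rewrite -coefficient_main /stopped_coefficient /before.
under eq_bigr do rewrite -mulrA; rewrite -mulr_sumr.
by case: ifP => _; rewrite ?mul1r ?mul0r.
Qed.

Let at_grid_adapted k g : (k <= N)%N -> continuous_after t0 g ->
  adapted t w (grid k) (fun om => g (grid k) (Q (grid k) om)).
Proof.
move=> kN cg.
have cgk : continuous (g (grid k)).
  move=> y; have t0k : t0 < grid k.
    by have /andP[ak _] := grid_int' kN; exact: lt_le_trans ak.
  apply: (@cvg_comp _ _ _ (fun y => (grid k, y)) (fun z : R * 'rV[R]_d => g z.1 z.2)
    _ (nbhs (grid k, y))); last exact: (cg (grid k, y)).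
  exact: (@cvg_pair _ _ _ _ (nbhs (grid k)) (nbhs y) _ _ _ (fun=> grid k) id
    (cvg_cst _) cvg_id).
apply: (@measurable_continuous_comp _ _ _ (backward_past t w (grid k))
  (fun om => Q (grid k) om) _ _ cgk) => i.
exact: Q_adapted_grid.
Qed.

Lemma stopped_coefficient_adapted k j : (k < N)%N ->
  adapted t w (grid k) (stopped_coefficient k j).
Proof.
move=> kN.
apply: measurable_funM; first apply: measurable_funM.
- exact: before_adapted.
- apply: measurableT_comp => //; apply: measurable_funM; first exact: measurable_cst.
  apply: measurable_sum => i; apply: measurable_funM; first exact: measurable_cst.
  have ik : (i <= k)%N by exact: ltnW.
  apply: (@adapted_subset _ _ _ _ _ _ (grid i)); first exact: path_grid_ge.
  apply: at_grid_adapted (beq_c beq); exact: leq_trans (ltnW kN).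
- case: j => [i|[i j]] /=.
    apply: measurable_funM; first exact: measurable_cst.
    by apply: at_grid_adapted; [exact: ltnW|apply: (beq_f1 beq)].
  case: (i == j); last (case: (j < i)%N; last exact: measurable_cst).
    apply: measurable_funM; first exact: measurable_cst.
    by apply: at_grid_adapted; [exact: ltnW|apply: (beq_f2 beq)].
  apply: measurable_funM; first exact: measurable_cst.
  by apply: at_grid_adapted; [exact: ltnW|apply: (beq_f2 beq)].
Qed.

Definition stopped_coefficient_bound (C : R) : R :=
  expR (beta * (C * (t - a))) * ((sigma + sigma ^+ 2) * C).

(** When [before] is nonzero, all grid points up to [k] lie in the box, which bounds the
    coefficients and also the Riemann sum in the discount. *)
Lemma stopped_coefficient_bounded C k j om : 1 <= C ->
  (forall s (y : 'rV[R]_d), a <= s <= t -> (forall i, `|y 0 i| <= K) ->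
  [/\ `|f s y| <= C, `|c s y| <= C, forall i, `|b i s y| <= C,
      forall i, `|f1 i s y| <= C & forall i j, `|f2 i j s y| <= C]) ->
  (k < N)%N -> `|stopped_coefficient k j om| <= stopped_coefficient_bound C.
Proof.
move=> C1 bC kN; have C0 : 0 <= C by exact: le_trans ler01 _.
have s20 := sqr_ge0 sigma.
have B0 : 0 <= stopped_coefficient_bound C.
  by rewrite !(mulr_ge0, addr_ge0)// expR_ge0.
rewrite /stopped_coefficient /before; case: ltnP => kn; last by rewrite !mul0r normr0.
rewrite mul1r normrM; apply: ler_pM => //.
  rewrite ger0_norm ?expR_ge0// ler_expR ler_wpM2l//.
  apply: (@le_trans _ _ (\sum_(j < k) h * C)).
    apply: ler_sum => i _; rewrite ler_wpM2l ?(ltW h0)//.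
    apply: le_trans (ler_norm _) _.
    have ik : (i < k)%N by [].
    have [] // := bC (grid i) (Q (grid i) om).
      by apply: grid_int'; exact: ltnW (ltn_trans ik kN).
    by apply: before_exit; exact: ltn_trans kn.
  rewrite sumr_const card_ord -mulr_natl.
  have -> : k%:R * (h * C) = C * (k%:R * h) by ring.
  rewrite ler_wpM2l//; have := grid_int' (ltnW kN); rewrite /grid /path_grid => /andP[+ _]; lra.
have [_ _ _ f1C f2C] := bC (grid k) (Q (grid k) om) (grid_int' (ltnW kN)) (before_exit kn).
have sC : sigma * C <= (sigma + sigma ^+ 2) * C by rewrite ler_wpM2r// lerDl.
have s2C : sigma ^+ 2 * C <= (sigma + sigma ^+ 2) * C by rewrite ler_wpM2r// lerDr.
case: j => [i|[i j]] /=.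
  by rewrite normrM normrN (ger0_norm sigma_ge0) (le_trans _ sC)// ler_wpM2l.
case: ifP => _; last case: ifP => _.
- rewrite normrM ger0_norm ?mulr_ge0//; apply: (le_trans _ s2C); apply: ler_pM => //.
    by rewrite mulr_ge0.
  by rewrite ler_pdivrMr// ler_peMr//; rewrite ler1n.
- by rewrite normrM ger0_norm// (le_trans _ s2C)// ler_wpM2l.
- by rewrite normr0; apply: le_trans s2C; rewrite mulr_ge0.
Qed.

Definition square_variation om : R :=
  \sum_(k < N) \sum_i (w (grid k) om 0 i - w (grid k.+1) om 0 i) ^+ 2.

Lemma square_variation_mean : L1 P square_variation /\ E square_variation = d%:R * (t - a).
Proof.
have S k : (k < N)%N -> L1 P (fun om => \sum_i increment w (grid k.+1) (grid k) i om ^+ 2) /\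
  E (fun om => \sum_i increment w (grid k.+1) (grid k) i om ^+ 2) = d%:R * h.
  move=> kN; have /andP[t0k _] := grid_int kN; have /andP[_ kt] := grid_int (ltnW kN).
  have kk : grid k.+1 < grid k by rewrite /grid path_gridS gtrBl.
  have [L ->] := Er_sum_increment_sqr hw t0k kk; split => //.
  by congr (_ * _); rewrite /grid path_gridS; ring.
split; first by apply: L1_sum => k; have [] := S k (ltn_ord k).
rewrite Er_sum => [|k]; last by have [] := S k (ltn_ord k).
rewrite (eq_bigr (fun=> d%:R * h)) => [|k _]; last by have [] := S k (ltn_ord k).
rewrite sumr_const card_ord -mulr_natl /h; field.
by rewrite pnatr_eq0 -lt0n.
Qed.

(** Free of [N]: summing [transform_bound] over the steps uses [N * h = t - a] and [h <= t - a]. *)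
Definition stopped_main_bound (C : R) : R :=
  (stopped_coefficient_bound C * #|{: J}|%:R) ^+ 2 * ((t - a) + 3 * (t - a) ^+ 2).

Lemma stopped_main_moments C : 1 <= C ->
  (forall s (y : 'rV[R]_d), a <= s <= t -> (forall i, `|y 0 i| <= K) ->
  [/\ `|f s y| <= C, `|c s y| <= C, forall i, `|b i s y| <= C,
      forall i, `|f1 i s y| <= C & forall i j, `|f2 i j s y| <= C]) ->
  [/\ L1 P stopped_main, E stopped_main = 0,
      L1 P (fun om => stopped_main om ^+ 2) &
      E (fun om => stopped_main om ^+ 2) <= stopped_main_bound C].
Proof.
move=> C1 bC.
have st k : grid k - grid k.+1 = h by rewrite /grid path_gridS; ring.
have t0N : t0 <= grid N by rewrite gridN ltW.
have g0 : grid 0 <= t by exact: path_grid_le.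
have [] := transform_moments hw h0 st t0N g0
  (fun k j => @stopped_coefficient_adapted k j)
  (fun k j om => @stopped_coefficient_bounded C k j om C1 bC) (leqnn N).
have -> : transform w grid stopped_coefficient N = stopped_main.
  by apply/funext => om; exact: transform_main.
move=> L1V EV L2V E2V; split => //; apply: (le_trans E2V).
rewrite /transform_bound /stopped_main_bound.
set B := (_ * _) ^+ 2; have B0 : 0 <= B by exact: sqr_ge0.
have hN : N%:R * h = t - a by rewrite /h mulrC divfK// pnatr_eq0 -lt0n.
have ht : h <= t - a.
  by rewrite -hN ler_peMl ?(ltW h0)// ler1n.
have -> : N%:R * (B * (h + 3 * h ^+ 2)) = B * (N%:R * h + 3 * (N%:R * h * h)) by ring.
rewrite hN ler_wpM2l// lerD2l ler_wpM2l// expr2 ler_wpM2l// subr_ge0; exact: ltW.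
Qed.

End stopped_expansion.

Lemma near_natSinv {R : realType} (L : R) (p : R -> Prop) : 0 < L ->
  (\forall h \near (0 : R)^'+, p h) -> \forall n \near \oo, p (L / n.+1%:R).
Proof.
move=> L0 /nbhs_ballP[dlt /= dlt0 hd].
have dL0 : 0 < dlt / L by rewrite divr_gt0.
near=> n.
have hn : n.+1%:R^-1 < dlt / L by near: n; exact: (near_infty_natSinv_lt (PosNum dL0)).
have h0 : 0 < L / n.+1%:R by rewrite divr_gt0.
apply: hd => //; rewrite /ball/= sub0r normrN gtr0_norm//.
by rewrite mulrC -ltr_pdivlMr.
Unshelve. all: by end_near. Qed.

Lemma start_stopping_time {R : realType} {d : nat} {disp : measure_display}
    {T : measurableType disp} (t0 t : R) (w : R -> T -> 'rV[R]_d) : t0 <= t ->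
  backward_stopping_time t0 w t (fun=> t0).
Proof.
move=> t0t; split=> [om|s /andP[t0s st]]; first by rewrite lexx.
have [st0|t0s'] := leP s t0.
  have -> : [set _ : T | true] = setT by apply/seteqP; split.
  exact: (@measurableT _ (backward_past t w s)).
have -> : [set _ : T | false] = set0 by apply/seteqP; split.
exact: (@measurable0 _ (backward_past t w s)).
Qed.

Section stopped_limit.
Context {R : realType} {d : nat} {disp : measure_display}
  {T : measurableType disp} (P : probability T R).
Local Notation mu := (@lebesgue_measure R).
Local Notation E f := (Rintegral P setT f).
Variables (t0 t beta sigma : R) (w Q : R -> T -> 'rV[R]_d) (q : 'rV[R]_d).
Variables (f : R -> 'rV[R]_d -> R)
  (f1 : 'I_d -> R -> 'rV[R]_d -> R) (f2 : 'I_d -> 'I_d -> R -> 'rV[R]_d -> R)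
  (ft c : R -> 'rV[R]_d -> R) (b : 'I_d -> R -> 'rV[R]_d -> R)
  (M : R -> T -> R).
Hypotheses (hw : standard_Wiener P t0 w)
  (beq : backward_equation t0 beta sigma f f1 f2 ft c b)
  (t0t : t0 < t) (beta_ge0 : 0 <= beta) (sigma_ge0 : 0 <= sigma).
Hypothesis Q_adapted : forall s i, t0 <= s <= t ->
  adapted t w s (fun om => Q s om 0 i).
Hypotheses
  (Q_continuous : forall om, {within `[t0, t], continuous (Q^~ om)})
  (Q_equation : {ae P, forall om, forall u s i, t0 < u -> u <= s -> s <= t ->
    Q u om 0 i - Q s om 0 i = - (\int[mu]_(r in `[u, s]) b i r (Q r om)) -
      sigma * (w s om 0 i - w u om 0 i)})
  (Q_end : {ae P, forall om, Q t om = q})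
  (M_after : forall s om, t0 < s <= t -> M s om = Feynman_Kac t beta f c (Q^~ om) s)
  (M_start : forall om, M s om @[s --> t0^'+] --> M t0 om)
  (M_class_D : class_D P t0 w t M).

Let stopped_L1 tau : backward_stopping_time t0 w t tau -> L1 P (fun om => M (tau om) om).
Proof. by move=> htau; have [h _] := M_class_D; apply: h; exists tau. Qed.

(** Optional stopping in the limit of vanishing mesh, for a fixed box: the transform has mean 0, and
    the mean of the remainder tends to 0 by [ratio_cvg_expectation]. *)
Lemma exit_expectation_cvg (a K : R) : t0 < a -> a < t ->
  E (fun om => M (exit_time a t K Q N.+1 om) om) @[N --> \oo] --> f t q.
Proof.
move=> t0a at_.
have [C C1 bC] := coefficients_bounded t beq t0a K.
pose V N := stopped_main a t beta sigma K w Q N.+1 f1 f2 c.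
pose Y N om := M (exit_time a t K Q N.+1 om) om.
pose W N om := 1 + square_variation a t w N.+1 om.
have Ystop N : backward_stopping_time t0 w t (exit_time a t K Q N.+1).
  exact: exit_time_stopping.
have LY N : L1 P (Y N) by exact: stopped_L1.
have VM N := @stopped_main_moments _ _ _ _ P _ _ _ _ _ K w Q N.+1 _ _ _ _ _ _
  hw beq t0a at_ beta_ge0 sigma_ge0 (ltn0Sn N) Q_adapted C C1 bC.
have LV N : L1 P (V N) by have [] := VM N.
have SM N := square_variation_mean (N := N.+1) hw t0a at_ isT.
have LW N : L1 P (W N) by apply: L1D; [exact: L1_cst|have [] := SM N].
have LNV N : L1 P (fun om => -1 * V N om) by exact: L1Z.
(* Written with sums only, so that [eacD] applies; as [V N] is centred, the mean of [X N] is the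
   error to be estimated. *)
pose X N om := (Y N om + -1 * V N om) + - f t q.
have XE N : E (X N) = E (Y N) - f t q.
  rewrite ErD ?Er_cst//; [|exact: L1D|exact: L1_cst].
  by rewrite ErD// ErZ//; have [_ -> _ _] := VM N; rewrite mulr0 addr0.
have X0 : E (X N) @[N --> \oo] --> (0 : R).
  apply: (@ratio_cvg_expectation _ _ _ P X W (1 + d%:R * (t - a))) => //.
  - by move=> N; apply: L1D; [exact: L1D|exact: L1_cst].
  - by move=> N om; rewrite lerDl; do 2!apply: sumr_ge0 => ? _; exact: sqr_ge0.
  - move=> N; rewrite ErD; [|exact: L1_cst|by have [] := SM N].
    by rewrite Er_cst; have [_ ->] := SM N.
  - apply: eacD.
    + by move=> N; exact: L1D.
    + by move=> N; exact: L1_cst.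
    + apply: eacD => //.
      * by apply: (uniformly_integrable_eac M_class_D) => N; exists (exit_time a t K Q N.+1).
      * apply: (@square_bounded_eac _ _ _ P _ (stopped_main_bound a t beta sigma C)).
        - by move=> N; exact: L1_measurable (LNV N).
        - move=> N; have [_ _ LV2 _] := VM N.
          have -> : (fun om => (-1 * V N om) ^+ 2) = (fun om => V N om ^+ 2); last exact: LV2.
          by apply/funext => om; ring.
        - move=> N; have [_ _ _ EV2] := VM N.
          have -> : (fun om => (-1 * V N om) ^+ 2) = (fun om => V N om ^+ 2); last exact: EV2.
          by apply/funext => om; ring.
    + apply: (@square_bounded_eac _ _ _ P _ ((- f t q) ^+ 2)).
      * by move=> N; exact: measurable_cst.
      * by move=> N; exact: L1_cst.
      * by move=> N; rewrite Er_cst.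
  - have [_ _ hwc _ _] := hw.
    apply: filterS3 hwc Q_equation Q_end => om cw eq Qq.
    have cx : {within `[a, t], continuous (Q^~ om)}.
      apply: continuous_subspaceW (@Q_continuous om) => r /=.
      by rewrite !in_itv/= => /andP[ar ->]; rewrite andbT (le_trans (ltW t0a)).
    have cw' : {within `[a, t], continuous (w^~ om)}.
      apply: continuous_subspaceW cw => r /=; rewrite !in_itv/= andbT => /andP[ar _].
      exact: le_trans (ltW t0a) ar.
    have xE u s i : a <= u -> u <= s -> s <= t -> Q u om 0 i - Q s om 0 i =
        - (\int[mu]_(r in `[u, s]) b i r (Q r om)) - sigma * (w s om 0 i - w u om 0 i).
      by move=> au; apply: eq; exact: lt_le_trans au.
    apply/cvgrPdist_le => e e0.
    have ta0 : 0 < t - a by rewrite subr_gt0.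
    (* The threshold [N0] depends on the path, so the limit obtained here is only pathwise. *)
    have [N0 _ pe] := near_natSinv ta0
      (near_path_expansion beq t0a at_ beta_ge0 sigma_ge0 cx cw' xE e0).
    exists N0 => // N N0N.
    have W1 : 1 <= W N om.
      by rewrite lerDl; do 2!apply: sumr_ge0 => ? _; exact: sqr_ge0.
    have W0 : 0 < W N om by exact: lt_le_trans W1.
    rewrite sub0r normrN normrM normfV (gtr0_norm W0) ler_pdivrMr//.
    have /andP[an tn] := exit_time_int K Q at_ (ltn0Sn N) om.
    have XomE : X N om = Feynman_Kac t beta f c (Q^~ om) (exit_time a t K Q N.+1 om) -
        f t (Q t om) - V N om.
      by rewrite /X /Y M_after ?Qq ?(lt_le_trans t0a)//; ring.
    rewrite XomE; apply: (le_trans (pe N N0N _ an)).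
    rewrite ler_wpM2l ?(ltW e0)// lerD2l.
    have nN := exit_index_le a t K Q N.+1 om.
    (* The squares up to the exit are part of the squares over the whole grid, whose mean is
       known. *)
    pose F k : R := \sum_i (w (path_grid t ((t - a) / N.+1%:R) k) om 0 i -
      w (path_grid t ((t - a) / N.+1%:R) k.+1) om 0 i) ^+ 2.
    rewrite (big_ord_widen _ F nN) big_mkcond/=.
    apply: ler_sum => k _; case: ifP => // _.
    by apply: sumr_ge0 => i _; exact: sqr_ge0.
have -> : (fun N => E (fun om => M (exit_time a t K Q N.+1 om) om)) = (fun N => E (X N) + f t q).
  by apply/funext => N; rewrite XE subrK.
rewrite -[X in _ --> X]add0r; apply: cvgD => //; exact: cvg_cst.
Qed.

(** A diagonal choice: the [m]-th stopping time uses the box of size [m], a start [a m] tending to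
    [t0], and a grid fine enough for error [1 / m.+1]. The stopped means then tend both to [f t q]
    and to the mean of [M t0]. *)
Lemma start_expectation : E (M t0) = f t q.
Proof.
(* The shift by 2 gives [a m < t] already for [m = 0]. *)
pose a m := t0 + (t - t0) / m.+2%:R.
have tt0 : 0 < t - t0 by rewrite subr_gt0.
have t0a m : t0 < a m by rewrite ltrDl divr_gt0.
have at_ m : a m < t.
  by rewrite /a -ltrBrDl ltr_pdivrMr// ltr_pMr// ltr1n.
have hN m : exists N : nat,
    `|f t q - E (fun om => M (exit_time (a m) t m%:R Q N.+1 om) om)| <= m.+1%:R^-1.
  have m0 : 0 < m.+1%:R^-1 :> R by rewrite invr_gt0.
  have /cvgrPdist_le/(_ _ m0)[N _ hN] := exit_expectation_cvg m%:R (t0a m) (at_ m).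
  by exists N; apply: hN => /=.
have [N {}hN] := choice hN.
pose tau m := exit_time (a m) t m%:R Q (N m).+1.
have tau_stop m : backward_stopping_time t0 w t (tau m).
  by apply: exit_time_stopping.
have t0_stop := start_stopping_time w (ltW t0t).
pose Y m om := M (tau m om) om.
have LY m : L1 P (Y m) by exact: stopped_L1.
have L0 : L1 P (M t0) by exact: stopped_L1 t0_stop.
have LN : L1 P (fun om => -1 * M t0 om) by exact: L1Z.
pose X m om := Y m om + -1 * M t0 om.
have XE m : E (X m) = E (Y m) - E (M t0).
  by rewrite ErD// ErZ//; ring.
(* With the constant weight 1 the ratio criterion is Vitali's convergence theorem. *)
have X0 : E (X m) @[m --> \oo] --> (0 : R).
  apply: (@ratio_cvg_expectation _ _ _ P X (fun=> fun=> 1) 1) => //.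
  - by move=> m; exact: L1D.
  - by move=> m; exact: L1_cst.
  - by move=> m; rewrite Er_cst.
  - apply: eacD => //.
      by apply: (uniformly_integrable_eac M_class_D) => m; exists (tau m).
    have eM : equi_absolutely_continuous P (fun _ : nat => M t0).
      by apply: (uniformly_integrable_eac M_class_D) => _; exists (fun=> t0).
    move=> e e0; have [dlt dlt0 hd] := eM e e0; exists dlt => // i A mA PA.
    have := hd i A mA PA.
    have -> : (fun om => \1_A om * `|-1 * M t0 om|) = (fun om => \1_A om * `|M t0 om|); last by [].
    by apply/funext => om; rewrite mulN1r normrN.
  - apply: aeW => om.
    have -> : (fun m => X m om / 1) = (fun m => Y m om + - M t0 om).
      by apply/funext => m; rewrite divr1 /X mulN1r.
    rewrite -[X in _ --> X](subrr (M t0 om)); apply: cvgB; last exact: cvg_cst.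
    (* A continuous path is bounded on [[t0, t]], so for large [m] it never leaves the box and is
       stopped exactly at [a m]. *)
    have [K hK] := path_bounded (@Q_continuous om).
    have near_start : \forall m \near \oo, M (a m) om = Y m om.
      near=> m.
      have Km : K <= m%:R by near: m; exact: nbhs_infty_ger.
      rewrite /Y /tau exit_time_inside// => r i /andP[ar rt].
      by apply: le_trans Km; apply: hK; rewrite rt andbT (le_trans (ltW (t0a m))).
    apply: cvg_trans (near_eq_cvg near_start) _.
    apply: (@cvg_comp _ _ _ a (M^~ om) _ t0^'+); last exact: M_start.
    move=> p [e /= e0 hp].
    have : \forall h \near (0 : R)^'+, p (t0 + h).
      exists e => //= h; rewrite /ball_/= sub0r normrN => he h0.
      apply: hp; rewrite /ball_/= ?ltrDl//.
      by have -> : t0 - (t0 + h) = - h by [ring]; rewrite normrN.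
    move=> /(@near_natSinv _ _ (fun h => p (t0 + h)) tt0)[n _ hn]; exists n => // m /= nm.
    by apply: (hn m.+1); exact: leqW.
have YE : (fun m => E (Y m)) = (fun m => E (X m) + E (M t0)).
  by apply/funext => m; rewrite XE subrK.
have Y1 : E (Y m) @[m --> \oo] --> E (M t0).
  by rewrite YE -[X in _ --> X]add0r; apply: cvgD => //; exact: cvg_cst.
have Y2 : E (Y m) @[m --> \oo] --> f t q.
  apply/cvgrPdist_le => e e0; near=> m.
  apply: (le_trans (hN m)); apply: ltW.
  by near: m; exact: (near_infty_natSinv_lt (PosNum e0)).
exact: cvg_unique Y1 Y2.
Unshelve. all: by end_near. Qed.

End stopped_limit.

(** * The process of the theorem near the initial time, and the conclusion *)

Section process_along_paths.
Context {R : realType} {d : nat}.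
Local Notation leb := (@lebesgue_measure R).
Variables (t0 t : R) (x : R -> 'rV[R]_d).
Hypotheses (t0t : t0 < t) (cx : {within `[t0, t], continuous x}).

Lemma jointly_continuous_along (g : R -> 'rV[R]_d -> R) :
  jointly_continuous `[t0, +oo[ g -> {within `[t0, t], continuous (fun r => g r (x r))}.
Proof.
move=> /subspace_continuousP cg; apply/subspace_continuousP => s As.
have t0s : `[t0, +oo[%classic s.
  by move: As; rewrite /= !in_itv/= andbT => /andP[].
have /subspace_continuousP/(_ s As) cxs := cx.
apply: cvg_trans (cg (s, x s) t0s) => B /= nB.
have cp : (r, x r) @[r --> within `[t0, t]%classic (nbhs s)] --> (s, x s).
  exact: (@cvg_pair _ _ _ _ (nbhs s) (nbhs (x s)) _ _ _ id x (cvg_within _) cxs).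
have /= cB := cp _ nB.
have hA : within `[t0, t]%classic (nbhs s) `[t0, t]%classic by exact: withinT.
apply: filterS2 hA cB => r Ar; apply.
by move: Ar; rewrite /= !in_itv/= andbT => /andP[].
Qed.

Variables (U dU : R -> 'rV[R]_d -> R).
Hypotheses (cdU : jointly_continuous `[t0, +oo[ dU)
  (DU : forall s y, t0 < s -> is_derive s (1 : R) (U^~ y) (dU s y)).

Lemma time_derivE s y : t0 < s -> time_deriv U s y = dU s y.
Proof.
by move=> t0s; rewrite /time_deriv derive1E; exact: (@derive_val _ _ _ _ _ _ _ (DU y t0s)).
Qed.

(** The two integrands may differ at [t0] only, where the two-sided derivative carries no
    information; removing the left endpoint of the interval leaves the integral unchanged. *)
Lemma Rintegral_time_deriv s : t0 <= s <= t ->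
  \int[leb]_(r in `[s, t]) time_deriv U r (x r) = \int[leb]_(r in `[s, t]) dU r (x r).
Proof.
move=> /andP[t0s st].
have cs : {within `[s, t], continuous (fun r => dU r (x r))}.
  exact: segment_subspace t0s (lexx t) (jointly_continuous_along cdU).
have io : leb.-integrable `]s, t] (EFin \o (fun r => dU r (x r))).
  by apply: integrableS (segment_integrable cs) => //; exact: subset_itv_oc_cc.
have e : {in `]s, t]%classic, (fun r => dU r (x r)) =1 (fun r => time_deriv U r (x r))}.
  move=> r; rewrite inE/= in_itv/= => /andP[sr _].
  by rewrite time_derivE// (le_lt_trans t0s).
rewrite -(Rintegral_itv_obnd_cbnd io) -(@Rintegral_itv_obnd_cbnd _ _ _ _ _); last first.
  by apply: (@eq_integrable _ _ _ leb _ _ (EFin \o (fun r => dU r (x r))) _ _ io) => // r ri /=; rewrite e.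
by apply: eq_Rintegral => r ri; rewrite e.
Qed.

(** The difference is an integral over [[t0, s]], at most the supremum of [|g|] times [s - t0]. *)
Lemma Rintegral_start_continuous g : {within `[t0, t], continuous g} ->
  \int[leb]_(r in `[s, t]) g r @[s --> t0^'+] --> \int[leb]_(r in `[t0, t]) g r.
Proof.
move=> cg; have ck : compact (g @` `[t0, t]%classic).
  by apply: continuous_compact => //; exact: segment_compact.
have [M [_ hM]] := compact_bounded ck.
pose C := `|M| + 1; have C0 : 0 < C by rewrite /C ltr_wpDl.
have gC r : t0 <= r <= t -> `|g r| <= C.
  move=> hr; apply: hM; first by rewrite (le_lt_trans (ler_norm M))// ltrDl.
  by exists r => //=; rewrite in_itv.
apply/cvgrPdist_le => e e0; near=> s.
have t0s : t0 < s by near: s; exact: nbhs_right_gt.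
have st : s <= t by near: s; exact: nbhs_right_le.
have se : s <= t0 + e / C by near: s; apply: nbhs_right_le; rewrite ltrDl divr_gt0.
rewrite (@Rintegral_segmentD _ t0 t s) ?(ltW t0s)// addrK.
have := @Rintegral_segment_approx _ t0 s g 0 C (ltW t0s)
  (segment_subspace (lexx t0) st cg).
rewrite mul0r subr0 => H; apply: (le_trans (H _)).
  by move=> r /andP[t0r rs]; rewrite subr0 gC// t0r (le_trans rs).
by rewrite mulrC -ler_pdivlMr// lerBlDl.
Unshelve. all: by end_near. Qed.

End process_along_paths.

Theorem proposition2p1 (R : realType) (d : nat) (hd : (0 < d)%N)
    (mu beta t0 : R) (hmu : 0 < mu) (hbeta : 0 < beta)
    (U : R -> 'rV[R]_d -> R)
    (hU_ge0 : forall s x, t0 <= s -> 0 <= U s x)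
    (hU_regular : regular_potential t0 U)
    (hU_confining : confining t0 U)
    (p : R -> 'rV[R]_d -> R)
    (hp_FP : Fokker_Planck_solution mu beta t0 U p)
    (hp_init : probability_density (p t0))
    (hp_integrable : integrable_in_space t0 p)
    (t : R) (ht : t0 <= t) (q : 'rV[R]_d)
    (disp : measure_display) (T : measurableType disp) (P : probability T R)
    (w : R -> T -> 'rV[R]_d) (hw : standard_Wiener P t0 w)
    (Q : R -> T -> 'rV[R]_d)
    (hQ : backward_diffusion P mu beta t0 U w t q Q)
    (hM : class_D P t0 w t (weighted_density beta U p t Q)) :
  (p t q)%:E =
  ((expR (- (beta * U t q)))%:E *
   'E_P[(fun o : T => p t0 (Q t0 o) *
          expR (beta * U t0 (Q t0 o) +
                beta * \int[lebesgue_measure]_(s in `[t0, t])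
                         time_deriv U s (Q s o)))%R])%E.
Proof.
have [cU [_ _ cU1 _] [dU cdU DU]] := hU_regular.
have [cp _ _ _] := hp_FP.
have [Qc Qa Qe] := hQ.
pose M := weighted_density beta U p t Q.
have Q_end : {ae P, forall om, Q t om = q}.
  apply: filterS Qe => om /(_ t); rewrite ht lexx => /(_ isT) ->.
  apply/rowP => i; rewrite !mxE set_itv1 Rintegral_set1 subrr mulr0; ring.
have LM : L1 P (M t0).
  have [h _] := hM; apply: h; exists (fun=> t0) => //.
  exact: start_stopping_time.
suff EM : Rintegral P setT (M t0) = weighted beta U p t q.
  have -> : (fun o : T => p t0 (Q t0 o) * expR (beta * U t0 (Q t0 o) +
      beta * \int[lebesgue_measure]_(s in `[t0, t]) time_deriv U s (Q s o))) = M t0.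
    by apply/funext => om; rewrite /M /weighted_density expRD; ring.
  rewrite unlock -(EFin_Er LM) EM /weighted -EFinM; congr EFin.
  by rewrite mulrA -expRD addNr expR0 mul1r.
(* For [t = t0] there is no interval to subdivide: [Q t = q] almost surely, and the integral over
   one point is 0. *)
have [tE|t0t] := eqVneq t0 t.
  apply: ErE; rewrite (@ae_eq_integral _ _ _ P setT (fun=> (weighted beta U p t q)%:E)) //.
  - by rewrite -(EFin_Er (L1_cst P _)) Er_cst.
  - by apply/measurable_EFinP; exact: L1_measurable LM.
  - apply: filterS Q_end => om Qq _; congr EFin; rewrite /M /weighted_density tE.
    by rewrite set_itv1 Rintegral_set1 mulr0 expR0 mul1r Qq.
have {}t0t : t0 < t by rewrite lt_neqAle t0t.
have [f1 [f2 [ft beq]]] := weighted_backward_equation hmu hbeta hU_regular hp_FP cdU DU.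
have after_le s : t0 < s <= t -> t0 <= s <= t by move=> /andP[/ltW -> ->].
apply: (start_expectation hw beq t0t (ltW hbeta) (sqrtr_ge0 _) _ Qc _ Q_end _ _ hM).
- by move=> s i t0st; apply/adaptedP => B mB; exact: Qa.
- apply: filterS Qe => om QE u s i t0u us st.
  have cb : {within `[u, t], continuous (fun r => mu * partial i (U r) (Q r om))}.
    have cQ : {within `[u, t], continuous (Q^~ om)}.
      apply: continuous_subspaceW (Qc om) => r /=.
      by rewrite !in_itv/= => /andP[ur ->]; rewrite andbT (le_trans (ltW t0u)).
    apply: (along_path_continuous t0u cQ (g := fun s x => mu * partial i (U s) x)).
    by move: (i); exact: (beq_b beq).
  (* The equation at [u] minus the equation at [s]: [q] and [w t] cancel, and the integrals differ
     by the one over [[u, s]]. *)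
  rewrite (QE u) ?(ltW t0u) ?(le_trans us)// (QE s) ?st ?(le_trans (ltW t0u))//.
  rewrite !mxE; under eq_Rintegral do rewrite mxE.
  under [X in _ - (_ - X - _)]eq_Rintegral do rewrite mxE.
  by rewrite (@Rintegral_segmentD _ u t s) ?us//; ring.
- move=> s om t0st; rewrite /weighted_density /Feynman_Kac.
  by rewrite (Rintegral_time_deriv (Qc om) cdU DU (after_le s t0st)) /weighted mulrA.
- move=> om.
  (* Continuity up to the initial time enters here, as a right limit at [t0] along each path. *)
  have along g : jointly_continuous `[t0, +oo[ g ->
      g s (Q s om) @[s --> t0^'+] --> g t0 (Q t0 om).
    move=> cg; have := jointly_continuous_along (Qc om) cg.
    by move=> /(continuous_within_itvP _ t0t)[].
  apply: cvgM; last exact: along.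
  apply: cvgM; last first.
    apply: (@cvg_comp _ _ _ (fun s => beta * U s (Q s om)) expR); last exact: continuous_expR.
    by apply: cvgMr; exact: along.
  apply: (@cvg_comp _ _ _ (fun s => beta * _) expR); last exact: continuous_expR.
  apply: cvgMr.
  rewrite (Rintegral_time_deriv (Qc om) cdU DU) ?lexx ?ltW//.
  have := Rintegral_start_continuous t0t (jointly_continuous_along (Qc om) cdU).
  apply: cvg_trans; apply: near_eq_cvg; near=> s.
  rewrite (Rintegral_time_deriv (Qc om) cdU DU)//; apply/andP; split.
    by apply: ltW; near: s; exact: nbhs_right_gt.
  by near: s; exact: nbhs_right_le.
Unshelve. all: by end_near. Qed.
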